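(* There exists an absolute constant $c>0$ such that every connected vertex-transitive graph on $n\ge 3$ vertices contains a cycle of length at least $c\cdot n^{9/14}$ and a path of length at least $c\cdot n^{9/14}$.
   Context: All graphs are finite, simple and undirected. The length of a path or cycle is its number of edges. A graph is vertex-transitive if its automorphism group acts transitively on its vertex set. *)

(* Defs.v *)
From HB Require Import structures.
From mathcomp Require Import all_boot all_order all_fingroup all_algebra.
From mathcomp Require Import reals exp.

Set Implicit Arguments.
Unset Strict Implicit.
Unset Printing Implicit Defensive.

(* A finite graph is given by its adjacency relation [e : rel T] on the finite
   type [T] of its vertices. *)

Definition simple_graph (T : finType) (e : rel T) : Prop :=
  symmetric e /\ irreflexive e.

Definition connected_graph (T : finType) (e : rel T) : Prop :=
  0 < #|T| /\ forall x y : T, connect e x y.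

Definition graph_aut (T : finType) (e : rel T) : {set {perm T}} :=
  [set s : {perm T} | [forall x, forall y, e (s x) (s y) == e x y]].

Lemma graph_autP (T : finType) (e : rel T) (s : {perm T}) :
  reflect (forall x y, e (s x) (s y) = e x y) (s \in graph_aut e).
Proof.
rewrite inE; apply: (iffP forallP) => [h x y | h x].
  exact/eqP/(forallP (h x)).
by apply/forallP => y; rewrite h.
Qed.

Lemma graph_aut_group_set (T : finType) (e : rel T) : group_set (graph_aut e).
Proof.
apply/group_setP; split=> [|s t /graph_autP hs /graph_autP ht].
  by apply/graph_autP => x y; rewrite !perm1.
by apply/graph_autP => x y; rewrite !permM ht hs.
Qed.

Canonical graph_aut_group (T : finType) (e : rel T) : {group {perm T}} :=
  Group (graph_aut_group_set e).

Definition vertex_transitive (T : finType) (e : rel T) : Prop :=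
  [transitive graph_aut e, on [set: T] | 'P].

(* [p] lists the vertices after the start [x], so the number of edges is
   [size p]. *)
Definition graph_path (T : finType) (e : rel T) (x : T) (p : seq T) : Prop :=
  path e x p /\ uniq (x :: p).

(* [ucycle e c] closes [c] up with the edge from its last to its first vertex,
   so the number of edges is [size c]; the bound on [size c] excludes the
   degenerate lists of at most two vertices, which [ucycle] accepts. *)
Definition graph_cycle (T : finType) (e : rel T) (c : seq T) : Prop :=
  ucycle e c /\ 3 <= size c.

(* Main.v *)
(* Let C be a longest cycle, of length L, in a connected vertex-transitive graph
   on n vertices. Averaging over automorphisms gives g with
   m = |C meet gC| <= L^2/n, and m >= 1 because there is no cut vertex. A
   smallest set Y separating C from gC satisfies |Y|^4 = O(m^5): by Menger there
   are |Y| disjoint C-gC paths, and if |Y|^4 exceeds a large multiple of m^5, then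
   the bipartite multigraph formed by these paths on the O(m) segments into which
   the common vertices cut C and gC is dense. Such a graph contains a pattern
   along which both cycles can be rerouted through each other, yielding two cycles
   of total length greater than 2L. Finally n = O(L|Y|): one side of Y containing
   C or gC has at most n/2 vertices, hence only O(L|Y|) of them since any two
   vertices lie on a common cycle; were n much larger than L|Y|, some
   automorphism would move that cycle off the side and off Y, although any two
   longest cycles meet. Altogether n^4 = O(L^4 m^5), so n^9 = O(L^4 (mn)^5)
   = O(L^14).

   The pattern is found in the extremal subgraph for e^4/(|P|+|Q|)^5, where P and Q
   are the sets of segments used on the two cycles and e is the number of edges.
   Its vertices are cut into pieces of comparable degree; walks of length four
   X - J - M - K - Y between pieces, taken two at a time in one class, close up to
   small structures, and two such structures chosen by Ramsey-type selection in
   two different middle cells combine to a valid rerouting. *)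
Require Import Defs.
From HB Require Import structures.
From mathcomp Require Import all_boot all_order all_fingroup all_algebra.
From mathcomp Require Import boolp reals exp.
From mathcomp Require Import zify lra.

Set Implicit Arguments.
Unset Strict Implicit.
Unset Printing Implicit Defensive.

(** * Rerouting words *)

(** A gain of length is automatic in a rerouting; the obstacle is connectivity. The kept arcs and
    the detours may close up into several tours instead of one, on either cycle, and this depends on
    the order of all ports. Pieces are therefore sorted into boundedly many intervals, the cells, so
    that an order pattern becomes a finite word, and whether a word gives one tour on both cycles is
    decided by computation. Some features of the arrangement of two structures can be prescribed;
    the rest is answered by choosing which structure sits in which middle cell.

    The exponents come from counting walks of length four. With v pieces of degree about D there are
    about v D^4 such walks, but only O(v^2) classes, since a class consists of the end pieces X and
    Y and bounded information. Hence D^4 >> v, that is e^4 >> v^5 for e = v D, makes repeated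
    classes the rule. The same inequality for subgraphs has exponent 5/4 > 1 and so forbids that
    many pieces send a fixed share of their edges into one cell; this spreads the ports over as many
    cells as the selection asks for. *)

Fixpoint consec (w : seq nat) : seq (nat * nat) :=
  if w is x :: y :: w' then (x, y) :: consec w' else [::].

Definition partner (v : seq nat) (p : nat) : nat :=
  let i := index p v in nth 0 v (if odd i then i.-1 else i.+1).

Definition flip (i : nat) : nat := if odd i then i.-1 else i.+1.

(* [w] and [v] list the same ports in their order along a first and a second
   cycle. In the first cycle the stretch between two consecutive ports
   [w_2k, w_2k+1] is deleted, so that the arcs kept join the consecutive pairs of
   [rot 1 w]; the ports of a consecutive pair of [v] are joined through the second
   cycle. A tour alternates arcs ([flip]) and these chords ([chord]), the ports
   being named by their positions in [rot 1 w]. *)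
Definition chord (w v : seq nat) (i : nat) : nat :=
  index (partner v (nth 0 (rot 1 w) i)) (rot 1 w).

Definition tour (w v : seq nat) : seq nat :=
  traject (fun i => chord w v (flip i)) 0 (size w)./2.

(* All arcs and chords together form one closed tour. *)
Definition single (w v : seq nat) : bool :=
  let s := tour w v in
  [&& chord w v (flip (last 0 s)) == 0, uniq (map half s) &
      uniq (map (fun i => (index (nth 0 (rot 1 w) (flip i)) v)./2) s)].

Definition two (p q : nat) (b : bool) : seq nat := if b then [:: p; q] else [:: q; p].
(** One orientation bit [o] serves both pairs, because walks of one class have equal orientations;
    [s] says which of the two pieces comes first in the cell. *)
Definition four (p1 p2 q1 q2 : nat) (o s : bool) : seq nat :=
  let P := two p1 p2 o in let Q := two q1 q2 o in if s then P ++ Q else Q ++ P.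

(* The port orders in the cells of X, M, Y on the first cycle and of J, K on the
   second. *)
Definition words := (seq nat * seq nat * seq nat * (seq nat * seq nat))%type.

(* Two walks X - J - M - K - Y of one class, with the shared ends X and Y: [tag]
   records which of their middle pieces J, M, K coincide, and the bits record the
   orders of the ports. *)
Definition color_words (tag : nat) (b1 b2 b3 b4 b5 b6 b7 b8 : bool) : words :=
  match tag with
  | 0 => (two 0 7 b1, four 1 2 6 5 b2 b3, two 3 4 b4,
          (four 0 1 7 6 b5 b6, four 2 3 5 4 b7 b8))
  | 1 => ([::], four 0 1 5 4 b1 b2, two 2 3 b3, (two 0 5 b4, four 1 2 4 3 b5 b6))
  | 2 => (two 2 3 b1, four 0 1 5 4 b2 b3, [::], (four 1 2 4 3 b4 b5, two 0 5 b6))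
  | 3 => (two 0 3 b1, two 1 2 b2, [::], (four 0 1 3 2 b3 b4, [::]))
  | 4 => ([::], two 1 2 b1, two 0 3 b2, ([::], four 0 1 3 2 b3 b4))
  | _ => ([::], four 0 1 3 2 b1 b2, [::], (two 0 3 b3, two 1 2 b4))
  end.

Definition wI (k : words) := let: (X, M, Y, _) := k in X ++ M ++ Y.
Definition wJ (k : words) := let: (_, (J, K)) := k in J ++ K.

(* Two structures of the same color are combined, the ports of the second one being
   shifted. [cross] tells whether their X and Y cells alternate, [region] how many
   of the two M cells precede the X and Y cells, and [asg] which structure uses the
   first M cell. *)
Definition arrI (cross : bool) (region : nat) (asg : bool) (k : words) : seq nat :=
  let: (X, M, Y, _) := k in
  let sh := map (addn (size (wI k))) in
  let R := if cross then X ++ sh X ++ Y ++ sh Y else X ++ Y ++ sh X ++ sh Y in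
  let M1 := if asg then M else sh M in
  let M2 := if asg then sh M else M in
  match region with 0 => R ++ M1 ++ M2 | 1 => M1 ++ R ++ M2 | _ => M1 ++ M2 ++ R end.

(* [sw] tells whether the J cell of the second structure comes first, and [par]
   whether its K cell is then in the same relative order. *)
Definition arrJ (par sw : bool) (k : words) : seq nat :=
  let: (_, (J, K)) := k in
  let sh := map (addn (size (wI k))) in
  (if sw then sh J ++ J else J ++ sh J) ++ (if sw == par then sh K ++ K else K ++ sh K).

Definition arr_ok (n : nat) (w v : seq nat) : bool :=
  [&& perm_eq w (iota 0 n), perm_eq v (iota 0 n), single w v & single v w].

(** The quantifiers record who controls what. [cross] and [par] are prescribed in advance for a
    color; the region of the middle cells and the order of the J cells are imposed from outside; the
    assignment [a] may answer them, since both structures will be available at both middle cells. *)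
Definition combos_ok (cross par : bool) (k : words) : bool :=
  all (fun r => all (fun sw => has (fun a =>
    arr_ok (size (wI k)).*2 (arrI cross r a k) (arrJ par sw k))
    [:: true; false]) [:: true; false]) [:: 0; 1; 2].

Definition even_blocks (k : words) : bool :=
  let: (X, M, Y, (J, K)) := k in all (fun s : seq nat => ~~ odd (size s)) [:: X; M; Y; J; K].

Definition wf_words (k : words) : bool :=
  [&& 0 < size (wI k), ~~ odd (size (wI k)), all (gtn (size (wI k))) (wI k ++ wJ k), even_blocks k &
   has (fun cr => has (fun pa => combos_ok cr pa k) [:: true; false]) [:: true; false]].

(** * Surgery on two cycles *)

Section Blocks.
Variables (T : eqType) (e : rel T) (x0 : T).

Definition block (b : seq T) := (b != [::]) && sorted e b.
Definition linked (b b' : seq T) := e (last x0 b) (head x0 b').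

Lemma path_flatten y b bs : path e y b -> (b == [::]) = false -> all block bs ->
  path linked b bs -> path e y (flatten (b :: bs)).
Proof.
elim: bs y b => [|b' bs IH] y b pb nb /=; first by rewrite cats0.
case: b' => [|z b'] //; case/andP => /andP[_ sb'] bbs /andP[lk pl].
rewrite cat_path pb /=.
have: path e (last y b) (z :: b').
  rewrite /=; move: lk sb'; rewrite /linked /=.
  by case: b nb {pb} => //= ? ? _ -> ->.
move=> pz; have := IH (last y b) (z :: b') pz (erefl _) bbs pl.
by rewrite /=.
Qed.

Lemma last_flatten y b bs : all block (b :: bs) -> last y (flatten (b :: bs)) = last x0 (last b bs).
Proof.
elim: bs y b => [|b' bs IH] y b /=.
  by rewrite andbT cats0; case: b.
case/and3P => _ bb' bbs; rewrite last_cat.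
by have := IH (last y b) b' => /=; rewrite bb' => /(_ bbs).
Qed.

Lemma cycle_flatten bs : all block bs -> path.cycle linked bs -> path.cycle e (flatten bs).
Proof.
case: bs => // b bs Hb; have := Hb; case: b Hb => // y b Hb /= /andP[sb bbs].
rewrite rcons_path => /andP[pl lk].
rewrite rcons_path; apply/andP; split.
  case: b sb pl Hb {lk} => [|z b] sb pl Hb.
    case: bs bbs pl {Hb} => //= b' bs; case: b' => // z b' /andP[/andP[_ sb'] bbs] /andP[lk pl].
    rewrite /= in sb'; have pz : path e y (z :: b') by rewrite /= sb' andbT; exact: lk.
    exact: (path_flatten pz _ bbs pl).
  have ps : path linked (z :: b) bs.
    by case: bs pl {bbs Hb} => //= b' bs /andP[]; rewrite /linked /= => -> ->.
  exact: (path_flatten sb _ bbs ps).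
by have /= := last_flatten y Hb => ->.
Qed.

End Blocks.

Definition slice (T : Type) (c : seq T) (i j : nat) : seq T := take (j - i).+1 (drop i c).

Section Slice.
Variables (T : eqType) (x0 : T).
Implicit Types c : seq T.

Lemma size_slice c i j : i <= j -> j < size c -> size (slice c i j) = (j - i).+1.
Proof. by move=> ij jc; rewrite /slice size_takel // size_drop; lia. Qed.

Lemma slice_cons c i j : i <= j -> j < size c -> exists s, slice c i j = nth x0 c i :: s.
Proof.
move=> ij jc; rewrite /slice (drop_nth x0) /=; last lia.
by eexists.
Qed.

Lemma head_slice c i j : i <= j -> j < size c -> head x0 (slice c i j) = nth x0 c i.
Proof. by move=> ij jc; case: (slice_cons ij jc) => s ->. Qed.

Lemma last_slice c i j : i <= j -> j < size c -> last x0 (slice c i j) = nth x0 c j.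
Proof.
move=> ij jc; rewrite -nth_last (size_slice ij jc) /= /slice nth_take // nth_drop.
by congr nth; lia.
Qed.

Lemma mem_slice c i j y : i <= j -> j < size c -> uniq c ->
  (y \in slice c i j) = (y \in c) && (i <= index y c <= j).
Proof.
move=> ij jc uc; apply/idP/idP => [|/and3P[yc iy yj]].
  move=> /(nthP x0)[k]; rewrite (size_slice ij jc) => kl <-.
  rewrite /slice nth_take // nth_drop mem_nth; last lia.
  by rewrite index_uniq //; lia.
apply/(nthP x0); exists (index y c - i); first by rewrite (size_slice ij jc); lia.
rewrite /slice nth_take ?nth_drop; last lia.
by rewrite subnKC // nth_index.
Qed.

Lemma slice_uniq c i j : uniq c -> uniq (slice c i j).
Proof. by move=> uc; rewrite take_uniq // drop_uniq. Qed.

Lemma slice_sorted (e : rel T) c i j : sorted e c -> sorted e (slice c i j).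
Proof. by move=> sc; rewrite take_sorted // drop_sorted. Qed.

End Slice.

Lemma flip_half i : (flip i)./2 = i./2.
Proof. by rewrite /flip; case: ifP => oi; lia. Qed.

Lemma odd_flip i : odd (flip i) = ~~ odd i.
Proof. by rewrite /flip; case: ifP => oi; lia. Qed.

Lemma flip_double i : flip i = if odd i then i./2.*2 else (i./2.*2).+1.
Proof. by rewrite /flip; case: ifP => oi; lia. Qed.

Lemma flip_lt i t : (flip i < t.*2) = (i < t.*2).
Proof. by rewrite /flip; case: ifP => oi; lia. Qed.

Lemma flipK i : flip (flip i) = i.
Proof. rewrite flip_double odd_flip flip_half; case: ifP; lia. Qed.

Lemma map_uniq_inj (T1 T2 : eqType) (f : T1 -> T2) (s : seq T1) :
  uniq (map f s) -> {in s &, injective f}.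
Proof.
elim: s => //= z s IH /andP[zs us] x y; rewrite !inE => /orP[/eqP->|xs] /orP[/eqP->|ys] // fxy.
- by case/negP: zs; rewrite fxy map_f.
- by case/negP: zs; rewrite -fxy map_f.
- exact: IH.
Qed.

Section Tour.
Variables (T : eqType) (e : rel T) (x0 : T) (c : seq T).
Hypothesis esym : symmetric e.
Hypothesis sc : sorted e c.
Hypothesis uc : uniq c.
Variables (t : nat) (q : nat -> nat).
Hypothesis qinc : forall i j, i < j < t.*2 -> q i < q j.
Hypothesis qlt : forall i, i < t.*2 -> q i < size c.

(** An index names an arc together with a direction: it runs from port [i] to port [flip i], so an
    odd index reads the slice backwards. *)
Definition arc i : seq T :=
  let K := slice c (q i./2.*2) (q (i./2.*2).+1) in if odd i then rev K else K.

Let arc_le i : i < t.*2 -> q i./2.*2 <= q (i./2.*2).+1 /\ q (i./2.*2).+1 < size c.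
Proof. by move=> it; split; [apply/ltnW/qinc|apply/qlt]; lia. Qed.

Lemma head_arc i : i < t.*2 -> head x0 (arc i) = nth x0 c (q i).
Proof.
move=> it; have [h1 h2] := arc_le it; rewrite /arc; case: ifP => oi.
  have := last_slice x0 h1 h2; case/lastP: (slice _ _ _) (size_slice h1 h2) => [//|s y] _.
  by rewrite last_rcons rev_rcons /= => ->; congr (nth _ _ (q _)); lia.
rewrite head_slice //; congr (nth _ _ (q _)); lia.
Qed.

Lemma last_arc i : i < t.*2 -> last x0 (arc i) = nth x0 c (q (flip i)).
Proof.
move=> it; have [h1 h2] := arc_le it; rewrite /arc flip_double; case: ifP => oi.
  have [s es] := slice_cons x0 h1 h2.
  by rewrite es rev_cons last_rcons.
exact: last_slice.
Qed.

Lemma size_arc i : i < t.*2 -> size (arc i) = (q (i./2.*2).+1 - q i./2.*2).+1.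
Proof.
by move=> it; have [h1 h2] := arc_le it; rewrite /arc; case: ifP => oi; rewrite ?size_rev size_slice.
Qed.

Lemma mem_arc i y : i < t.*2 ->
  (y \in arc i) = (y \in c) && (q i./2.*2 <= index y c <= q (i./2.*2).+1).
Proof.
by move=> it; have [h1 h2] := arc_le it; rewrite /arc; case: ifP => oi; rewrite ?mem_rev (mem_slice x0).
Qed.

Lemma arc_block i : i < t.*2 -> block e (arc i).
Proof.
move=> it; rewrite /block -size_eq0 size_arc //= /arc; case: ifP => oi; last exact: slice_sorted.
rewrite rev_sorted; have := slice_sorted (q i./2.*2) (q (i./2.*2).+1) sc.
by rewrite (@eq_sorted _ (fun x y => e y x) e) // => x y; exact: esym.
Qed.

Lemma arc_disjoint i j y : i < t.*2 -> j < t.*2 -> i./2 != j./2 -> y \in arc i -> y \notin arc j.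
Proof.
move=> it jt ij; rewrite !mem_arc // => /and3P[-> h1 h2] /=.
case/orP: (leq_total i./2 j./2) => h.
  have := @qinc (i./2.*2).+1 j./2.*2; lia.
have := @qinc (j./2.*2).+1 i./2.*2; lia.
Qed.

Variables (ch : nat -> seq T) (sg cid : nat -> nat).
Hypothesis chb : forall i, i < t.*2 -> block e (ch i) /\ uniq (ch i).
Hypothesis chl : forall i, i < t.*2 ->
  e (nth x0 c (q i)) (head x0 (ch i)) /\ e (last x0 (ch i)) (nth x0 c (q (sg i))).
Hypothesis chc : forall i y, i < t.*2 -> y \in ch i -> y \notin c.
Hypothesis chd : forall i j y, i < t.*2 -> j < t.*2 -> cid i != cid j -> y \in ch i -> y \notin ch j.
Variables (s : seq nat).
Hypothesis slt : all (fun i => i < t.*2) s.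
Hypothesis scyc : fcycle (fun i => sg (flip i)) s.
Hypothesis us1 : uniq (map half s).
Hypothesis us2 : uniq (map (fun i => cid (flip i)) s).

Let piece i := arc i ++ ch (flip i).

Lemma uniq_flatten_map (I : eqType) (U : eqType) (F : I -> seq U) (r : seq I) :
  uniq r -> (forall i, i \in r -> uniq (F i)) ->
  (forall i j y, i \in r -> j \in r -> i != j -> y \in F i -> y \notin F j) ->
  uniq (flatten (map F r)).
Proof.
elim: r => //= i r IH /andP[ir ur] hu hd; rewrite cat_uniq hu ?inE ?eqxx //=.
rewrite IH // ?andbT.
- apply/hasPn => y /flattenP[_ /mapP[j jr ->] yj]; apply/negP => yi.
  have ij : i != j by apply: contraNneq ir => ->.
  by have := hd i j y; rewrite !inE eqxx jr orbT => /(_ isT isT ij yi); rewrite yj.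
- by move=> j jr; apply: hu; rewrite inE jr orbT.
- by move=> j k y jr kr; apply: hd; rewrite inE ?jr ?kr orbT.
Qed.

(** Arcs and connectors are concatenated along the tour. [us1] says that no arc is traversed twice,
    [us2] that no connector is, not even in opposite directions, since in the application both ends
    of a connector have the same [cid]. *)
Lemma tour_ucycle :
  ucycle e (flatten (map piece s)) /\
  size (flatten (map piece s)) =
    \sum_(i <- s) ((q (i./2.*2).+1 - q i./2.*2).+1 + size (ch (flip i))).
Proof.
have lt2 i : i \in s -> i < t.*2 by move/(allP slt).
have lt2' i : i \in s -> flip i < t.*2 by rewrite flip_lt => /(allP slt).
split; last first.
  rewrite size_flatten /shape sumnE big_map big_map big_seq [RHS]big_seq.
  by apply: eq_bigr => i /lt2 it; rewrite size_cat size_arc.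
apply/andP; split.
  apply: (@cycle_flatten _ _ x0).
    apply/allP => _ /mapP[i is_ ->]; rewrite /block /piece.
    have /andP[ne1 sa] := arc_block (lt2 _ is_).
    have [/andP[ne2 sb] _] := chb (lt2' _ is_).
    have [h1 _] := chl (lt2' _ is_).
    have la := last_arc (lt2 _ is_).
    apply/andP; split; first by case: (arc i) ne1.
    case: (arc i) ne1 sa la => // a al _ /= sa la; rewrite cat_path sa /=.
    by case: (ch (flip i)) ne2 sb h1 => //= b bl _ -> h1; rewrite la h1.
  rewrite cycle_map; apply: (@sub_in_cycle _ (mem s)) scyc; last exact/allP.
  move=> j k js ks /= /eqP sk; rewrite /linked /piece last_cat.
  have [/andP[ne2 _] _] := chb (lt2' _ js).
  have [_ h2] := chl (lt2' _ js).
  have hk := head_arc (lt2 _ ks).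
  have /andP[ne1 _] := arc_block (lt2 _ ks).
  case: (arc k) ne1 hk => //= a al _ ->.
  case: (ch (flip j)) ne2 h2 => //= b bl _.
  by rewrite sk.
apply: uniq_flatten_map.
- exact: map_uniq us1.
- move=> i is_; rewrite /piece cat_uniq.
  have [_ ->] := chb (lt2' _ is_); rewrite andbT; apply/andP; split.
    by rewrite /arc; case: ifP => _; rewrite ?rev_uniq slice_uniq.
  apply/hasPn => y yc; apply/negP => ya; move: (chc (lt2' _ is_) yc).
  by move: ya; rewrite mem_arc ?lt2 // => /andP[->].
- move=> i j y is_ js ij; rewrite /piece !mem_cat negb_or => /orP[ya|yc]; apply/andP; split.
  + apply: arc_disjoint ya; rewrite ?lt2 //.
    apply: contra_neq ij => h; exact: (map_uniq_inj us1 is_ js h).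
  + apply/negP => yj; move: (chc (lt2' _ js) yj).
    by move: ya; rewrite mem_arc ?lt2 // => /andP[->].
  + apply/negP => yj; move: (chc (lt2' _ is_) yc).
    by move: yj; rewrite mem_arc ?lt2 // => /andP[->].
  + apply: chd yc; rewrite ?lt2' //.
    apply: contra_neq ij => h; exact: (map_uniq_inj us2 is_ js h).
Qed.

End Tour.

(** The positions below the last one split into the initial part up to [a 0] and then, in
    alternation, the open deleted stretches and the closed kept ones. *)
Lemma telescope_gaps (a : nat -> nat) t : (forall i, i <= t.*2 -> a i < a i.+1) ->
  \sum_(0 <= j < t.+1) (a j.*2.+1 - a j.*2).-1
  + \sum_(0 <= k < t) (a k.*2.+2 - a k.*2.+1).+1 + (a 0).+1 = a t.*2.+1.
Proof.
elim: t => [|t IH] ainc.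
  by rewrite big_nat1 big_geq // !double0; have := ainc 0 (leqnn _); lia.
have {IH} := IH (fun i hi => ainc i ltac:(lia)).
rewrite [in X in _ -> X]big_nat_recr // [X in _ -> _ + X + _ = _]big_nat_recr //= !doubleS.
have := ainc t.*2.+1 ltac:(lia); have := ainc t.*2.+2 ltac:(lia).
set S1 := \sum_(0 <= i < t.+1) _; set S2 := \sum_(0 <= i < t) _; lia.
Qed.

(** Position [a 1] becomes the start of the list. Then every kept arc is an interval, including the
    one that used to run over the end of the list: it ends at the image [L - a 1 + a 0] of the first
    port. *)
Lemma rotated_positions (a : nat -> nat) t L : 0 < t ->
  (forall i j, i < j < t.*2 -> a i < a j) -> (forall i, i < t.*2 -> a i < L) ->
  exists q : nat -> nat,
  [/\ forall i j, i < j < t.*2 -> q i < q j,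
      forall i, i < t.*2 -> q i < L,
      forall i, i.+1 < t.*2 -> a 1 <= a i.+1 /\ q i = a i.+1 - a 1,
      forall i, t.*2 <= i.+1 -> q i = L - a 1 + a 0 &
      \sum_(0 <= k < t) (q k.*2.+1 - q k.*2).+1
      + \sum_(0 <= j < t) (a j.*2.+1 - a j.*2).-1 = L].
Proof.
move=> t0 ainc aL; exists (fun i => if i.+1 < t.*2 then a i.+1 - a 1 else L - a 1 + a 0).
have nL : a 1 < L by apply: aL; lia.
have a01 : a 0 < a 1 by apply: ainc; lia.
have nle i : i.+1 < t.*2 -> a 1 <= a i.+1.
  by case: i => [//|i] it; apply: ltnW; apply: ainc; lia.
split.
- move=> i j /andP[ij jt] /=; rewrite ifT; last lia.
  case: ifP => h; last by have := aL i.+1; lia.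
  by have := ainc i.+1 j.+1; have := @nle i; lia.
- by move=> i it /=; case: ifP => h; [have := aL i.+1|]; lia.
- by move=> i it /=; rewrite it; split => //; apply: nle.
- by move=> i it /=; rewrite ifF //; lia.
have [m tE] : exists m, t = m.+1 by exists t.-1; rewrite prednK.
rewrite {t0}tE in ainc aL nle *.
have T := @telescope_gaps a m ltac:(by move=> i hi; apply: ainc; lia).
rewrite big_nat_recr //= ifF; last lia.
rewrite (eq_big_nat _ _ (F2 := fun k => (a k.*2.+2 - a k.*2.+1).+1)); last first.
  move=> k /andP[_ kt]; rewrite !ifT; try lia.
  by have := ainc k.*2.+1 k.*2.+2; have := @nle k.*2; lia.
have h2 : m.*2.+1 < m.+1.*2 by lia.
rewrite h2; have := nle m.*2 h2; have := aL _ h2; move: T nL a01; clear.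
set S1 := \sum_(0 <= i < _) _; set S2 := \sum_(0 <= i < _) _; lia.
Qed.

Lemma perm_iota_uniq (s : seq nat) t : uniq s -> all (fun i => i < t) s -> size s = t ->
  perm_eq s (iota 0 t).
Proof.
move=> us st sz; apply: uniq_perm; rewrite ?iota_uniq //.
have sub : {subset s <= iota 0 t} by move=> i /(allP st); rewrite mem_iota.
by have [] := uniq_min_size us sub ltac:(by rewrite size_iota sz).
Qed.

Lemma big_uniq_iota (F : nat -> nat) (s : seq nat) t : uniq s -> all (fun i => i < t) s ->
  size s = t -> \sum_(i <- s) F i = \sum_(0 <= i < t) F i.
Proof. by move=> us st sz; rewrite (perm_big _ (perm_iota_uniq us st sz)) /index_iota subn0. Qed.

Lemma partner_mem v p : ~~ odd (size v) -> p \in v -> partner v p \in v.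
Proof.
move=> ov pv; have := pv; rewrite -index_mem => hi.
by apply: mem_nth; case: ifP => h; lia.
Qed.

Lemma index_partner v p : uniq v -> ~~ odd (size v) -> p \in v ->
  (index (partner v p) v) = flip (index p v).
Proof.
move=> uv ov pv; have := pv; rewrite -index_mem => hi.
by rewrite /partner index_uniq // /flip; case: ifP; lia.
Qed.

Section Circle.
Variables (T : eqType) (e : rel T) (x0 : T) (c : seq T).
Hypothesis esym : symmetric e.
Hypothesis cc : ucycle e c.
Variables (w v : seq nat) (pos : nat -> nat).
Hypothesis wv : perm_eq w v.
Hypothesis uw : uniq w.
Hypothesis ow : ~~ odd (size w).
Hypothesis w0 : 0 < size w.
Hypothesis pinc : sorted ltn (map pos w).
Hypothesis plt : forall p, p \in w -> pos p < size c.
Variables (conn : nat -> seq T) (cl : nat -> nat).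
Hypothesis cb : forall p, p \in w -> block e (conn p) /\ uniq (conn p).
Hypothesis cle : forall p, p \in w ->
  e (nth x0 c (pos p)) (head x0 (conn p)) /\
  e (last x0 (conn p)) (nth x0 c (pos (partner v p))).
Hypothesis ccl : forall p y, p \in w -> y \in conn p -> y \notin c.
Hypothesis cd : forall p p' y, p \in w -> p' \in w ->
  (index p v)./2 != (index p' v)./2 -> y \in conn p -> y \notin conn p'.
Hypothesis csz : forall p, p \in w -> size (conn p) = cl (index p v)./2.
Hypothesis sgl : single w v.

(** [conn p] leads from port [p] to its partner in [v], so each detour is described once from either
    end. The sizes are compared by an equation between sums, which avoids truncated subtraction of
    the deleted total. *)
Lemma circle_surgery : exists2 s, ucycle e s &
  size s + \sum_(0 <= j < (size w)./2) (pos (nth 0 w j.*2.+1) - pos (nth 0 w j.*2)).-1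
  = size c + \sum_(0 <= j < (size w)./2) cl j.
Proof.
have [t tE] : exists t, t = (size w)./2 by eexists.
have t2 : size w = t.*2 by rewrite tE even_halfK.
have t0 : 0 < t by rewrite -double_gt0 -t2.
have [L LE] : exists L, L = size c by eexists.
have [a aE] : exists a, forall i, a i = pos (nth 0 w i) by exists (fun i => pos (nth 0 w i)).
have uv : uniq v by rewrite -(perm_uniq wv).
have szv : size v = size w by rewrite (perm_size wv).
have ov : ~~ odd (size v) by rewrite szv.
have memv p : (p \in v) = (p \in w) by rewrite (perm_mem wv).
have ainc i j : i < j < t.*2 -> a i < a j.
  move=> /andP[ij jt].
  have := sorted_ltn_nth ltn_trans 0 pinc; rewrite size_map t2 => /(_ i j).
  rewrite !inE !(nth_map 0) ?t2 -?aE; move: ij jt; clear; lia.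
have aL i : i < t.*2 -> a i < L by move=> it; rewrite aE LE; apply/plt/mem_nth; rewrite t2.
have [q [qinc qlt q1 q2 qsum]] := rotated_positions t0 ainc aL.
pose c' := rot (a 1) c.
have /andP[cyc uc] := cc.
have uc' : uniq c' by rewrite rot_uniq.
have szc' : size c' = L by rewrite size_rot LE.
have sc' : sorted e c'.
  have : path.cycle e c' by rewrite rot_cycle.
  by case: (c') => //= y s; rewrite rcons_path => /andP[].
have nthr i : i < t.*2 -> nth 0 (rot 1 w) i = nth 0 w (if i.+1 < t.*2 then i.+1 else 0).
  move=> it; rewrite /rot nth_cat size_drop t2; move: it t0; clear.
  case: (ltnP i.+1 t.*2) => h1 it t0; first by rewrite ifT ?nth_drop //; lia.
  by rewrite ifF; [rewrite nth_take; [congr nth|]|]; lia.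
have nq i : i < t.*2 -> nth x0 c' (q i) = nth x0 c (pos (nth 0 (rot 1 w) i)).
  move=> it; rewrite nthr // /c' /rot nth_cat size_drop -LE.
  have h1 := qlt _ it; case: (ltnP i.+1 t.*2) => h.
    have h2 := aL _ h; have [h3 h4] := q1 _ h.
    rewrite h4 ifT; last by move: h2 h3; clear; lia.
    by rewrite nth_drop subnKC // aE.
  have h2 : a 0 < a 1 by apply: ainc; move: t0; clear; lia.
  rewrite (q2 _ h) ifF; last by clear; lia.
  by rewrite addKn nth_take // aE.
have memr i : i < t.*2 -> nth 0 (rot 1 w) i \in w.
  by move=> it; rewrite -(mem_rot 1) mem_nth // size_rot t2.
have chlt i : i < t.*2 -> chord w v i < t.*2.
  move=> it; rewrite /chord -t2 -(size_rot 1 w) index_mem mem_rot -memv.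
  by apply: partner_mem => //; rewrite memv memr.
have nchord i : i < t.*2 -> nth 0 (rot 1 w) (chord w v i) = partner v (nth 0 (rot 1 w) i).
  by move=> it; rewrite /chord nth_index // mem_rot -memv partner_mem // memv memr.
pose ch i := conn (nth 0 (rot 1 w) i).
pose cid i := (index (nth 0 (rot 1 w) i) v)./2.
pose s := tour w v.
have ss : size s = t by rewrite /s /tour size_traject tE.
have slt : all (fun i => i < t.*2) s.
  apply/allP => i /trajectP[k _ ->]; elim: k => [|k IH] /=; first by rewrite double_gt0.
  by apply: chlt; rewrite flip_lt.
have /and3P[s1 s2 s3] := sgl.
have scyc : fcycle (fun i => chord w v (flip i)) s.
  move: s1; rewrite -/s /s /tour -tE; case: (t) t0 => // k _ /=.
  rewrite rcons_path fpath_traject /=; exact.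
have T1 := @tour_ucycle _ e x0 c' esym sc' uc' t q qinc
  ltac:(by move=> i /qlt; rewrite szc') ch (chord w v) cid.
case: (T1 _ _ _ _ s slt scyc s2 s3) => [i it|i it|i y it|i j y it jt|u1 u2].
- exact: cb (memr _ it).
- have [h1 h2] := cle (memr _ it); split; first by rewrite (nq _ it).
  by rewrite (nq _ (chlt _ it)) (nchord _ it).
- by move=> /(ccl (memr _ it)); rewrite mem_rot.
- by apply: cd; rewrite ?memr.
exists (flatten [seq arc c' q i ++ ch (flip i) | i <- s]) => //.
rewrite {}u2 big_split /=.
have -> : \sum_(i <- s) size (ch (flip i)) = \sum_(0 <= j < t) cl j.
  rewrite -(@big_uniq_iota cl (map (fun i => cid (flip i)) s)) ?size_map //; first last.
    apply/allP => _ /mapP[i is_ ->]; rewrite /cid.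
    have : flip i < t.*2 by rewrite flip_lt (allP slt).
    by move=> /memr; rewrite -memv -index_mem szv t2; clear; lia.
  rewrite big_map big_seq [RHS]big_seq; apply: eq_bigr => i is_.
  by rewrite /ch /cid csz // memr // flip_lt (allP slt).
have -> : \sum_(i <- s) (q (i./2.*2).+1 - q i./2.*2).+1 =
   \sum_(0 <= k < t) (q k.*2.+1 - q k.*2).+1.
  rewrite -(@big_uniq_iota _ (map half s)) ?size_map //; first by rewrite big_map.
  by apply/allP => _ /mapP[i is_ ->]; have := allP slt _ is_; clear; lia.
rewrite -tE addnAC -LE -qsum; congr (_ + _).
by congr (_ + _); apply: eq_bigr => j _; rewrite !aE.
Qed.

End Circle.

Lemma path_ends (T : eqType) (e : rel T) x0 a F b : F != [::] -> path e a (rcons F b) ->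
  e a (head x0 F) /\ e (last x0 F) b.
Proof. by case: F => //= z F _ /andP[-> ]; rewrite rcons_path => /andP[]. Qed.

Lemma path_rev (T : eqType) (e : rel T) a F b : symmetric e ->
  path e a (rcons F b) -> path e b (rcons (rev F) a).
Proof.
move=> esym p; rewrite -rev_cons.
have := rev_path e a (rcons F b); rewrite last_rcons belast_rcons => ->.
by rewrite (@eq_path _ _ e) // => z t; exact: esym.
Qed.

Section Half.
Variables (T : eqType) (e : rel T) (x0 : T) (c d : seq T).
Hypothesis esym : symmetric e.
Hypothesis cc : ucycle e c.
Hypothesis dd : ucycle e d.
Variables (x y : nat -> T) (h : nat -> seq T).
Variables (w v : seq nat).
Hypothesis wv : perm_eq w v.
Hypothesis uw : uniq w.
Hypothesis ow : ~~ odd (size w).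
Hypothesis w0 : 0 < size w.
Hypothesis hp : forall p, p \in w -> path e (x p) (rcons (h p) (y p)).
Hypothesis hx : forall p, p \in w -> x p \in c.
Hypothesis hy : forall p, p \in w -> y p \in d.
Hypothesis hc : forall p z, p \in w -> z \in h p -> (z \notin c) && (z \notin d).
Hypothesis hu : forall p, p \in w -> uniq (h p).
Hypothesis hd : forall p p' z, p \in w -> p' \in w -> p != p' -> z \in h p -> z \notin h p'.
Hypothesis finc : sorted ltn (map (fun p => index (x p) c) w).
Hypothesis ginc : sorted ltn (map (fun p => index (y p) d) v).
Hypothesis gsite : forall j z, j < (size w)./2 -> z \in d ->
  index (y (nth 0 v j.*2)) d <= index z d <= index (y (nth 0 v j.*2.+1)) d -> z \notin c.
Hypothesis sgl : single w v.

Let g p := index (y p) d.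
Let cl j := size (h (nth 0 v j.*2)) + size (h (nth 0 v j.*2.+1)) +
  (g (nth 0 v j.*2.+1) - g (nth 0 v j.*2)).+1.
Let F j := h (nth 0 v j.*2) ++ slice d (g (nth 0 v j.*2)) (g (nth 0 v j.*2.+1))
             ++ rev (h (nth 0 v j.*2.+1)).

Let memv p : (p \in v) = (p \in w). Proof. by rewrite (perm_mem wv). Qed.
Let szv : size v = size w. Proof. by rewrite (perm_size wv). Qed.
Let uv : uniq v. Proof. by rewrite -(perm_uniq wv). Qed.

Let nthv i : i < size w -> nth 0 v i \in w.
Proof. by move=> it; rewrite -memv mem_nth // szv. Qed.

Let jlt j : j < (size w)./2 -> j.*2 < size w /\ j.*2.+1 < size w.
Proof. by move: ow; clear; lia. Qed.

Let g_lt j : j < (size w)./2 -> g (nth 0 v j.*2) < g (nth 0 v j.*2.+1) /\ g (nth 0 v j.*2.+1) < size d.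
Proof.
move=> jt; have [j1 j2] := jlt jt; split; last by rewrite index_mem hy // nthv.
have := sorted_ltn_nth ltn_trans 0 ginc; rewrite size_map szv => /(_ j.*2 j.*2.+1).
by rewrite !inE !(nth_map 0) ?szv //; apply.
Qed.

Let F_path j : j < (size w)./2 ->
  path e (x (nth 0 v j.*2)) (rcons (F j) (x (nth 0 v j.*2.+1))).
Proof.
move=> jt; have [j1 j2] := jlt jt; have [g1 g2] := g_lt jt.
have p1 := hp (nthv j1); have p2 := hp (nthv j2).
have sd : sorted e d.
  have /andP[] := dd; case: (d) => //= a s; rewrite rcons_path => /andP[]//.
have [s es] := slice_cons x0 (ltnW g1) g2.
have la := last_slice x0 (ltnW g1) g2.
have so := slice_sorted (g (nth 0 v j.*2)) (g (nth 0 v j.*2.+1)) sd.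
move: la so; rewrite /F es /= => la so.
rewrite !rcons_cat cat_path; move: p1; rewrite rcons_path => /andP[-> l1] /=.
rewrite nth_index ?hy ?nthv // l1 /=.
rewrite rcons_cat cat_path; rewrite nth_index ?hy ?nthv // in so la; rewrite so /= la.
by rewrite nth_index ?hy ?nthv // path_rev.
Qed.

Let F_size j : j < (size w)./2 -> size (F j) = cl j.
Proof.
move=> jt; have [g1 g2] := g_lt jt.
by rewrite /F !size_cat size_rev (size_slice (ltnW g1) g2) /cl addnA addnAC.
Qed.

Let udd : uniq d. Proof. by case/andP: dd. Qed.

Let mem_F j z : j < (size w)./2 -> (z \in F j) =
  [|| z \in h (nth 0 v j.*2), (z \in d) && (g (nth 0 v j.*2) <= index z d <= g (nth 0 v j.*2.+1))
    | z \in h (nth 0 v j.*2.+1)].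
Proof.
by move=> jt; have [g1 g2] := g_lt jt; rewrite /F !mem_cat mem_rev (mem_slice x0) // ltnW.
Qed.

Let F_uniq j : j < (size w)./2 -> uniq (F j).
Proof.
move=> jt; have [j1 j2] := jlt jt; have [g1 g2] := g_lt jt.
have ne : nth 0 v j.*2 != nth 0 v j.*2.+1.
  by rewrite nth_uniq ?szv //; clear; lia.
rewrite /F !cat_uniq rev_uniq !hu ?nthv // slice_uniq //= andbT; apply/andP; split.
  rewrite has_cat negb_or; apply/andP; split; apply/hasPn => z.
    by rewrite (mem_slice x0) ?(ltnW g1) // => /andP[zd _]; apply/negP => /(hc (nthv j1)); rewrite zd andbF.
  by rewrite mem_rev => z1; apply/negP => z2; rewrite eq_sym in ne; move: (hd (nthv j2) (nthv j1) ne z1); rewrite z2.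
apply/hasPn => z; rewrite mem_rev => /(hc (nthv j2)) /andP[_ zd].
by rewrite (mem_slice x0) ?(ltnW g1) // (negPf zd).
Qed.

Let F_disj j k z : j < (size w)./2 -> k < (size w)./2 -> j != k -> z \in F j -> z \notin F k.
Proof.
wlog: j k / j < k => [W jt kt jk zj|jk jt kt _].
  have := jk; rewrite neq_ltn => /orP[lt|lt]; first exact: (W j k lt jt kt jk zj).
  by rewrite eq_sym in jk; apply/negP => zk; move: (W k j lt kt jt jk zk); rewrite zj.
have [j1 j2] := jlt jt; have [k1 k2] := jlt kt.
have ne a b : a < size w -> b < size w -> a != b -> nth 0 v a != nth 0 v b.
  by move=> *; rewrite nth_uniq ?szv.
have gjk : g (nth 0 v j.*2.+1) < g (nth 0 v k.*2).
  have := sorted_ltn_nth ltn_trans 0 ginc; rewrite size_map szv => /(_ j.*2.+1 k.*2).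
  by rewrite !inE !(nth_map 0) ?szv //; apply => //; move: jk; clear; lia.
rewrite !mem_F // => /or3P[zh|/andP[zd /andP[zl zr]]|zh].
- rewrite !negb_or; have /andP[_ /negPf->] := hc (nthv j1) zh.
  by rewrite !(hd (nthv j1) _ _ zh) ?nthv ?ne //; move: jk; clear; lia.
- rewrite zd !negb_or /=; apply/and3P; split.
  + by apply/negP => /(hc (nthv k1)); rewrite zd andbF.
  + by apply/negP; move: zr gjk; clear; lia.
  + by apply/negP => /(hc (nthv k2)); rewrite zd andbF.
- rewrite !negb_or; have /andP[_ /negPf->] := hc (nthv j2) zh.
  by rewrite !(hd (nthv j2) _ _ zh) ?nthv ?ne //; move: jk; clear; lia.
Qed.

(** The detour [F j] leaves [c] along one path [h], follows [d] between two landing points and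
    returns along another. [gsite] keeps that stretch of [d] off [c]; [cl j] counts the vertices of
    the detour, both landing points included. *)
Lemma half_surgery : exists2 s, ucycle e s &
  size s + \sum_(0 <= j < (size w)./2)
     (index (x (nth 0 w j.*2.+1)) c - index (x (nth 0 w j.*2)) c).-1
  = size c + \sum_(0 <= j < (size w)./2) cl j.
Proof.
pose conn p := let i := index p v in if odd i then rev (F i./2) else F i./2.
have ih p : p \in w -> (index p v)./2 < (size w)./2.
  by rewrite -memv -index_mem szv; move: ow; clear; lia.
have conn_block p : p \in w -> block e (conn p) /\ uniq (conn p).
  move=> pw; have jt := ih p pw; have := F_path jt; rewrite rcons_path => /andP[pF _].
  have ne : F (index p v)./2 != [::] by rewrite -size_eq0 F_size // /cl addnS.
  have sF : sorted e (F (index p v)./2) by move: pF; case: (F _) => //= a s /andP[].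
  rewrite /conn; case: ifP => _; split; rewrite ?rev_uniq ?F_uniq // /block.
    rewrite -size_eq0 size_rev size_eq0 ne rev_sorted (@eq_sorted _ _ e) // => a b; exact: esym.
  by rewrite ne.
have pe p : p \in w -> let j := (index p v)./2 in
    p = nth 0 v (if odd (index p v) then j.*2.+1 else j.*2) /\
    partner v p = nth 0 v (if odd (index p v) then j.*2 else j.*2.+1).
  move=> pw j; split; last first.
    rewrite /partner /j; case: ifP => oi; congr nth; move: oi; clear; lia.
  rewrite -[LHS](nth_index 0 (_ : p \in v)) ?memv //; congr nth; rewrite /j; case: ifP; clear; lia.
have := @circle_surgery _ e x0 c esym cc w v (fun p => index (x p) c) wv uw ow w0 finc _ conn cl
   conn_block _ _ _ _ sgl.
apply.
- by move=> p pw; rewrite index_mem hx.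
- move=> p pw; have [e1 e2] := pe p pw; have jt := ih p pw; have [j1 j2] := jlt jt.
  have pm : partner v p \in w by rewrite -memv partner_mem ?szv ?memv.
  rewrite !nth_index ?hx //.
  have pF := F_path jt; have ne : F (index p v)./2 != [::] by rewrite -size_eq0 F_size // /cl addnS.
  rewrite /conn e2 [X in e (x X)]e1; case: ifP => _; last exact: (path_ends x0 ne pF).
  by apply: path_ends (path_rev esym pF); rewrite -size_eq0 size_rev size_eq0.
- move=> p z pw; have jt := ih p pw; have [j1 j2] := jlt jt.
  have -> : (z \in conn p) = (z \in F (index p v)./2) by rewrite /conn; case: ifP; rewrite ?mem_rev.
  rewrite mem_F // => /or3P[/(hc (nthv j1))/andP[]//|/andP[zd zi]|/(hc (nthv j2))/andP[]//].
  exact: gsite jt zd zi.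
- move=> p p' z pw pw' ne.
  have E q : (z \in conn q) = (z \in F (index q v)./2) by rewrite /conn; case: ifP; rewrite ?mem_rev.
  by rewrite !E; apply: F_disj; rewrite ?ih.
- move=> p pw; rewrite /conn; case: ifP; rewrite ?size_rev F_size ?ih //.
Qed.

End Half.

Lemma all_consec (P : nat * nat -> bool) w j : all P (consec w) -> j < (size w)./2 ->
  P (nth 0 w j.*2, nth 0 w j.*2.+1).
Proof.
move: {2}(size w) (leqnn (size w)) => n; elim: n w j => [|n IH] [|a [|b w]] j //= sn /andP[Pab al].
case: j => [|j] //= jw; apply: IH => //; exact: ltnW.
Qed.

(* The items of [z] are connecting paths with ends at positions [f] and [g] on the two
   cycles, [A] and [B] being the segments of these ends. Rerouting each cycle
   through the other along [w] and [v] gives two cycles: every deleted stretch of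
   one cycle is used by the other, so their total length exceeds that of the
   original pair. *)
Definition exchangeable (I : eqType) (U V : eqType) (f g : I -> nat) (A : I -> U) (B : I -> V)
    (i0 : I) (z : seq I) (w v : seq nat) : Prop :=
  let zn := nth i0 z in
  [/\ [/\ uniq z, 0 < size z & ~~ odd (size z)],
      perm_eq w (iota 0 (size z)) /\ perm_eq v (iota 0 (size z)),
      sorted ltn (map (f \o zn) w) /\ sorted ltn (map (g \o zn) v),
      all (fun p => A (zn p.1) == A (zn p.2)) (consec w) /\
      all (fun p => B (zn p.1) == B (zn p.2)) (consec v) &
      single w v /\ single v w].

Section Double.
Variables (T : eqType) (e : rel T) (c d : seq T) (I : eqType).
Hypothesis esym : symmetric e.
Hypothesis cc : ucycle e c.
Hypothesis dd : ucycle e d.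
Hypothesis cmax : forall s, ucycle e s -> size s <= size c.
Hypothesis dmax : forall s, ucycle e s -> size s <= size d.
Variables (x y : I -> T) (h : I -> seq T).
Hypothesis hp : forall i, path e (x i) (rcons (h i) (y i)).
Hypothesis hx : forall i, x i \in c.
Hypothesis hy : forall i, y i \in d.
Hypothesis hc : forall i z, z \in h i -> (z \notin c) && (z \notin d).
Hypothesis hu : forall i, uniq (h i).
Hypothesis hd : forall i j z, i != j -> z \in h i -> z \notin h j.
Variables (U V : eqType) (A : I -> U) (B : I -> V).
Let f i := index (x i) c.
Let g i := index (y i) d.
Hypothesis hA : forall i j z, A i = A j -> z \in c -> f i <= index z c <= f j -> z \notin d.
Hypothesis hB : forall i j z, B i = B j -> z \in d -> g i <= index z d <= g j -> z \notin c.

Lemma not_exchangeable i0 z w v : ~ exchangeable f g A B i0 z w v.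
Proof.
move=> [[uz z0 oz] [pw pv] [sw sv] [aw av] [s1 s2]].
pose zn := nth i0 z.
have szw : size w = size z by rewrite (perm_size pw) size_iota.
have szv : size v = size z by rewrite (perm_size pv) size_iota.
have wv : perm_eq w v by rewrite (perm_trans pw) // perm_sym.
have uw : uniq w by rewrite (perm_uniq pw) iota_uniq.
have uv : uniq v by rewrite (perm_uniq pv) iota_uniq.
have mw p : p \in w -> p < size z by rewrite (perm_mem pw) mem_iota.
have mv p : p \in v -> p < size z by rewrite (perm_mem pv) mem_iota.
have ne p q : p < size z -> q < size z -> p != q -> zn p != zn q by move=> *; rewrite nth_uniq.
have [] := @half_surgery _ e (x (zn 0)) c d esym cc dd (x \o zn) (y \o zn) (h \o zn) w v wv uw
   ltac:(by rewrite szw) ltac:(by rewrite szw) (fun p _ => hp _) (fun p _ => hx _) (fun p _ => hy _)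
   (fun p z _ => @hc _ _) (fun p _ => hu _)
   (fun p p' z pw pw' ne' => @hd _ _ _ (ne _ _ (mw _ pw) (mw _ pw') ne')) sw sv _ s1.
  move=> j u jw ud; apply: hB ud; apply/eqP.
  by apply: (all_consec av); rewrite szv -szw.
move=> s /cmax sc E1.
have hp' i : path e (y i) (rcons (rev (h i)) (x i)) by apply: path_rev.
have [] := @half_surgery _ e (x (zn 0)) d c esym dd cc (y \o zn) (x \o zn) (rev \o h \o zn) v w
   ltac:(by rewrite perm_sym) uv
   ltac:(by rewrite szv) ltac:(by rewrite szv) (fun p _ => hp' _) (fun p _ => hy _) (fun p _ => hx _)
   _ _ _ sv sw _ s2.
- by move=> p u _ /=; rewrite mem_rev andbC => /hc.
- by move=> p _ /=; rewrite rev_uniq.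
- by move=> p p' u pw' pw'' ne' /=; rewrite !mem_rev; apply: hd; apply: ne => //; apply: mv.
- move=> j u jw ud; apply: hA ud; apply/eqP.
  by apply: (all_consec aw); rewrite szw -szv.
move=> s' /dmax sd E2.
move: E1 E2; rewrite szv szw /=.
set n := (size z)./2.
have n0 : 0 < n by rewrite /n; move: z0 oz; clear; lia.
set S1 := \sum_(0 <= j < n) _.-1; set S2 := \sum_(0 <= j < n) (_ + _).
set S3 := \sum_(0 <= j < n) _.-1; set S4 := \sum_(0 <= j < n) (_ + _) => E1 E2.
(* A stretch deleted from one cycle loses only its interior there but is traversed with both ends by
   the other new cycle, so every pair of ports yields a gain of at least one vertex. *)
have h1 : S1 + n <= S4.
  rewrite -[n]subn0 -[n - 0]muln1 -sum_nat_const_nat -big_split /= leq_sum // => j _.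
  by rewrite /f; clear; lia.
have h2 : S3 + n <= S2.
  rewrite -[n]subn0 -[n - 0]muln1 -sum_nat_const_nat -big_split /= leq_sum // => j _.
  by rewrite /g; clear; lia.
by move: sc sd E1 E2 h1 h2 n0; clear; lia.
Qed.

End Double.

(** * Selection of two structures *)

Definition color := ('I_6 * (bool * bool * bool * bool) * (bool * bool * bool * bool))%type.

Definition words_of (c : color) : words :=
  let: (t, (b1, b2, b3, b4), (b5, b6, b7, b8)) := c in color_words t b1 b2 b3 b4 b5 b6 b7 b8.

Fixpoint all_bits (n : nat) (P : seq bool -> bool) : bool :=
  if n is n'.+1 then all_bits n' (fun s => P (true :: s)) && all_bits n' (fun s => P (false :: s))
  else P [::].

Lemma all_bitsP n P (s : seq bool) : all_bits n P -> size s = n -> P s.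
Proof.
elim: n P s => [|n IH] P; first by case.
case=> // -[] s /= /andP[p1 p2] [sz].
  exact: (IH _ _ p1 sz).
exact: (IH _ _ p2 sz).
Qed.

(** Bits beyond the end of [s] default to [true]. Tags 1 to 5 read at most six bits, so lists of
    length 6 suffice for them. *)
Definition words_bits (t : nat) (s : seq bool) : words :=
  let b := nth true s in color_words t (b 0) (b 1) (b 2) (b 3) (b 4) (b 5) (b 6) (b 7).

Lemma words_bits_wf :
  all_bits 8 (fun s => wf_words (words_bits 0 s)) &&
  all (fun t => all_bits 6 (fun s => wf_words (words_bits t s))) (iota 1 5).
Proof. by vm_compute. Qed.

Lemma color_wf c : wf_words (words_of c).
Proof.
case: c => [[[t tlt] [[[b1 b2] b3] b4]] [[[b5 b6] b7] b8]] /=.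
have /andP[h0 h1] := words_bits_wf.
case: t tlt => [|t] tlt; first exact: (all_bitsP (s := [:: b1; b2; b3; b4; b5; b6; b7; b8]) h0).
have tP : t.+1 \in iota 1 5 by rewrite mem_iota.
have := all_bitsP (s := [:: b1; b2; b3; b4; b5; b6]) (allP h1 _ tP) (erefl _).
by case: t {tP} tlt => [|[|[|[|[|]]]]].
Qed.

Lemma pigeonhole (C : finType) n (f : nat -> C) : #|C| < n ->
  exists i j, [/\ i < j, j < n & f i = f j].
Proof.
move=> Cn; pose g (i : 'I_n) := f i.
have : ~ injective g by move=> /leq_card; rewrite card_ord leqNgt Cn.
move=> ninj.
case: (pickP (fun u : 'I_n * 'I_n => (u.1 < u.2) && (g u.1 == g u.2))) => [[i j] /= /andP[ij /eqP E]|none].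
  by exists i, j; rewrite ij ltn_ord.
case: ninj => i j E; apply: val_inj => /=.
have := none (i, j); have := none (j, i); rewrite /= E eqxx !andbT.
by case: ltngtP.
Qed.

Definition crossing (cr : bool) (r1 r2 r3 r4 : nat) : bool :=
  if cr then [&& r1 < r3, r3 < r2 & r2 < r4] else [&& r1 < r2, r2 < r3 & r3 < r4].

Definition comparable (pa : bool) (i k i' k' : nat) : bool :=
  if pa then (i < i') && (k < k') || (i' < i) && (k' < k)
  else (i < i') && (k' < k) || (i' < i) && (k < k').

(** A direct construction replaces Ramsey's theorem. On a suitable grid of cell pairs two
    pigeonholes give equal colors in the relative order that the color asks for; the outcome colors
    the pairs of region cells, and a second grid does the same for crossing or separated pairs. *)
Lemma selection (C : finType) (cr pa : C -> bool) : exists n1 n2, forall col : nat -> nat -> nat -> nat -> C,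
  exists i k i' k' r1 r2 r3 r4,
  [/\ [/\ i < n2, k < n2, i' < n2 & k' < n2], r4 < n1,
      col i k r1 r2 = col i' k' r3 r4,
      comparable (pa (col i k r1 r2)) i k i' k' & crossing (cr (col i k r1 r2)) r1 r2 r3 r4].
Proof.
pose F := #|C|.+1; pose O := (('I_F * 'I_F) * ('I_F * 'I_F) * C)%type.
pose M := #|{: O}|.+1.
exists (M * (M + M)), (F * F) => col.
(* Moving in [j] within a chain [s] raises both coordinates, moving to a later chain raises the
   first and lowers the second. So points of one chain are parallel, points of different chains
   antiparallel. *)
pose pi (p : 'I_F * 'I_F) : nat := p.1 * F + p.2.
pose pk (p : 'I_F * 'I_F) : nat := (F - p.1.+1) * F + p.2.
have pi_lt p : pi p < F * F /\ pk p < F * F.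
  rewrite /pi /pk; case: p => [[s sF] [j jF]] /=; split.
    by apply: (@leq_trans (s * F + F)); rewrite ?ltn_add2l // -mulSnr leq_mul2r sF orbT.
  by apply: (@leq_trans ((F - s.+1) * F + F)); rewrite ?ltn_add2l // -mulSnr leq_mul2r; apply/orP; right; move: sF; clear; lia.
have outcome r r' : exists o : O, [/\ col (pi o.1.1) (pk o.1.1) r r' = o.2,
    col (pi o.1.2) (pk o.1.2) r r' = o.2 & comparable (pa o.2) (pi o.1.1) (pk o.1.1) (pi o.1.2) (pk o.1.2)].
  pose cc (s j : 'I_F) := col (pi (s, j)) (pk (s, j)) r r'.
  have chain (s : 'I_F) : exists jj : 'I_F * 'I_F, jj.1 < jj.2 /\ cc s jj.1 = cc s jj.2.
    have [j [j' [jj jF E]]] := @pigeonhole C F (fun j => cc s (inord j)) (ltnSn _).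
    have jF' := ltn_trans jj jF.
    by exists (inord j, inord j'); rewrite /= !inordK.
  have [ch chP] := fin_all_exists chain.
  have chain_lt (s j j' : 'I_F) : j < j' -> pi (s, j) < pi (s, j') /\ pk (s, j) < pk (s, j').
    by rewrite /pi /pk /= !ltn_add2l.
  (* Each chain repeats a color. If some repeated color wants parallel order, its chain serves;
     otherwise two chains repeat the same color, and one point from each gives the antiparallel
     order. *)
  case: (pickP (fun s => pa (cc s (ch s).1))) => [s pas|npa].
    have [lt E] := chP s; have [l1 l2] := chain_lt s _ _ lt.
    by exists ((s, (ch s).1), (s, (ch s).2), cc s (ch s).1); split => //=; rewrite pas /comparable l1 l2.
  have [s [s' [ss sF E]]] := @pigeonhole C F (fun s => cc (inord s) (ch (inord s)).1) (ltnSn _).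
  exists ((inord s, (ch (inord s)).1), (inord s', (ch (inord s')).1), cc (inord s) (ch (inord s)).1).
  rewrite /= npa; split => //.
  have sF' := ltn_trans ss sF.
  apply/orP; left; rewrite /pi /pk /= !inordK //.
  have [j1 j2] := (ltn_ord (ch (inord s)).1, ltn_ord (ch (inord s')).1).
  move: j1 j2; set u1 := nat_of_ord _; set u2 := nat_of_ord _ => j1 j2; apply/andP; split.
    apply: (@leq_trans (s * F + F)); rewrite ?ltn_add2l // -mulSnr.
    by apply: leq_trans (leq_addr _ _); rewrite leq_mul2r ss orbT.
  apply: (@leq_trans ((F - s'.+1) * F + F)); rewrite ?ltn_add2l // -mulSnr.
  apply: leq_trans (leq_addr _ _); rewrite leq_mul2r; apply/orP; right.
  by move: ss sF; clear; lia.
pose G := nat; have [o oP] : exists o : nat -> nat -> O, forall r r',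
   [/\ col (pi (o r r').1.1) (pk (o r r').1.1) r r' = (o r r').2,
    col (pi (o r r').1.2) (pk (o r r').1.2) r r' = (o r r').2 &
    comparable (pa (o r r').2) (pi (o r r').1.1) (pk (o r r').1.1) (pi (o r r').1.2) (pk (o r r').1.2)].
  pose ok r r' (x : O) := [&& col (pi x.1.1) (pk x.1.1) r r' == x.2,
    col (pi x.1.2) (pk x.1.2) r r' == x.2 & comparable (pa x.2) (pi x.1.1) (pk x.1.1) (pi x.1.2) (pk x.1.2)].
  have okx r r' : exists x, ok r r' x.
    by have [x [/eqP e1 /eqP e2 e3]] := outcome r r'; exists x; apply/and3P.
  exists (fun r r' => xchoose (okx r r')) => r r'.
  by have /and3P[/eqP-> /eqP-> ->] := xchooseP (okx r r').
(* Inside group [t] all pairs (lo, hi) cross each other, and pairs from different groups are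
   separated: the same dichotomy as for the chains. *)
pose lo t j := t * (M + M) + j; pose hi t j := t * (M + M) + M + j.
have finish t j t' j' : t < M -> j < M -> t' < M -> j' < M ->
    o (lo t j) (hi t j) = o (lo t' j') (hi t' j') ->
    crossing (cr (o (lo t j) (hi t j)).2) (lo t j) (hi t j) (lo t' j') (hi t' j') ->
  exists i k i' k' r1 r2 r3 r4,
  [/\ [/\ i < F * F, k < F * F, i' < F * F & k' < F * F], r4 < M * (M + M),
      col i k r1 r2 = col i' k' r3 r4,
      comparable (pa (col i k r1 r2)) i k i' k' & crossing (cr (col i k r1 r2)) r1 r2 r3 r4].
  move=> tM jM tM' jM' E cx; have [e1 _ e3] := oP (lo t j) (hi t j).
  have [_ e2 _] := oP (lo t' j') (hi t' j').
  exists (pi (o (lo t j) (hi t j)).1.1), (pk (o (lo t j) (hi t j)).1.1),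
    (pi (o (lo t j) (hi t j)).1.2), (pk (o (lo t j) (hi t j)).1.2), (lo t j), (hi t j), (lo t' j'), (hi t' j').
  have [p1 p2] := pi_lt (o (lo t j) (hi t j)).1.1; have [p3 p4] := pi_lt (o (lo t j) (hi t j)).1.2.
  split; [by split| |by rewrite e1 E e2|by rewrite e1|by rewrite e1].
  rewrite /hi -addnA; apply: (@leq_trans (t' * (M + M) + (M + M))).
    by rewrite ltn_add2l ltn_add2l.
  by rewrite -mulSnr leq_mul2r tM' orbT.
have group t : exists jj : nat * nat, [/\ jj.1 < jj.2, jj.2 < M &
   o (lo t jj.1) (hi t jj.1) = o (lo t jj.2) (hi t jj.2)].
  have [j [j' [jj jF E]]] := @pigeonhole O M (fun j => o (lo t j) (hi t j)) (ltnSn _).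
  by exists (j, j').
have [[t [tM [jj [j1 j2 E]] crt]]|ncr] : (exists t, t < M /\ exists2 jj : nat * nat, [/\ jj.1 < jj.2, jj.2 < M &
   o (lo t jj.1) (hi t jj.1) = o (lo t jj.2) (hi t jj.2)] & cr (o (lo t jj.1) (hi t jj.1)).2) \/
   forall t, t < M -> exists j, j < M /\ ~~ cr (o (lo t j) (hi t j)).2.
- have : (exists t : 'I_M, exists2 jj : 'I_M * 'I_M, (jj.1 < jj.2) && (o (lo t jj.1) (hi t jj.1) == o (lo t jj.2) (hi t jj.2)) & cr (o (lo t jj.1) (hi t jj.1)).2)
    \/ forall t, t < M -> exists j, j < M /\ ~~ cr (o (lo t j) (hi t j)).2.
    case: (pickP (fun x : 'I_M * ('I_M * 'I_M) => [&& x.2.1 < x.2.2, o (lo x.1 x.2.1) (hi x.1 x.2.1) == o (lo x.1 x.2.2) (hi x.1 x.2.2) & cr (o (lo x.1 x.2.1) (hi x.1 x.2.1)).2])) => [[t jj] /= /and3P[h1 h2 h3]|none].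
      by left; exists t; exists jj => //; rewrite h1 h2.
    right=> t tM; have [[j j'] /= [h1 h2 /eqP h3]] := group t; have h0 := ltn_trans h1 h2.
    exists j; split => //; have := none (Ordinal tM, (Ordinal h0, Ordinal h2)) => /=.
    by rewrite h1 h3 /= => ->.
  case=> [[t [jj /andP[h1 /eqP h2] h3]]|]; last by right.
  left; exists t; split; first exact: ltn_ord.
  by exists (nat_of_ord jj.1, nat_of_ord jj.2) => //; split => //; exact: ltn_ord.
- apply: (finish t jj.1 t jj.2) => //; first exact: ltn_trans j1 j2.
  by rewrite crt /crossing /lo /hi; move: j1 j2; clear; lia.
have [jt jtP] : exists jt : 'I_M -> 'I_M, forall t : 'I_M, ~~ cr (o (lo t (jt t)) (hi t (jt t))).2.
  apply: (@fin_all_exists _ _ (fun t j : 'I_M => ~~ cr (o (lo t j) (hi t j)).2)) => t.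
  by have [j [jM h]] := ncr t (ltn_ord t); exists (Ordinal jM).
have [t [t' [tt tM E]]] := @pigeonhole O M (fun t => o (lo (inord t : 'I_M) (jt (inord t))) (hi (inord t : 'I_M) (jt (inord t)))) (ltnSn _).
have tM' := ltn_trans tt tM.
have := jtP (inord t); have := E; rewrite !inordK // => E' ncrt.
apply: (finish t (jt (inord t)) t' (jt (inord t'))) => //.
rewrite (negPf ncrt) /crossing /lo /hi.
have := ltn_ord (jt (inord t)); have := ltn_ord (jt (inord t')).
set u1 := nat_of_ord (jt _); set u2 := nat_of_ord (jt _) => h1 h2.
have : t.+1 * (M + M) <= t' * (M + M) by rewrite leq_mul2r tt orbT.
rewrite mulSnr; move: h1 h2; set V := t * _; set V' := t' * _; clear; lia.
Qed.

Lemma ltn_flip m n m' n' : m != n -> m' != n' -> (m < n) = (m' < n') -> (n < m) = (n' < m').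
Proof. by move=> /negPf h /negPf h' E; rewrite !ltnNge (leq_eqVlt m) (leq_eqVlt m') h h' E. Qed.

Lemma size_two p q o : size (two p q o) = 2. Proof. by case: o. Qed.
Lemma size_four p q r t o s : size (four p q r t o s) = 4.
Proof. by case: s; rewrite /four size_cat !size_two. Qed.

(** * Port orders inside cells *)

Section CellWord.
Variables (I : eqType) (N : nat) (F : I -> nat) (lab : I -> 'I_N).
Hypothesis Finj : injective F.
Hypothesis Fmono : forall i j, F i <= F j -> lab i <= lab j.
Variable cell : nat -> nat.

Definition cell_word (z : nat -> I) (p : nat) (w : seq nat) : bool :=
  [&& sorted ltn (map (F \o z) w), all (fun u => lab (z u.1) == lab (z u.2)) (consec w) &
      all (fun u => cell (lab (z u)) == p) w].

Lemma cell_word_two z p u v : z u != z v -> lab (z u) = lab (z v) -> cell (lab (z u)) = p ->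
  cell_word z p (two u v (F (z u) < F (z v))).
Proof.
move=> ne la ce; rewrite /cell_word /two; have : F (z u) != F (z v) by rewrite (inj_eq Finj).
by case: ltngtP => //= lt _; rewrite lt ?la ?eqxx /= -?ce ?la eqxx.
Qed.

Lemma lab_lt i j : lab i < lab j -> F i < F j.
Proof. by move=> lij; rewrite ltnNge; apply/negP => /Fmono; rewrite leqNgt lij. Qed.

(** By [Fmono] the ports of different pieces do not interleave, so the order of the four ports is
    determined by which piece comes first and by the order inside each piece; the latter agree by
    assumption, and one bit records both. *)
Lemma cell_word_four z p u1 u2 v1 v2 : z u1 != z u2 -> z v1 != z v2 ->
  lab (z u1) = lab (z u2) -> lab (z v1) = lab (z v2) -> lab (z u1) != lab (z v1) ->
  (F (z u1) < F (z u2)) = (F (z v1) < F (z v2)) ->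
  cell (lab (z u1)) = p -> cell (lab (z v1)) = p ->
  cell_word z p (four u1 u2 v1 v2 (F (z u1) < F (z u2)) (F (z u1) < F (z v1))).
Proof.
move=> ne1 ne2 l1 l2 l12 o c1 c2; rewrite /cell_word /four /two.
have n1 : F (z u1) != F (z u2) by rewrite (inj_eq Finj).
have n2 : F (z v1) != F (z v2) by rewrite (inj_eq Finj).
have lt4 : lab (z u1) < lab (z v1) ->
    [/\ F (z u1) < F (z v1), F (z u1) < F (z v2), F (z u2) < F (z v1) & F (z u2) < F (z v2)].
  by move=> h; split; apply: lab_lt; rewrite -?l1 -?l2.
have gt4 : lab (z v1) < lab (z u1) ->
    [/\ F (z v1) < F (z u1), F (z v2) < F (z u1), F (z v1) < F (z u2) & F (z v2) < F (z u2)].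
  by move=> h; split; apply: lab_lt; rewrite -?l1 -?l2.
have E1 : (lab (z u2) == lab (z u1)) && (lab (z v2) == lab (z v1)) by rewrite l1 l2 !eqxx.
have E2 : (lab (z u1) == lab (z u2)) && (lab (z v1) == lab (z v2)) by rewrite l1 l2 !eqxx.
have C : [&& cell (lab (z u1)) == p, cell (lab (z u2)) == p, cell (lab (z v1)) == p & cell (lab (z v2)) == p].
  by rewrite -l1 -l2 c1 c2 eqxx.
have : (lab (z u1) : nat) != lab (z v1) by [].
move: C E1 E2; case/and4P => C1 C2 C3 C4 /andP[E1 E1'] /andP[E2 E2'].
have O : (F (z u1) < F (z u2)) && (F (z v1) < F (z v2)) || (F (z u2) < F (z u1)) && (F (z v2) < F (z v1)).
  by move: o n1 n2; case: (ltngtP (F (z u1))) => // ? /esym; case: (ltngtP (F (z v1))).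
rewrite neq_ltn => /orP[/lt4|/gt4] [h1 h2 h3 h4].
  rewrite h1; case/orP: O => /andP[o1 o2].
    by rewrite o1 /= o1 o2 h3 E2 E2' C1 C2 C3 C4.
  by rewrite ltnNge (ltnW o1) /= o1 o2 h2 E1 E1' C1 C2 C3 C4.
rewrite [F (z u1) < F (z v1)]ltnNge (ltnW h1) /=; case/orP: O => /andP[o1 o2].
  by rewrite o1 /= o1 o2 h2 E2 E2' C1 C2 C3 C4.
by rewrite ltnNge (ltnW o1) /= o1 o2 h3 E1 E1' C1 C2 C3 C4.
Qed.

Lemma cell_word_twoE z p u v i j : z u = i -> z v = j -> i != j -> lab i = lab j ->
  cell (lab i) = p -> cell_word z p (two u v (F i < F j)).
Proof. by move=> <- <-; exact: cell_word_two. Qed.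

Lemma cell_word_fourE z p u1 u2 v1 v2 i1 i2 j1 j2 :
  z u1 = i1 -> z u2 = i2 -> z v1 = j1 -> z v2 = j2 ->
  i1 != i2 -> j1 != j2 -> lab i1 = lab i2 -> lab j1 = lab j2 -> lab i1 != lab j1 ->
  (F i1 < F i2) = (F j1 < F j2) -> cell (lab i1) = p -> cell (lab j1) = p ->
  cell_word z p (four u1 u2 v1 v2 (F i1 < F i2) (F i1 < F j1)).
Proof. by move=> <- <- <- <-; exact: cell_word_four. Qed.

End CellWord.

Section Conf.
Variables (I : eqType) (N : nat) (f g : I -> nat) (a b : I -> 'I_N).
Hypothesis finj : injective f.
Hypothesis ginj : injective g.
Hypothesis fmono : forall i j, f i <= f j -> a i <= a j.
Hypothesis gmono : forall i j, g i <= g j -> b i <= b j.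
Hypothesis abinj : forall i j, a i = a j -> b i = b j -> i = j.
Variables (c1 c2 c3 : nat -> nat).
(* [c1] and [c3] give the coarse and the fine cells of the pieces on the first cycle,
   [c2] the cells on the second one. *)

Definition conf (i0 : I) (c : color) (mu u u' r r' : nat) (z : seq I) : Prop :=
  let: (X, M, Y, (J, K)) := words_of c in
  size z = size (wI (words_of c)) /\
  [&& cell_word f a c1 (nth i0 z) r X, cell_word f a c3 (nth i0 z) mu M, cell_word f a c1 (nth i0 z) r' Y,
      cell_word g b c2 (nth i0 z) u J & cell_word g b c2 (nth i0 z) u' K].

(** The two walks bound the closed walk X J M K Y K' M' J', and [z] lists its edges in cyclic order.
    Wherever middle pieces coincide it is pinched to a shorter closed walk. The six cases are the
    six tags; that J, M and K all coincide is excluded by [abinj] and the last hypothesis. Blocks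
    missing from a tag are empty, and an empty block fits every cell. *)
Lemma walks_conf i0 x1 b1 d1 y1 x2 b2 d2 y2 :
  a x1 = a x2 -> a y1 = a y2 ->
  a b1 = a d1 -> a b2 = a d2 ->
  b x1 = b b1 -> b x2 = b b2 -> b d1 = b y1 -> b d2 = b y2 ->
  c2 (b b2) = c2 (b b1) -> c2 (b d2) = c2 (b d1) -> c3 (a b2) = c3 (a b1) ->
  a x1 != a b1 -> a x2 != a b2 -> a y1 != a b1 -> a y2 != a b2 -> b b1 != b d1 -> b b2 != b d2 ->
  (g x1 < g b1) = (g x2 < g b2) -> (f b1 < f d1) = (f b2 < f d2) -> (g d1 < g y1) = (g d2 < g y2) ->
  (x1, b1, d1, y1) != (x2, b2, d2, y2) ->
  exists c z, conf i0 c (c3 (a b1)) (c2 (b b1)) (c2 (b d1)) (c1 (a x1)) (c1 (a y1)) z.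
Proof.
move=> ax ay am1 am2 bj1 bj2 bk1 bk2 cj ck cm nx1 nx2 ny1 ny2 njk1 njk2 oJ oM oK ne.
have dif i j : a i != a j -> i != j by apply: contra_neq => ->.
have difb i j : b i != b j -> i != j by apply: contra_neq => ->.
have x1b1 : x1 != b1 by apply: dif.
have x2b2 : x2 != b2 by apply: dif.
have b1d1 : b1 != d1 by apply: difb.
have b2d2 : b2 != d2 by apply: difb.
have d1y1 : d1 != y1 by apply: dif; rewrite -am1 eq_sym.
have d2y2 : d2 != y2 by apply: dif; rewrite -am2 eq_sym.
have [x1b1' x2b2' b1d1' b2d2' d1y1'] : [/\ b1 != x1, b2 != x2, d1 != b1, d2 != b2 & y1 != d1].
  by split; rewrite eq_sym.
have d2y2' : y2 != d2 by rewrite eq_sym.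
have oM' : (f d1 < f b1) = (f d2 < f b2) by apply: ltn_flip oM; rewrite (inj_eq finj).
have oJ' : (g b1 < g x1) = (g b2 < g x2) by apply: ltn_flip oJ; rewrite (inj_eq ginj).
have oK' : (g y1 < g d1) = (g y2 < g d2) by apply: ltn_flip oK; rewrite (inj_eq ginj).
have [mm|mm] := eqVneq (a b1) (a b2).
  have [jj|jj] := eqVneq (b b1) (b b2).
    have [kk|kk] := eqVneq (b d1) (b d2).
      case/eqP: ne; have e1 := abinj mm jj; have e2 : d1 = d2 by apply: abinj => //; rewrite -am1 mm.
      have e3 : x1 = x2 by apply: abinj; rewrite // bj1 jj.
      have e4 : y1 = y2 by apply: abinj; rewrite // -bk1 kk.
      by rewrite e1 e2 e3 e4.
    exists (inord 4, (f d1 < f d2, f y1 < f y2, g y1 < g d1, g y1 < g y2), (true, true, true, true)).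
    exists [:: y1; d1; d2; y2]; rewrite /conf /= inordK //=; split; first by rewrite ?size_cat ?size_two ?size_four.
    apply/and3P; split => //.
    - by apply: (cell_word_twoE finj (erefl _) (erefl _)) => //; rewrite -?am1 ?mm //; apply: difb.
    - by apply: (cell_word_twoE finj (erefl _) (erefl _)) => //; apply: difb; rewrite -bk1 -bk2.
    - by apply: (cell_word_fourE ginj gmono (erefl _) (erefl _) (erefl _) (erefl _)) => //; rewrite -?bk1 -?bk2.
  exists (inord 3, (f x1 < f x2, f b1 < f b2, g x1 < g b1, g x1 < g x2), (true, true, true, true)).
  exists [:: x1; b1; b2; x2]; rewrite /conf /= inordK //=; split; first by rewrite ?size_cat ?size_two ?size_four.
  apply/and3P; split => //.
  - by apply: (cell_word_twoE finj (erefl _) (erefl _)) => //; apply: difb; rewrite bj1 bj2.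
  - by apply: (cell_word_twoE finj (erefl _) (erefl _)) => //; apply: difb.
  - apply/andP; split => //.
    by apply: (cell_word_fourE ginj gmono (erefl _) (erefl _) (erefl _) (erefl _)) => //; rewrite ?bj1 ?bj2 ?cj // -bj1 // -bj2.
have [jj|jj] := eqVneq (b b1) (b b2).
  have [kk|kk] := eqVneq (b d1) (b d2).
    exists (inord 5, (f b1 < f d1, f b1 < f b2, g b1 < g b2, g d1 < g d2), (true, true, true, true)).
    exists [:: b1; d1; d2; b2]; rewrite /conf /= inordK //=; split; first by rewrite ?size_cat ?size_two ?size_four.
    apply/and3P; split => //.
    + by apply: (cell_word_fourE finj fmono (erefl _) (erefl _) (erefl _) (erefl _)) => //.
    + by apply: (cell_word_twoE ginj (erefl _) (erefl _)) => //; apply: dif.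
    + by apply: (cell_word_twoE ginj (erefl _) (erefl _)) => //; apply: dif; rewrite -am1 -am2.
  exists (inord 1, (f b1 < f d1, f b1 < f b2, f y1 < f y2, g b1 < g b2), (g d1 < g y1, g d1 < g d2, true, true)).
  exists [:: b1; d1; y1; y2; d2; b2]; rewrite /conf /= inordK //=; split; first by rewrite ?size_cat ?size_two ?size_four.
  apply/and4P; split => //.
  + by apply: (cell_word_fourE finj fmono (erefl _) (erefl _) (erefl _) (erefl _)) => //.
  + by apply: (cell_word_twoE finj (erefl _) (erefl _)) => //; apply: difb; rewrite -bk1 -bk2.
  + by apply: (cell_word_twoE ginj (erefl _) (erefl _)) => //; apply: dif.
  + by apply: (cell_word_fourE ginj gmono (erefl _) (erefl _) (erefl _) (erefl _)) => //.
have [kk|kk] := eqVneq (b d1) (b d2).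
  exists (inord 2, (f x1 < f x2, f d1 < f b1, f d1 < f d2, g b1 < g x1), (g b1 < g b2, g d1 < g d2, true, true)).
  exists [:: d1; b1; x1; x2; b2; d2]; rewrite /conf /= inordK //=; split; first by rewrite ?size_cat ?size_two ?size_four.
  apply/and4P; split => //.
  + by apply: (cell_word_twoE finj (erefl _) (erefl _)) => //; apply: difb; rewrite bj1 bj2.
  + by apply: (cell_word_fourE finj fmono (erefl _) (erefl _) (erefl _) (erefl _)) => //; rewrite -?am1 -?am2.
  + by apply: (cell_word_fourE ginj gmono (erefl _) (erefl _) (erefl _) (erefl _)) => //; rewrite ?bj1 ?bj2.
  + by apply: (cell_word_twoE ginj (erefl _) (erefl _)) => //; apply: dif; rewrite -am1 -am2.
exists (inord 0, (f x1 < f x2, f b1 < f d1, f b1 < f b2, f y1 < f y2), (g x1 < g b1, g x1 < g x2, g d1 < g y1, g d1 < g d2)).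
exists [:: x1; b1; d1; y1; y2; d2; b2; x2]; rewrite /conf /= inordK //=; split; first by rewrite ?size_cat ?size_two ?size_four.
apply/and5P; split.
+ by apply: (cell_word_twoE finj (erefl _) (erefl _)) => //; apply: difb; rewrite bj1 bj2.
+ by apply: (cell_word_fourE finj fmono (erefl _) (erefl _) (erefl _) (erefl _)) => //.
+ by apply: (cell_word_twoE finj (erefl _) (erefl _)) => //; apply: difb; rewrite -bk1 -bk2.
+ by apply: (cell_word_fourE ginj gmono (erefl _) (erefl _) (erefl _) (erefl _)) => //; rewrite ?bj1 ?bj2.
+ by apply: (cell_word_fourE ginj gmono (erefl _) (erefl _) (erefl _) (erefl _)) => //.
Qed.

End Conf.

Lemma consec_cat s t : ~~ odd (size s) -> consec (s ++ t) = consec s ++ consec t.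
Proof.
move: {2}(size s) (leqnn (size s)) => n; elim: n s => [|n IH] [|x [|y s]] //= sn; rewrite negbK => ev.
by rewrite IH // -ltnS ltnW.
Qed.

Lemma consec_map (h : nat -> nat) s : consec (map h s) = map (fun u => (h u.1, h u.2)) (consec s).
Proof.
move: {2}(size s) (leqnn (size s)) => n; elim: n s => [|n IH] [|x [|y s]] //= sn.
by rewrite IH // -ltnS ltnW.
Qed.

Lemma mem_consec u s : u \in consec s -> (u.1 \in s) && (u.2 \in s).
Proof.
move: {2}(size s) (leqnn (size s)) => n; elim: n s => [|n IH] [|x [|y s]] //= sn.
rewrite inE => /orP[/eqP -> /=|/IH h]; first by rewrite !inE !eqxx orbT.
by have /andP[h1 h2] := h (ltnW sn); rewrite !inE h1 h2 !orbT.
Qed.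

Lemma all_consec_flatten P (bl : seq (seq nat)) : all (fun s => ~~ odd (size s)) bl ->
  all P (consec (flatten bl)) = all (fun s => all P (consec s)) bl.
Proof. by elim: bl => //= s bl IH /andP[ev evs]; rewrite consec_cat // all_cat IH. Qed.

Lemma sorted_flatten (F : nat -> nat) (bl : seq (seq nat)) :
  all (fun s => sorted ltn (map F s)) bl ->
  pairwise (allrel (fun p q => F p < F q)) bl -> sorted ltn (map F (flatten bl)).
Proof.
move=> sb pb; rewrite (sorted_pairwise ltn_trans); elim: bl sb pb => //= s bl IH /andP[ss sb] /andP[al pb].
rewrite map_cat pairwise_cat IH // -(sorted_pairwise ltn_trans) ss !andbT.
apply/allrelP => _ _ /mapP[p ps ->] /mapP[q /flattenP[t tb qt] ->].
by move/allP/(_ _ tb)/allrelP: al; apply.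
Qed.

(** * Combining two structures of one color *)

Section Assemble.
Variables (I : eqType) (N : nat) (f g : I -> nat) (a b : I -> 'I_N).
Hypothesis fmono : forall i j, f i <= f j -> a i <= a j.
Hypothesis gmono : forall i j, g i <= g j -> b i <= b j.
Variables (c1 c2 c3 cf : nat -> nat).
Hypothesis c1mono : {homo c1 : x y / x <= y}.
Hypothesis c2mono : {homo c2 : x y / x <= y}.
Hypothesis c3mono : {homo c3 : x y / x <= y}.
Hypothesis cfE : forall x, c1 x = cf (c3 x).
Variables (i0 : I) (c : color) (m1 m2 uA uA' rA rA' uB uB' rB rB' : nat).
Hypothesis m12 : m1 < m2.
Hypothesis hA1 : exists z, conf f g a b c1 c2 c3 i0 c m1 uA uA' rA rA' z.
Hypothesis hA2 : exists z, conf f g a b c1 c2 c3 i0 c m2 uA uA' rA rA' z.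
Hypothesis hB1 : exists z, conf f g a b c1 c2 c3 i0 c m1 uB uB' rB rB' z.
Hypothesis hB2 : exists z, conf f g a b c1 c2 c3 i0 c m2 uB uB' rB rB' z.
Variables (cr pa : bool).
Hypothesis ucomp : comparable pa uA uA' uB uB'.
Hypothesis usep : [&& uA < uA', uA < uB', uB < uA' & uB < uB'].
Hypothesis rcross : crossing cr rA rA' rB rB'.
Variable reg : nat.
Hypothesis regP : all (fun r => match reg with 0 => (r < cf m1) && (r < cf m2)
  | 1 => (cf m1 < r) && (r < cf m2) | _ => (cf m1 < r) && (cf m2 < r) end) [:: rA; rA'; rB; rB'].
Hypothesis wfc : combos_ok cr pa (words_of c).

Lemma lt_cell (F : I -> nat) (lab : I -> 'I_N) (Fmono : forall i j, F i <= F j -> lab i <= lab j)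
   (cl : nat -> nat) (clm : {homo cl : x y / x <= y}) i j :
  cl (lab i) < cl (lab j) -> F i < F j.
Proof. by move=> h; rewrite ltnNge; apply/negP => /Fmono/clm; rewrite leqNgt h. Qed.

Lemma cell_word_ext (F : I -> nat) (lab : I -> 'I_N) cl z z' p w :
  {in w, z =1 z'} -> cell_word F lab cl z p w = cell_word F lab cl z' p w.
Proof.
move=> zz; rewrite /cell_word; congr [&& _, _ & _].
- by congr (sorted _ _); apply/eq_in_map => x xw /=; rewrite zz.
- by apply: eq_in_all => u /mem_consec/andP[h1 h2]; rewrite !zz.
- by apply: eq_in_all => u uw; rewrite zz.
Qed.

Lemma cell_word_shift (F : I -> nat) (lab : I -> 'I_N) cl z p w n :
  cell_word F lab cl z p (map (addn n) w) = cell_word F lab cl (fun i => z (n + i)) p w.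
Proof. by rewrite /cell_word -map_comp consec_map !all_map. Qed.

(** The structures A and B are each available in both middle cells. For the given region and order
    of J cells [combos_ok] yields some assignment [asg], and only then is it decided which structure
    is realised in [m1] and which in [m2]. All cells in question are separated, so the concatenated
    blocks are sorted. *)
Lemma assemble : exists z w v, exchangeable f g a b i0 z w v.
Proof.
(* [reg] is any number, but all values from 2 on mean the same region. *)
have [r' r'3 r'P] : exists2 r', r' \in [:: 0; 1; 2] &
  all (fun r => match r' with 0 => (r < cf m1) && (r < cf m2)
  | 1 => (cf m1 < r) && (r < cf m2) | _ => (cf m1 < r) && (cf m2 < r) end) [:: rA; rA'; rB; rB'].
  by case: reg regP => [|[|r]] h; [exists 0|exists 1|exists 2].
(* The order of the J cells is whatever the data give; [ucomp] then forces the order of the K cells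
   that [arrJ] expects. *)
pose sw := uB < uA.
have sw2 : sw \in [:: true; false] by case: sw.
have /hasP[asg _ ok] := allP (allP wfc _ r'3) _ sw2.
pose mA := if asg then m1 else m2; pose mB := if asg then m2 else m1.
have [zA cA] : exists z, conf f g a b c1 c2 c3 i0 c mA uA uA' rA rA' z by rewrite /mA; case: (asg).
have [zB cB] : exists z, conf f g a b c1 c2 c3 i0 c mB uB uB' rB rB' z by rewrite /mB; case: (asg).
have [mAE mBE] : mA = (if asg then m1 else m2) /\ mB = (if asg then m2 else m1) by [].
clearbody mA mB.
move: ok cA cB (color_wf c); rewrite /conf /wf_words /arr_ok /arrI /arrJ /even_blocks.
move E : (words_of c) => k; case: k E => [[[X M] Y] [J K]] _ /=.
set n := size (X ++ M ++ Y); set sh := map (addn n).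
move=> ok [szA bA] [szB bB] /and5P[n0 evn lt_n ev _].
pose z := zA ++ zB; pose zn := nth i0 z.
have znA p : p < n -> zn p = nth i0 zA p by move=> pn; rewrite /zn nth_cat szA pn.
have znB p : zn (n + p) = nth i0 zB p.
  by rewrite /zn nth_cat szA ltnNge leq_addr /= addKn.
have ltX p : p \in (X ++ M ++ Y) ++ J ++ K -> p < n by move/(allP lt_n).
have bl1 (F : I -> nat) (lab : I -> 'I_N) cl p w : {subset w <= (X ++ M ++ Y) ++ J ++ K} ->
    cell_word F lab cl (nth i0 zA) p w -> cell_word F lab cl zn p w.
  by move=> sub; rewrite (@cell_word_ext _ _ _ zn (nth i0 zA)) // => x /sub/ltX/znA.
have bl2 (F : I -> nat) (lab : I -> 'I_N) cl p w : cell_word F lab cl (nth i0 zB) p w -> cell_word F lab cl zn p (sh w).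
  by rewrite cell_word_shift (@cell_word_ext _ _ _ _ (nth i0 zB)) // => x _; apply: znB.
have subX : {subset X <= (X ++ M ++ Y) ++ J ++ K} by move=> x; rewrite !mem_cat => ->.
have subM : {subset M <= (X ++ M ++ Y) ++ J ++ K} by move=> x; rewrite !mem_cat => ->; rewrite !orbT.
have subY : {subset Y <= (X ++ M ++ Y) ++ J ++ K} by move=> x; rewrite !mem_cat => ->; rewrite !orbT.
have subJ : {subset J <= (X ++ M ++ Y) ++ J ++ K} by move=> x; rewrite !mem_cat => ->; rewrite !orbT.
have subK : {subset K <= (X ++ M ++ Y) ++ J ++ K} by move=> x; rewrite !mem_cat => ->; rewrite !orbT.
case/and5P: bA => /(bl1 _ _ _ _ _ subX) AX /(bl1 _ _ _ _ _ subM) AM /(bl1 _ _ _ _ _ subY) AY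
  /(bl1 _ _ _ _ _ subJ) AJ /(bl1 _ _ _ _ _ subK) AK.
case/and5P: bB => /bl2 BX /bl2 BM /bl2 BY /bl2 BJ /bl2 BK.
have blF s s' p q : p < q -> cell_word f a c1 zn p s -> cell_word f a c1 zn q s' ->
    allrel (fun p q => f (zn p) < f (zn q)) s s'.
  move=> pq /and3P[_ _ /allP h1] /and3P[_ _ /allP h2]; apply/allrelP => x y /h1/eqP e1 /h2/eqP e2.
  by apply: (lt_cell fmono c1mono); rewrite e1 e2.
have blF3 s s' p q : p < q -> cell_word f a c3 zn p s -> cell_word f a c3 zn q s' ->
    allrel (fun p q => f (zn p) < f (zn q)) s s'.
  move=> pq /and3P[_ _ /allP h1] /and3P[_ _ /allP h2]; apply/allrelP => x y /h1/eqP e1 /h2/eqP e2.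
  by apply: (lt_cell fmono c3mono); rewrite e1 e2.
have blG s s' p q : p < q -> cell_word g b c2 zn p s -> cell_word g b c2 zn q s' ->
    allrel (fun p q => g (zn p) < g (zn q)) s s'.
  move=> pq /and3P[_ _ /allP h1] /and3P[_ _ /allP h2]; apply/allrelP => x y /h1/eqP e1 /h2/eqP e2.
  by apply: (lt_cell gmono c2mono); rewrite e1 e2.
have bl31 s p : cell_word f a c3 zn p s -> cell_word f a c1 zn (cf p) s.
  by case/and3P=> h1 h2 /allP h3; apply/and3P; split => //; apply/allP => x /h3/eqP <-; rewrite cfE.
have AM' := bl31 _ _ AM; have BM' := bl31 _ _ BM.
have srt (F : I -> nat) (lab : I -> 'I_N) cl p w : cell_word F lab cl zn p w -> sorted ltn (map (F \o zn) w) by case/and3P.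
have sit (F : I -> nat) (lab : I -> 'I_N) cl p w : cell_word F lab cl zn p w -> all (fun u => lab (zn u.1) == lab (zn u.2)) (consec w) by case/and3P.
have evsh s : ~~ odd (size s) -> ~~ odd (size (sh s)) by rewrite size_map.
case/and5P: ev => /= eX eM eY eJ; rewrite andbT => eK.
have finish blI blJ : 
   arr_ok n.*2 (flatten blI) (flatten blJ) ->
   all (fun s => [&& ~~ odd (size s), sorted ltn (map (f \o zn) s) &
      all (fun u => a (zn u.1) == a (zn u.2)) (consec s)]) blI ->
   pairwise (allrel (fun p q => f (zn p) < f (zn q))) blI ->
   all (fun s => [&& ~~ odd (size s), sorted ltn (map (g \o zn) s) &
      all (fun u => b (zn u.1) == b (zn u.2)) (consec s)]) blJ ->
   pairwise (allrel (fun p q => g (zn p) < g (zn q))) blJ ->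
   exists z w v, exchangeable f g a b i0 z w v.
  move=> /and4P[pw pv s1 s2] aI pI aJ pJ; exists z, (flatten blI), (flatten blJ).
  have szz : size z = n.*2 by rewrite size_cat szA szB addnn.
  have sI : sorted ltn (map (f \o zn) (flatten blI)).
    by apply: sorted_flatten => //; apply: sub_all aI => s /and3P[].
  have sJ : sorted ltn (map (g \o zn) (flatten blJ)).
    by apply: sorted_flatten => //; apply: sub_all aJ => s /and3P[].
  split; rewrite ?szz //; last split.
  - split; rewrite ?double_gt0 ?odd_double //.
    have : uniq (map (f \o zn) (flatten blI)) by apply: sorted_uniq sI; [exact: ltn_trans|exact: ltnn].
    rewrite map_comp => /map_uniq; rewrite (perm_uniq (perm_map zn pw)) -szz.
    by rewrite (_ : map zn _ = z) //; exact: mkseq_nth.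
  - rewrite all_consec_flatten; last by apply: sub_all aI => s /and3P[].
    by apply: sub_all aI => s /and3P[].
  - rewrite all_consec_flatten; last by apply: sub_all aJ => s /and3P[].
    by apply: sub_all aJ => s /and3P[].
have good (F : I -> nat) (lab : I -> 'I_N) cl p w : ~~ odd (size w) -> cell_word F lab cl zn p w ->
   [&& ~~ odd (size w), sorted ltn (map (F \o zn) w) & all (fun u => lab (zn u.1) == lab (zn u.2)) (consec w)].
  by move=> -> /and3P[-> ->].
pose blJ := (if sw then [:: sh J; J] else [:: J; sh J]) ++ (if sw == pa then [:: sh K; K] else [:: K; sh K]).
pose R := if cr then [:: X; sh X; Y; sh Y] else [:: X; Y; sh X; sh Y].
pose M1 := if asg then M else sh M; pose M2 := if asg then sh M else M.
pose blI := match r' with 0 => R ++ [:: M1; M2] | 1 => M1 :: R ++ [:: M2] | _ => [:: M1, M2 & R] end.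
have evI s : s \in [:: X; sh X; Y; sh Y; M; sh M] ->
    [&& ~~ odd (size s), sorted ltn (map (f \o zn) s) &
      all (fun u => a (zn u.1) == a (zn u.2)) (consec s)].
  rewrite !inE => /or4P[/eqP->|/eqP->|/eqP->|/or3P[] /eqP->].
  + exact: good AX. + exact: good (evsh _ eX) BX. + exact: good AY.
  + exact: good (evsh _ eY) BY. + exact: good AM. + exact: good (evsh _ eM) BM.
have BM1 : cell_word f a c3 zn m1 M1 by rewrite /M1; move: mAE mBE; case: (asg) => eA eB; rewrite -?eA -?eB.
have BM2 : cell_word f a c3 zn m2 M2 by rewrite /M2; move: mAE mBE; case: (asg) => eA eB; rewrite -?eA -?eB.
have BM1' := bl31 _ _ BM1; have BM2' := bl31 _ _ BM2.
have MM : allrel (fun p q => f (zn p) < f (zn q)) M1 M2 by exact: blF3 m12 BM1 BM2.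
have RR : pairwise (allrel (fun p q => f (zn p) < f (zn q))) R.
  move: rcross; rewrite /R /crossing; case: (cr) => /and3P[h1 h2 h3] /=; rewrite !andbT.
    by rewrite (blF _ _ _ _ _ AX BX) ?(blF _ _ _ _ _ AX AY) ?(blF _ _ _ _ _ AX BY) ?(blF _ _ _ _ _ BX AY)
      ?(blF _ _ _ _ _ BX BY) ?(blF _ _ _ _ _ AY BY) //; move: h1 h2 h3; clear; lia.
  by rewrite (blF _ _ _ _ _ AX AY) ?(blF _ _ _ _ _ AX BX) ?(blF _ _ _ _ _ AX BY) ?(blF _ _ _ _ _ AY BX)
      ?(blF _ _ _ _ _ AY BY) ?(blF _ _ _ _ _ BX BY) //; move: h1 h2 h3; clear; lia.
have Rr s : s \in R -> exists2 r, r \in [:: rA; rA'; rB; rB'] & cell_word f a c1 zn r s.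
  rewrite /R => hs; have : s \in [:: X; sh X; Y; sh Y].
    by move: hs; case: (cr) => //; rewrite !inE => /or4P[] ->; rewrite ?orbT.
  rewrite !inE => /or4P[]/eqP->; [exists rA|exists rB|exists rA'|exists rB'] => //; by rewrite !inE eqxx ?orbT.
have RM s : s \in R -> match r' with
    0 => allrel (fun p q => f (zn p) < f (zn q)) s M1 && allrel (fun p q => f (zn p) < f (zn q)) s M2
  | 1 => allrel (fun p q => f (zn p) < f (zn q)) M1 s && allrel (fun p q => f (zn p) < f (zn q)) s M2
  | _ => allrel (fun p q => f (zn p) < f (zn q)) M1 s && allrel (fun p q => f (zn p) < f (zn q)) M2 s end.
  move=> /Rr[r hr Bs]; have := allP r'P _ hr; case: (r') => [|[|_]] /andP[h1 h2].
  - by rewrite (blF _ _ _ _ h1 Bs BM1') (blF _ _ _ _ h2 Bs BM2').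
  - by rewrite (blF _ _ _ _ h1 BM1' Bs) (blF _ _ _ _ h2 Bs BM2').
  - by rewrite (blF _ _ _ _ h1 BM1' Bs) (blF _ _ _ _ h2 BM2' Bs).
apply: (finish blI blJ).
- move: ok; rewrite /blI /blJ /R -/M1 -/M2.
  by case: (r') => [|[|r'']]; case: (cr); case: (sw); case: (_ == pa);
    rewrite /= ?cats0 -?catA.
- apply/allP => s hs; apply: evI; move: hs; rewrite /blI /R /M1 /M2.
  case: (r') => [|[|r'']]; case: (cr); case: (asg); rewrite !inE;
    do ?[case/orP]; move=> /eqP ->; rewrite eqxx ?orbT //.
- rewrite /blI; case: (r') RM => [|[|_]] RM.
  + rewrite pairwise_cat RR /= MM !andbT; apply/allrelP => s t sR.
    by rewrite !inE; have /andP[h1 h2] := RM s sR; case/orP => /eqP ->.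
  + rewrite pairwise_cons pairwise_cat RR !andbT all_cat /= MM !andbT.
    apply/andP; split; first by apply/allP => s sR; have /andP[] := RM s sR.
    by apply/allrelP => s t sR; rewrite inE => /eqP ->; have /andP[] := RM s sR.
  + rewrite !pairwise_cons RR /= MM !andbT.
    by apply/andP; split; apply/allP => s sR; have /andP[] := RM s sR.
- apply/allP => s hs; have : s \in [:: J; sh J; K; sh K].
    move: hs; rewrite /blJ mem_cat; case: (sw); case: (_ == pa); rewrite !inE;
    do ?[case/orP]; move=> /eqP ->; rewrite eqxx ?orbT //.
  rewrite !inE => /or4P[] /eqP->.
  + exact: good AJ. + exact: good (evsh _ eJ) BJ. + exact: good AK. + exact: good (evsh _ eK) BK.
have /and4P[s1 s2 s3 s4] := usep.
have JK1 := blG _ _ _ _ s1 AJ AK; have JK2 := blG _ _ _ _ s2 AJ BK.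
have JK3 := blG _ _ _ _ s3 BJ AK; have JK4 := blG _ _ _ _ s4 BJ BK.
rewrite /blJ pairwise_cat; apply/and3P; split.
- by apply/allrelP => s t; case: (sw); case: (_ == pa); rewrite !inE => /orP[] /eqP-> /orP[] /eqP->.
- have : if sw then uB < uA else uA < uB.
    by rewrite /sw; move: ucomp; rewrite /comparable; case: (pa); case: ltngtP => //=; rewrite ?andbF.
  by case: (sw) => h /=; rewrite !andbT; [exact: blG h BJ AJ|exact: blG h AJ BJ].
have : if sw == pa then uB' < uA' else uA' < uB'.
  rewrite /sw; move: ucomp; rewrite /comparable; case: (pa); case: ltngtP => //= _; rewrite ?andbF ?orbF ?andbT //.
by case: (sw == pa) => h /=; rewrite !andbT; [exact: blG h BK AK|exact: blG h AK BK].
Qed.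

End Assemble.

(** * Intervals of pieces and counting by fibres *)

Definition cell (N q x : nat) : nat := x * q %/ N.

Lemma cell_mono N q : {homo cell N q : x y / x <= y}.
Proof. by move=> x y xy; rewrite /cell leq_div2r // leq_mul2r xy orbT. Qed.

Lemma cell_lt N q x : x < N -> 0 < q -> cell N q x < q.
Proof. by move=> xN q0; rewrite /cell ltn_divLR ?(leq_ltn_trans _ xN) // mulnC ltn_pmul2l. Qed.

(** Members of one cell differ by less than N/q, so there are at most N/q + 1 of them; the summand
    [q] pays for the rounding. *)
Lemma cell_card N q p : 0 < q -> #|[set x : 'I_N | cell N q x == p]| * q <= N + q.
Proof.
move=> q0; set S := [set x : 'I_N | _].
have [->|[x0 x0S]] := set_0Vmem S; first by rewrite cards0.
have N0 : 0 < N by apply: leq_ltn_trans (ltn_ord x0).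
pose x1 := [arg min_(x < x0 | x \in S) (x : nat)].
have [x1S x1min] : x1 \in S /\ forall x, x \in S -> x1 <= x.
  by rewrite /x1; case: arg_minnP.
have bound x : x \in S -> (x - x1) * q < N.
  move: x1S; rewrite !inE /cell => /eqP e1 xS.
  have /eqP e2 : x * q %/ N == p by move: xS.
  rewrite mulnBl; have := divn_eq (x * q) N; have := divn_eq (x1 * q) N.
  have := ltn_pmod (x * q) N0; rewrite e1 e2; set A := x * q; set B := x1 * q.
  by move: (A %% N) (B %% N) (p * N) => m m' pN h -> ->; lia.
have sub : #|S| <= (N.-1 %/ q).+1.
  rewrite -[X in _ <= X]card_ord.
  pose h (x : 'I_N) : 'I_(N.-1 %/ q).+1 := inord (x - x1).
  have hinj : {in S &, injective h}.
    move=> x y xS yS /(congr1 val); rewrite /h /= !inordK ?ltnS ?leq_divRL //.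
    - move=> E; apply: val_inj => /=; have := x1min _ xS; have := x1min _ yS; move: E.
      by clear; lia.
    - by have := bound _ yS; lia.
    - by have := bound _ xS; lia.
  by rewrite -(card_in_imset hinj) max_card.
apply: leq_trans (_ : (N.-1 %/ q).+1 * q <= _); first by rewrite leq_mul2r sub orbT.
by rewrite mulSn addnC leq_add2r (leq_trans (leq_divM _ _)) // leq_pred.
Qed.

Lemma card_fibers (I J : finType) (h : I -> J) (X : {set J}) (Q : pred I) :
  #|[set i | (h i \in X) && Q i]| = \sum_(x in X) #|[set i | (h i == x) && Q i]|.
Proof.
rewrite -sum1dep_card (partition_big h (mem X)) /=; last by move=> i /andP[].
apply: eq_bigr => x xX; rewrite -sum1dep_card; apply: eq_bigl => i.
by case: eqP => [->|]; rewrite ?xX ?andbT ?andbF.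
Qed.

(** * The regular case *)

Section Concentration.
Variables (I : finType) (N v d D : nat) (a b : I -> 'I_N).
Hypothesis d0 : 0 < d.
Hypothesis hN : N <= 2 * v.
Hypothesis hD : D <= 32 * d.
Hypothesis hb : forall y, #|[set i | b i == y]| <= D.
Hypothesis hsub : forall P Q : {set 'I_N},
  #|[set i | (a i \in P) && (b i \in Q)]| ^ 4 * v <= D ^ 4 * (#|P| + #|Q|) ^ 5.

Definition conc t q : {set 'I_N} :=
  [set x | [exists p : 'I_q, d <= t * #|[set i | (a i == x) && (cell N q (b i) == p)]|]].

(** A cell has s = O(v/q) labels, and the set of pieces concentrated on it has size O(s). For this
    set and the cell [hsub] gives the bound O(v / q^(5/4)) on its size. Summing over the q cells
    leaves a factor q^(-1/4): the gain comes from 5/4 > 1, and q = w^4 makes it the integer w. *)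
Lemma conc_few t w : 0 < w -> w ^ 4 <= v ->
  #|conc t (w ^ 4)| * w <= (3 * (32 * t + 1)) ^ 3 * v.
Proof.
move=> w0 wv; pose q := w ^ 4; have q0 : 0 < q by rewrite expn_gt0 w0.
pose c := 32 * t + 1.
have v0 : 0 < v by apply: leq_trans wv.
pose Xp (p : 'I_q) := [set x | d <= t * #|[set i | (a i == x) && (cell N q (b i) == p)]|].
have Xp_small p : #|Xp p| * w ^ 5 <= (3 * c) ^ 3 * v.
  pose Q := [set y : 'I_N | cell N q y == p].
  pose s := #|Q|; pose e := #|[set i | (a i \in Xp p) && (b i \in Q)]|.
  have sq : s * q <= 3 * v.
    by apply: leq_trans (cell_card N p q0) _; move: hN wv; rewrite /q; clear; lia.
  have e1 : #|Xp p| * d <= t * e.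
    rewrite /e card_fibers big_distrr /= -sum_nat_const leq_sum // => x.
    rewrite inE => h; apply: leq_trans h _; rewrite leq_mul2l; apply/orP; right.
    by apply: subset_leq_card; apply/subsetP => i; rewrite !inE.
  have e2 : e <= s * D.
    rewrite /e (_ : [set i | _] = [set i | (b i \in Q) && (a i \in Xp p)]); last first.
      by apply/setP => i; rewrite !inE andbC.
    rewrite card_fibers -sum_nat_const leq_sum // => y _; apply: leq_trans (hb y).
    by apply: subset_leq_card; apply/subsetP => i; rewrite !inE => /andP[].
  have Xs : #|Xp p| <= 32 * t * s.
    rewrite -(leq_pmul2r d0); apply: leq_trans e1 _.
    apply: leq_trans (_ : t * (s * (32 * d)) <= _).
      by rewrite leq_mul2l (leq_trans e2) ?orbT // leq_mul2l hD orbT.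
    by apply: eq_leq; clear; lia.
  have step : #|Xp p| ^ 4 * v <= c ^ 9 * s ^ 5.
    have d4 : 0 < d ^ 4 by rewrite expn_gt0 d0.
    rewrite -(leq_pmul2r d4) mulnAC -expnMn.
    apply: leq_trans (_ : (t * e) ^ 4 * v <= _); first by rewrite leq_mul2r leq_exp2r ?e1 ?orbT.
    rewrite expnMn -mulnA; apply: leq_trans (_ : t ^ 4 * (D ^ 4 * (#|Xp p| + s) ^ 5) <= _).
      by rewrite leq_mul2l hsub orbT.
    apply: leq_trans (_ : t ^ 4 * ((32 * d) ^ 4 * (c * s) ^ 5) <= _).
      rewrite leq_mul2l leq_mul ?orbT // leq_exp2r //.
      by move: Xs; rewrite /c mulnDl mul1n leq_add2r.
    have -> : t ^ 4 * ((32 * d) ^ 4 * (c * s) ^ 5) = (32 * t) ^ 4 * (c ^ 5 * s ^ 5 * d ^ 4).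
      by rewrite !expnMn; clear; lia.
    have -> : c ^ 9 * s ^ 5 * d ^ 4 = c ^ 4 * (c ^ 5 * s ^ 5 * d ^ 4) by rewrite -[9]/(4 + 5) expnD; clear; lia.
    by rewrite leq_mul2r leq_exp2r // /c addn1 leqnSn orbT.
  have v4 : 0 < v by [].
  rewrite -(leq_exp2r _ _ (isT : 0 < 4)) -(leq_pmul2r v0).
  have -> : (#|Xp p| * w ^ 5) ^ 4 * v = #|Xp p| ^ 4 * v * q ^ 5.
    by rewrite expnMn /q -!expnM; clear; lia.
  apply: leq_trans (_ : c ^ 9 * s ^ 5 * q ^ 5 <= _); first by rewrite leq_mul2r step orbT.
  rewrite -mulnA -expnMn; apply: leq_trans (_ : c ^ 9 * (3 * v) ^ 5 <= _).
    by rewrite leq_mul2l leq_exp2r // sq orbT.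
  have -> : c ^ 9 * (3 * v) ^ 5 = c ^ 9 * 3 ^ 5 * v ^ 5 by rewrite expnMn; clear; lia.
  have -> : ((3 * c) ^ 3 * v) ^ 4 * v = (3 * c) ^ 12 * v ^ 5.
    by rewrite [(_ * v) ^ 4]expnMn -expnM [v ^ 5]expnSr mulnA.
  rewrite leq_mul2r; apply/orP; right; rewrite expnMn mulnC.
  by apply: leq_mul; [rewrite leq_exp2l | apply: leq_pexp2l; rewrite // /c addn1].
have sub : conc t q \subset \bigcup_p Xp p.
  by apply/subsetP => x; rewrite inE => /existsP[p hp]; apply/bigcupP; exists p; rewrite // inE.
have w4 : 0 < w ^ 4 by [].
rewrite -(leq_pmul2r w4).
have -> : #|conc t (w ^ 4)| * w * w ^ 4 = #|conc t q| * w ^ 5 by rewrite /q; clear; lia.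
apply: leq_trans (_ : (\sum_p #|Xp p|) * w ^ 5 <= _).
  rewrite leq_mul2r; apply/orP; right; apply: leq_trans (subset_leq_card sub) _.
  elim/big_rec2: _ => [|p n S _ h]; first by rewrite cards0.
  by apply: leq_trans (leq_card_setU _ _) _; rewrite leq_add2l.
rewrite big_distrl /=; apply: leq_trans (_ : \sum_(p : 'I_q) (3 * c) ^ 3 * v <= _).
  by apply: leq_sum => p _; apply: Xp_small.
by rewrite sum_nat_const card_ord mulnC.
Qed.

End Concentration.

(** * Menger's theorem *)

Section Menger.
Variable T : finType.
Implicit Types (e : rel T) (A B S : {set T}).

Definition separates e A B S := forall x p,
  x \in A -> path e x p -> last x p \in B -> has (mem S) (x :: p).

Definition linkage e A B k (x : 'I_k -> T) (p : 'I_k -> seq T) :=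
  (forall i, [/\ x i \in A, path e (x i) (p i), last (x i) (p i) \in B & uniq (x i :: p i)]) /\
  (forall i j z, i != j -> z \in x i :: p i -> z \notin x j :: p j).

Lemma inj_onto k (f : 'I_k -> T) (Q : {set T}) :
  injective f -> (forall i, f i \in Q) -> #|Q| <= k -> forall y, y \in Q -> exists i, y = f i.
Proof.
move=> finj fQ cQ y yQ.
have E : [set f i | i in [set: 'I_k]] = Q.
  apply/eqP; rewrite eqEcard; apply/andP; split; first by apply/subsetP => _ /imsetP[i _ ->].
  by rewrite card_imset // cardsT card_ord.
by move: yQ; rewrite -E => /imsetP[i _ ->]; exists i.
Qed.

Definition del e (a b : T) : rel T := fun x y => e x y && ((x, y) != (a, b)).

Lemma del_path_head e a b x p : path e x p -> a \notin belast x p -> path (del e a b) x p.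
Proof.
elim: p x => //= y p IH x /andP[xy py]; rewrite inE negb_or => /andP[ax ap].
rewrite IH // andbT /del xy /=; apply: contra ax => /eqP[-> _]; exact: eqxx.
Qed.

Lemma del_path_tail e a b x p : path e x p -> b \notin p -> path (del e a b) x p.
Proof.
elim: p x => //= y p IH x /andP[xy py]; rewrite inE negb_or => /andP[bx bp].
rewrite IH // andbT /del xy /=; apply: contra bx => /eqP[_ ->]; exact: eqxx.
Qed.

Lemma first_hit S x p : has (mem S) (x :: p) -> exists p1 p2,
  [/\ p = p1 ++ p2, last x p1 \in S & ~~ has (mem S) (belast x p1)].
Proof.
elim: p x => [|y p IH] x /=; first by rewrite orbF => xS; exists [::], [::].
case xS: (x \in S) => /=; first by move=> _; exists [::], (y :: p).
case/IH => p1 [p2 [-> l n]]; exists (y :: p1), p2; split => //=.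
by rewrite xS.
Qed.

Lemma last_hit S x p : has (mem S) (x :: p) -> exists p1 p2,
  [/\ p = p1 ++ p2, last x p1 \in S & ~~ has (mem S) p2].
Proof.
elim: p x => [|y p IH] x; first by rewrite /= orbF => xS; exists [::], [::].
case h: (has (mem S) (y :: p)).
  by move=> _; have [p1 [p2 [-> l n]]] := IH y h; exists (y :: p1), p2.
move=> hx; exists [::], (y :: p); split; rewrite ?h //=.
by move: hx; rewrite (_ : has _ _ = (x \in S) || has (mem S) (y :: p)) // h orbF.
Qed.

Lemma linkage_sub e e' A B k x p : subrel e' e -> @linkage e' A B k x p -> linkage e A B x p.
Proof.
move=> sub [h1 h2]; split => // i; have [? pp ? ?] := h1 i; split => //.
exact: sub_path pp.
Qed.

(** Induction on the number of edges, for directed [e]. If after deletion of an edge (a, b) some S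
    with fewer than k vertices separates, then S + a and S + b both separate in [e], so |S| = k - 1.
    Induction links A to S + a and S + b to B without the edge, and the two linkages are glued at S
    and across (a, b). *)
Lemma menger e A B k : (forall S, separates e A B S -> k <= #|S|) ->
  exists x p, @linkage e A B k x p.
Proof.
move: {2}#|[set u : T * T | e u.1 u.2]| (leqnn #|[set u : T * T | e u.1 u.2]|) => n.
elim: n e A B => [|n IH] e A B ne sep.
  have none x y : e x y = false.
    apply/negP => exy; move: ne; rewrite leqn0 cards_eq0 => /eqP/setP/(_ (x, y)).
    by rewrite !inE /= exy.
  have kAB : k <= #|A :&: B|.
    by apply: sep => x [|y p] xA //=; rewrite ?none // => _ xB; rewrite !inE xA xB.
  pose x (i : 'I_k) := enum_val (widen_ord kAB i).
  exists x, (fun=> [::]); split => [i|i j z ij] /=.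
    by have := enum_valP (widen_ord kAB i); rewrite inE => /andP[xA xB].
  rewrite !inE => /eqP ->; apply: contra ij => /eqP /enum_val_inj /(congr1 val) /= h.
  by apply/eqP/val_inj.
case: (pickP (fun u : T * T => e u.1 u.2)) => [[a b] /= eab|none]; last first.
  by apply: IH => //; rewrite (_ : [set u | _] = set0) ?cards0 //; apply/setP => u; rewrite !inE none.
pose e' := del e a b.
have ne' : #|[set u : T * T | e' u.1 u.2]| <= n.
  rewrite -ltnS; apply: leq_trans ne; apply: proper_card; apply/properP; split.
    by apply/subsetP => -[u v]; rewrite !inE /= => /andP[].
  by exists (a, b); rewrite !inE /= ?eab // /e' /del eqxx andbF.
have sube : subrel e' e by move=> u v /andP[].
(* The relation tests only the vertices entered, so the start [x] has to be kept out of S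
   separately. *)
case: (pickP (fun S : {set T} => (#|S| < k) &&
    ~~ [exists x : T, exists y : T, [&& x \in A, y \in B & connect (fun u v => e' u v && (v \notin S)) x y && (x \notin S)]])); last first.
  move=> noS; have [S sS|x [p lp]] := IH e' A B ne'.
    rewrite leqNgt; apply/negP => Sk; have := noS S; rewrite Sk /= => /negbT/negPn.
    case/existsP => x /existsP[y /and3P[xA yB /andP[/connectP[p pp yl] xS]]].
    have pe : path e' x p by apply: sub_path pp => u v /andP[].
    have pS : ~~ has (mem S) p.
      by elim: p x pp {yl pe xA xS} => //= u p IHp x /andP[/andP[_ uS] pp]; rewrite negb_or uS (IHp u).
    by have := sS x p xA pe ltac:(by rewrite -yl); rewrite /= (negPf xS) (negPf pS).
  by exists x, p; apply: linkage_sub lp.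
move=> S /andP[Sk nS].
have sS : separates e' A B S.
  move=> x p xA pp lB; apply: contraNT nS => /=; rewrite negb_or => /andP[xS pS].
  apply/existsP; exists x; apply/existsP; exists (last x p); rewrite xA lB xS andbT /=.
  apply/connectP; exists p => //; elim: p x pp pS {lB xA xS} => //= u p IHp x /andP[xu pp].
  by rewrite negb_or => /andP[uS pS]; rewrite xu uS IHp.
have sepP c : (c == a) || (c == b) -> separates e A B (c |: S).
  move=> cab x p xA pp lB; apply/negPn/negP => nh.
  have nS' : ~~ has (mem S) (x :: p).
    by apply: contra nh; apply: sub_has => z zS; rewrite !inE; rewrite /= in zS; rewrite zS orbT.
  have cn : c \notin x :: p.
    by apply: contra nh => cp; apply/hasP; exists c; rewrite //= setU11.
  move/negP: nS'; apply; apply: sS lB => //.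
  case/orP: cab => /eqP ce; subst c.
    apply: del_path_head => //; apply: contra cn => /mem_belast //.
  by apply: del_path_tail => //; apply: contra cn; rewrite inE orbC => ->.
have card c : (c == a) || (c == b) -> #|c |: S| = k /\ c \notin S.
  move=> cab; have := sep _ (sepP c cab); rewrite cardsU1; case: (c \in S) => /=; lia.
have [cP aS] := card a ltac:(by rewrite eqxx).
have [cQ bS] := card b ltac:(by rewrite eqxx orbT).
have sA := sepP a ltac:(by rewrite eqxx).
have sB := sepP b ltac:(by rewrite eqxx orbT).
have [X sX|x [p [lp1 lp2]]] := IH e' A (a |: S) ne'.
  apply: sep => u p uA pp lB.
  have [p1 [p2 [pE l1 n1]]] := first_hit (sA u p uA pp lB).
  have : has (mem X) (u :: p1).
    apply: sX => //; move: pp; rewrite pE cat_path => /andP[pp1 _].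
    apply: del_path_head => //; apply: contra n1 => ab; apply/hasP; exists a => //=.
    by rewrite setU11.
  by rewrite pE /= has_cat => /orP[->|->]; rewrite ?orbT.
have [X sX|x' [p' [lq1 lq2]]] := IH e' (b |: S) B ne'.
  apply: sep => u p0 uA pp lB.
  have [p1 [p2 [pE l1 n1]]] := last_hit (sB u p0 uA pp lB).
  have : has (mem X) (last u p1 :: p2).
    apply: sX => //; last by rewrite -last_cat -pE.
    move: pp; rewrite pE cat_path => /andP[_ pp2].
    apply: del_path_tail => //; apply: contra n1 => ab; apply/hasP; exists b => //=.
    by rewrite setU11.
  rewrite pE -cat_cons has_cat /= => /orP[lX|->]; last by rewrite orbT.
  rewrite -[(u \in X) || _]/(has (mem X) (u :: p1)); apply/orP; left; apply/hasP.
  by exists (last u p1) => //; exact: mem_last.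
have linj : injective (fun i => last (x i) (p i)).
  move=> i j /= lij; apply/eqP/negPn/negP => ij; have := lp2 i j (last (x i) (p i)) ij.
  by rewrite mem_last => /(_ isT); rewrite lij mem_last.
have xinj : injective x'.
  move=> i j /= lij; apply/eqP/negPn/negP => ij; have := lq2 i j (x' i) ij.
  by rewrite mem_head => /(_ isT); rewrite lij mem_head.
have lonto z : z \in a |: S -> exists i, z = last (x i) (p i).
  by apply: (inj_onto linj); rewrite ?cP // => i; have [] := lp1 i.
have xonto z : z \in b |: S -> exists i, z = x' i.
  by apply: (inj_onto xinj); rewrite ?cQ // => i; have [] := lq1 i.
have Pend i z : z \in S -> z \in x i :: p i -> z = last (x i) (p i).
  move=> zS zi; have [j zj] := lonto z ltac:(by rewrite inE zS orbT).
  have [->//|ij] := eqVneq i j; have := lp2 i j z ij zi.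
  by rewrite zj mem_last.
have Qend i z : z \in S -> z \in x' i :: p' i -> z = x' i.
  move=> zS zi; have [j zj] := xonto z ltac:(by rewrite inE zS orbT).
  have [->//|ij] := eqVneq i j; have := lq2 i j z ij zi.
  by rewrite zj mem_head.
(* A common vertex outside S would let a path switch from the first linkage to the second and avoid
   S, which separates once (a, b) is deleted. *)
have meet i j z : z \in x i :: p i -> z \in x' j :: p' j ->
    [/\ z \in S, z = last (x i) (p i) & z = x' j].
  move=> zi zj; suff zS : z \in S by split => //; [exact: Pend|exact: Qend].
  have [xA pp _ up] := lp1 i; have [_ pp' lB up'] := lq1 j.
  move: (Pend i) (Qend j); case/splitPl: zi pp up => p1 p2 l1 pp up.
  case/splitPl: zj pp' lB up' => q1 q2 l2 pp' lB up' Pi Qj.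
  have := sS (x i) (p1 ++ q2) xA.
  move: pp pp'; rewrite !cat_path l1 l2 => /andP[-> _] /andP[_ ->].
  rewrite last_cat l1; rewrite last_cat l2 in lB; rewrite lB => /(_ isT isT).
  rewrite -cat_cons has_cat => /orP[|] /hasP[s sp sS'].
    have := Pi s sS' ltac:(by rewrite -cat_cons mem_cat sp).
    rewrite last_cat l1 => sE.
    case: p2 {Pi} up sE => [_ /= <-//|u p2]; rewrite -cat_cons cat_uniq => /and3P[_ /hasPn up _] sE.
    have si : s \in u :: p2 by rewrite sE; exact: (mem_last u p2).
    by have /negP[] := up s si.
  have := Qj s sS' ltac:(by rewrite -cat_cons mem_cat sp orbT) => sE.
  by move: up'; rewrite -cat_cons cat_uniq => /and3P[_ /hasPn /(_ s sp)]; rewrite sE /= mem_head.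
have tau i : exists j, x' j = if last (x i) (p i) \in S then last (x i) (p i) else b.
  have [|j jE] := xonto (if last (x i) (p i) \in S then last (x i) (p i) else b).
    by case: ifP => h; rewrite !inE ?h ?eqxx ?orbT.
  by exists j.
have [t tE] := fin_all_exists tau.
(* A path ending in S continues at the same vertex, which is not repeated; the path ending in [a]
   first steps across the edge to [b]. *)
exists x, (fun i => p i ++ if last (x i) (p i) \in S then p' (t i) else x' (t i) :: p' (t i)).
have tinj i j : i != j -> t i != t j.
  apply: contra => /eqP tij; have := tE i; rewrite tij tE.
  have [_ _] := lp1 i; have [_ _] := lp1 j; rewrite !inE => lj _ li _.
  case: ifP => h1; case: ifP => h2 h.
  - by apply/eqP/linj.
  - by move: h1; rewrite h (negPf bS).
  - by move: h2; rewrite -h (negPf bS).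
  - by apply/eqP/linj => /=; move: li lj; rewrite h1 h2 !orbF => /eqP-> /eqP->.
have sub i z : z \in x i :: p i ++ (if last (x i) (p i) \in S then p' (t i) else x' (t i) :: p' (t i)) ->
    (z \in x i :: p i) || (z \in x' (t i) :: p' (t i)).
  rewrite -cat_cons mem_cat => /orP[->//|]; case: ifP => _ h; last by rewrite h orbT.
  by rewrite !inE h !orbT.
split=> [i|i j z ij zi].
  have [xA pp lP up] := lp1 i; have [xQ pp' lB up'] := lq1 (t i).
  have ti := tE i; split => //.
  - rewrite cat_path (sub_path sube pp) /=; case: ifP ti => h ti.
      by rewrite -ti (sub_path sube).
    rewrite /= (sub_path sube pp') andbT ti.
    by move: lP; rewrite !inE h orbF => /eqP ->.
  - by rewrite last_cat; case: ifP ti => h ti //; rewrite -ti.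
  - rewrite -cat_cons cat_uniq up /=; apply/andP; split; last first.
      by case: ifP => _ //; case/andP: up'.
    apply/hasPn => z; case: ifP ti => h ti zq; apply/negP => /= zp.
      have [_ _ zx] := meet i (t i) z zp ltac:(by rewrite inE zq orbT).
      by move: up'; rewrite /= -zx zq.
    by have [zS zl _] := meet i (t i) z zp zq; rewrite -zl zS in h.
apply/negP => /sub zj; move/sub: zi => zi.
have ji : j != i by rewrite eq_sym.
case/orP: zi => zi; case/orP: zj => zj.
- by have := lp2 i j z ij zi; rewrite zj.
- have [zS zl zx] := meet i (t j) z zi zj.
  have := tE j; rewrite -zx; case: ifP => h zE; last by move: bS; rewrite -zE zS.
  by move: ij => /eqP; apply; apply: linj; rewrite /= -zl.
- have [zS zl zx] := meet j (t i) z zj zi.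
  have := tE i; rewrite -zx; case: ifP => h zE; last by move: bS; rewrite -zE zS.
  by move: ij => /eqP; apply; apply: linj; rewrite /= -zl.
- by have := lq2 (t i) (t j) z (tinj _ _ ij) zi; rewrite zj.
Qed.

End Menger.

(** Cells of weight below d/(2q) hold less than half of [d] in total, so fewer than [n] cells share
    the other half and one of them gets at least d/(2n). *)
Lemma heavy_cell q (cnt : 'I_q -> nat) n d : 0 < d -> d <= \sum_r cnt r ->
  #|[set r | d <= 2 * q * cnt r]| < n -> exists r, d <= 2 * n * cnt r.
Proof.
move=> d0 hs hn; have n0 : 0 < n by apply: leq_ltn_trans hn.
set S := [set r | _] in hn.
apply/existsP; apply: contraT; rewrite negb_exists => /forallP nex.
have q0 : 0 < q.
  by case: q cnt hs {hn S nex} => // cnt; rewrite big_ord0 => hs; move: d0 hs; clear; lia.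
suff : 2 * n * q * (\sum_r cnt r) <= 2 * n * q * (d - 1).
  by rewrite leq_pmul2l ?muln_gt0 ?n0 //; move: d0 hs; clear; lia.
rewrite (bigID (mem S)) /= mulnDr.
apply: leq_trans (_ : q * (#|S| * (d - 1)) + n * (q * (d - 1)) <= _); last first.
  have : q * (#|S| * (d - 1)) <= q * (n * (d - 1)) by rewrite leq_mul2l leq_mul2r (ltnW hn) !orbT.
  by clear; lia.
apply: leq_add.
  rewrite -[2 * n * q]mulnC -mulnA leq_mul2l; apply/orP; right.
  rewrite big_distrr /= -sum_nat_const leq_sum // => r _.
  by have := nex r; rewrite -ltnNge; move: d0; clear; lia.
rewrite -[2 * n]mulnC -2!mulnA leq_mul2l; apply/orP; right.
rewrite mulnA big_distrr /=; apply: leq_trans (_ : \sum_(r | r \notin S) (d - 1) <= _).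
  by apply: leq_sum => r; rewrite inE -ltnNge; move: d0; clear; lia.
rewrite sum_nat_const leq_mul2r; apply/orP; right.
by rewrite -[X in _ <= X]card_ord max_card.
Qed.

Lemma card_fibersT (I J : finType) (h : I -> J) (Q : pred I) :
  #|[set i | Q i]| = \sum_x #|[set i | Q i && (h i == x)]|.
Proof.
rewrite -sum1dep_card (partition_big h xpredT) //=.
by apply: eq_bigr => x _; rewrite -sum1dep_card.
Qed.

Lemma card_fibers_le (I J : finType) (h : I -> J) (X : {set J}) (Q : pred I) n :
  (forall x, #|[set i | h i == x]| <= n) -> #|[set i | (h i \in X) && Q i]| <= #|X| * n.
Proof.
move=> hn; rewrite card_fibers -sum_nat_const leq_sum // => x _; apply: leq_trans (hn x).
by apply: subset_leq_card; apply/subsetP => i; rewrite !inE => /andP[].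
Qed.

Lemma sorted_enum_ord n (S : {set 'I_n}) : sorted ltn (map val (enum S)).
Proof.
apply: (subseq_sorted ltn_trans _ (iota_ltn_sorted 0 n)); rewrite -val_enum_ord.
by apply: map_subseq; rewrite enumT; exact: filter_subseq.
Qed.

Lemma sorted_nth_lt n (s : seq 'I_n) o i j : sorted ltn (map val s) -> i < j -> j < size s ->
  (nth o s i < nth o s j)%N.
Proof.
move=> ss ij js; have := sorted_ltn_nth ltn_trans (val o) ss; rewrite size_map => /(_ i j).
have is_ := ltn_trans ij js.
by rewrite !inE => h; have := h is_ js ij; rewrite !(nth_map o).
Qed.

(** * Middle pieces rich in walks *)

Section Regular.
Variables (I : finType) (N v d D : nat) (f g : I -> nat) (a b : I -> 'I_N).
Hypothesis d0 : 0 < d.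
Hypothesis hN : N <= 2 * v.
Hypothesis hD : D <= 32 * d.
Hypothesis finj : injective f.
Hypothesis ginj : injective g.
Hypothesis fmono : forall i j, f i <= f j -> a i <= a j.
Hypothesis gmono : forall i j, g i <= g j -> b i <= b j.
Hypothesis abinj : forall i j, a i = a j -> b i = b j -> i = j.
Hypothesis a_le : forall x, #|[set i | a i == x]| <= D.
Hypothesis b_le : forall y, #|[set i | b i == y]| <= D.
Hypothesis a_ge : forall i, d <= #|[set j | a j == a i]|.
Hypothesis b_ge : forall i, d <= #|[set j | b j == b i]|.
Hypothesis hsub : forall P Q : {set 'I_N},
  #|[set i | (a i \in P) && (b i \in Q)]| ^ 4 * v <= D ^ 4 * (#|P| + #|Q|) ^ 5.
Hypothesis pieces : v <= 4 * #|[set a i | i in I]|.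

Variables (n1 n2 w1 w2 q' : nat).
Let q1 := w1 ^ 4.
Let q2 := w2 ^ 4.
Let q3 := q1 * q'.
Let tau := #|{set 'I_q1}|.
Hypothesis q1_gt0 : 0 < q1.
Hypothesis q2_gt0 : 0 < q2.
Hypothesis q3_gt0 : 0 < q3.
Hypothesis w1_big : 64 * 32 * (3 * (32 * (2 * n1) + 1)) ^ 3 <= w1.
Hypothesis w2_big : 32 * (3 * (32 * (2 * n2 * (2 * tau)) + 1)) ^ 3 <= w2.
Hypothesis q1v : q1 <= v.
Hypothesis q2v : q2 <= v.
Hypothesis q3v : q3 <= v.
Let c3 := ((4 * tau * q2) * (2 * q1)) ^ 2.
Variable T : nat.
Hypothesis TE : T = 32 ^ 4.
Hypothesis hK : T * (32 * 32) * (c3 * (q2 ^ 2 * q3)) * v <= D ^ 4.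

Let w1_gt0 : 0 < w1.
Proof. by apply: leq_trans w1_big; rewrite muln_gt0 expn_gt0 addn1 muln_gt0. Qed.
Let w2_gt0 : 0 < w2.
Proof. by apply: leq_trans w2_big; rewrite muln_gt0 expn_gt0 addn1 muln_gt0. Qed.
Let v0 : 0 < v. Proof. exact: leq_trans q1v. Qed.

Lemma hsubC (P Q : {set 'I_N}) :
  #|[set i | (b i \in P) && (a i \in Q)]| ^ 4 * v <= D ^ 4 * (#|P| + #|Q|) ^ 5.
Proof.
rewrite (_ : [set i | _] = [set i | (a i \in Q) && (b i \in P)]) 1?addnC //.
by apply/setP => i; rewrite !inE andbC.
Qed.

Definition cells_at (y : 'I_N) : {set 'I_q1} :=
  [set r : 'I_q1 | d <= 2 * q1 * #|[set i | (b i == y) && (cell N q1 (a i) == r)]|].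

Definition badJ : {set 'I_N} := [set y | [exists i, b i == y] && (#|cells_at y| < n1)].

Let ocell q (q0 : 0 < q) (x : 'I_N) : 'I_q := Ordinal (cell_lt (ltn_ord x) q0).

Lemma card_cells (J : finType) q (q0 : 0 < q) (lab : J -> 'I_N) (Q : pred J) :
  #|[set i | Q i]| = \sum_(r < q) #|[set i | Q i && (cell N q (lab i) == r)]|.
Proof.
rewrite (card_fibersT (fun i => ocell q0 (lab i))); apply: eq_bigr => r _.
by apply: eq_card => i; rewrite !inE -val_eqE.
Qed.

(** With fewer than [n1] cells of decent weight, [heavy_cell] puts a share 1/(2 n1) of [d] into one
    cell, so the piece is concentrated. *)
Lemma badJ_few : #|badJ| * w1 <= (3 * (32 * (2 * n1) + 1)) ^ 3 * v.
Proof.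
apply: leq_trans (conc_few d0 hN hD a_le hsubC (2 * n1) w1_gt0 q1v).
rewrite leq_mul2r; apply/orP; right; apply: subset_leq_card; apply/subsetP => y.
rewrite inE => /andP[/existsP[i /eqP iy] hn]; rewrite inE.
have hs : d <= \sum_(r < q1) #|[set j | (b j == y) && (cell N q1 (a j) == r)]|.
  by rewrite -(card_cells q1_gt0 a (fun j => b j == y)) -iy b_ge.
by have [r hr] := heavy_cell d0 hs hn; apply/existsP; exists r.
Qed.

Definition badI1 : {set 'I_N} :=
  [set x | d <= 2 * #|[set i | (a i == x) && (b i \in badJ)]|].

(** Each member spends at least d/2 edges on [badJ], whose members have degree at most 32 d; hence
    the factor 64 in [w1_big], the other 32 being the target. *)
Lemma badI1_few : 32 * #|badI1| <= v.
Proof.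
have h : #|badI1| <= 64 * #|badJ|.
  rewrite -(leq_pmul2r d0).
  apply: leq_trans (_ : 2 * #|[set i | (a i \in badI1) && (b i \in badJ)]| <= _).
    rewrite card_fibers big_distrr /= -sum_nat_const leq_sum // => x.
    by rewrite inE.
  have : #|[set i | (a i \in badI1) && (b i \in badJ)]| <= #|badJ| * D.
    rewrite (_ : [set i | _] = [set i | (b i \in badJ) && (a i \in badI1)]).
      exact: card_fibers_le.
    by apply/setP => i; rewrite !inE andbC.
  have : #|badJ| * D <= #|badJ| * (32 * d) by rewrite leq_mul2l hD orbT.
  by clear; lia.
have := badJ_few; move: h w1_big.
have : 0 < (3 * (32 * (2 * n1) + 1)) ^ 3 by rewrite expn_gt0 addn1 muln_gt0.
move: (#|badI1|) (#|badJ|) ((3 * (32 * (2 * n1) + 1)) ^ 3) => x y C C0 h hw hy.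
have h1 : y * (64 * 32 * C) <= C * v by apply: leq_trans hy; rewrite leq_mul2l hw orbT.
have h2 : y * 2048 <= v by rewrite -(leq_pmul2r C0); move: h1; clear; lia.
by move: h h2; clear; lia.
Qed.

(** The type of an edge at [x] is the set of cells in which its J piece has many edges; there are
    [tau] types, a bound independent of the graph. *)
Definition typed (x : 'I_N) (S : {set 'I_q1}) : {set I} :=
  [set i | [&& a i == x, b i \notin badJ & cells_at (b i) == S]].

Definition popular (x : 'I_N) (S : {set 'I_q1}) : {set 'I_q2} :=
  [set u : 'I_q2 | d <= 2 * q2 * (2 * tau * #|[set i in typed x S | cell N q2 (b i) == u]|)].

Definition badI2 : {set 'I_N} :=
  [set x | [exists S, (d <= 2 * tau * #|typed x S|) && (#|popular x S| < n2)]].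

Lemma badI2_few : 32 * #|badI2| <= v.
Proof.
have := conc_few d0 hN hD b_le hsub (2 * n2 * (2 * tau)) w2_gt0 q2v.
have := w2_big; set C := (_ ^ 3) => hw h1.
have C0 : 0 < C by rewrite expn_gt0 addn1 muln_gt0.
have h2 : #|badI2| <= #|conc d a b (2 * n2 * (2 * tau)) q2|.
  apply: subset_leq_card; apply/subsetP => x; rewrite inE => /existsP[S /andP[hS hn]]; rewrite inE.
  have hs : d <= \sum_(r < q2) 2 * tau * #|[set i in typed x S | cell N q2 (b i) == r]|.
    by rewrite -big_distrr /= -(card_cells q2_gt0 b (mem (typed x S))) cardsE.
  have [r hr] := heavy_cell d0 hs hn; apply/existsP; exists r.
  apply: leq_trans hr _; rewrite mulnA leq_mul2l; apply/orP; right.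
  by apply: subset_leq_card; apply/subsetP => i; rewrite !inE => /andP[/and3P[-> _ _] ->].
have h3 : #|badI2| * (32 * C) <= C * v.
  by apply: leq_trans h1; apply: leq_mul.
rewrite -(leq_pmul2r C0); move: h3; clear; lia.
Qed.

(** At least d/2 edges at [x] avoid [badJ], so one of the [tau] types carries at least d/(2 tau) of
    them; [badI2] excludes that this type has few popular cells. *)
Lemma popular_type (x : 'I_N) : (exists i, a i = x) -> x \notin badI1 -> x \notin badI2 ->
  exists S : {set 'I_q1}, [/\ n1 <= #|S|, n2 <= #|popular x S| & forall i, i \in typed x S -> cells_at (b i) = S].
Proof.
move=> [i0 ix] h1 h2.
pose G := [set i | (a i == x) && (b i \notin badJ)].
have hG : d <= 2 * #|G|.
  have := a_ge i0; rewrite ix; move: h1; rewrite inE -ltnNge.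
  rewrite (_ : #|[set j | a j == x]| = #|[set i | (a i == x) && (b i \in badJ)]| + #|G|).
    by clear; lia.
  rewrite -(cardsID [set i | b i \in badJ] [set j | a j == x]).
  by congr (_ + _); apply: eq_card => i; rewrite !inE // andbC.
have tau0 : 0 < tau by apply/card_gt0P; exists set0.
have sumG : #|G| = \sum_S #|typed x S|.
  rewrite (card_fibersT (fun i => cells_at (b i))); apply: eq_bigr => S _.
  by apply: eq_card => i; rewrite !inE andbA.
have [S hS] : exists S, d <= 2 * tau * #|typed x S|.
  apply/existsP; apply: contraT; rewrite negb_exists => /forallP nex.
  have : tau * (2 * #|G|) <= tau * (d - 1).
    rewrite mulnA [tau * 2]mulnC sumG big_distrr /= -sum_nat_const leq_sum // => S _.
    by have := nex S; rewrite -ltnNge; move: d0; clear; lia.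
  by rewrite leq_pmul2l //; move: hG d0; clear; lia.
exists S; split.
- have : 0 < #|typed x S| by move: hS d0; case: (#|_|) => //; rewrite muln0; clear; lia.
  move=> /card_gt0P[i]; rewrite inE => /and3P[_ hi /eqP <-].
  move: hi; rewrite inE negb_and -leqNgt => /orP[|//].
  by move/negP; case; apply/existsP; exists i.
- by move: h2; rewrite inE negb_exists => /forallP/(_ S); rewrite hS /= -leqNgt.
- by move=> i; rewrite inE => /and3P[_ _ /eqP].
Qed.

(* A walk X - J - M - K - Y is given by its edges (XJ, JM, MK, KY). *)
Notation walk := (I * I * I * I)%type.

Definition is_walk (w : walk) : bool :=
  let: (x, m, k, y) := w in [&& a m == a k, b x == b m & b k == b y].

Definition walk_class (w : walk) :=
  let: (x, m, k, y) := w in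
  ((a x, a y), (ocell q2_gt0 (b m), ocell q3_gt0 (a m), ocell q2_gt0 (b k)),
   ((g x < g m), (f m < f k), (g k < g y))).

Definition lonely : {set walk} :=
  [set w | is_walk w && [forall w', is_walk w' && (walk_class w' == walk_class w) ==> (w' == w)]].

(** A class contains at most one lonely walk, so it is enough to count classes: two end pieces,
    cells for J, M, K and three orientation bits. *)
Lemma lonely_few : #|lonely| <= 8 * (N ^ 2 * (q2 ^ 2 * q3)).
Proof.
have inj : {in lonely &, injective walk_class}.
  move=> w w'; rewrite !inE => /andP[h1 _] /andP[_ /forallP/(_ w)] h E.
  by move: h; rewrite h1 E eqxx /= => /eqP.
rewrite -(card_in_imset inj); apply: leq_trans (max_card _) _.
rewrite !card_prod !card_ord !card_bool; apply: eq_leq; rewrite !expnS !expn0; clear; lia.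
Qed.

Definition badI3 : {set 'I_N} :=
  [set x | d ^ 4 <= c3 * #|[set w in lonely | a w.1.1.2 == x]|].

(** Here D^4 >> v enters: every member absorbs at least d^4 / c3 lonely walks, of which there are
    only O(v^2). *)
Lemma badI3_few : 32 * #|badI3| <= v.
Proof.
have h1 : #|badI3| * d ^ 4 <= c3 * #|lonely|.
  rewrite -sum_nat_const; apply: leq_trans (_ : \sum_(x in badI3) c3 * #|[set w in lonely | a w.1.1.2 == x]| <= _).
    by apply: leq_sum => x; rewrite inE.
  rewrite -big_distrr /= leq_mul2l; apply/orP; right.
  rewrite -[X in _ <= X]cardsE (card_fibersT (fun w : walk => a w.1.1.2)).
  rewrite [X in _ <= X](bigID (mem badI3)) /=; apply: leq_trans (leq_addr _ _).
  by apply: leq_sum => x _; apply: subset_leq_card; apply/subsetP => w; rewrite !inE.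
have h2 := lonely_few.
have T0 : 0 < T by rewrite TE expn_gt0.
have h3 : D ^ 4 <= T * d ^ 4 by rewrite TE -expnMn leq_exp2r.
have h4 : N ^ 2 <= 4 * v ^ 2 by rewrite -[4]/(2 ^ 2) -expnMn leq_exp2r.
have [Z ZE] : exists Z, Z = c3 * (q2 ^ 2 * q3) by eexists.
have hK' : T * (32 * 32) * Z * v <= D ^ 4.
  by rewrite ZE.
have Z0 : 0 < Z.
  have tau0 : 0 < tau by apply/card_gt0P; exists set0.
  have m0 x y : 0 < x -> 0 < y -> 0 < x * y by move=> h h'; rewrite muln_gt0 h.
  have e0 x k : 0 < x -> 0 < x ^ k by move=> h; rewrite expn_gt0 h.
  rewrite ZE; apply: (m0 c3 _ _ (m0 _ _ (e0 _ 2 q2_gt0) q3_gt0)).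
  by apply: (e0 _ 2 (m0 _ _ (m0 _ _ (m0 4 _ _ tau0) q2_gt0) (m0 2 _ _ q1_gt0))).
have h5 : c3 * #|lonely| <= 32 * Z * v ^ 2.
  apply: leq_trans (_ : c3 * (8 * (4 * v ^ 2 * (q2 ^ 2 * q3))) <= _).
    by rewrite leq_mul2l (leq_trans h2) ?orbT // leq_mul2l leq_mul2r h4 !orbT.
  by apply: eq_leq; rewrite ZE; clear; lia.
have h6 : T * (32 * 32) * Z * v * #|badI3| <= T * (32 * Z * v ^ 2).
  apply: leq_trans (_ : T * d ^ 4 * #|badI3| <= _).
    by rewrite leq_mul2r (leq_trans hK' h3) orbT.
  by rewrite -mulnA leq_mul2l mulnC (leq_trans h1 h5) orbT.
have P0 : 0 < T * 32 * Z * v by rewrite !muln_gt0 T0 Z0 v0.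
rewrite -(leq_pmul2l P0); move: h6; rewrite expnS expn1.
by clear; lia.
Qed.

Definition branches x (S : {set 'I_q1}) (u : 'I_q2) (r : 'I_q1) : {set I * I} :=
  [set p | [&& p.1 \in typed x S, cell N q2 (b p.1) == u, b p.2 == b p.1 & cell N q1 (a p.2) == r]].

(** Popularity of [u] gives d / (4 tau q2) edges from [x] into cell [u], and each of their J pieces,
    having type S, sends d / (2 q1) edges into cell [r]. *)
Lemma branches_many x S u r : (forall i, i \in typed x S -> cells_at (b i) = S) ->
  u \in popular x S -> r \in S -> d ^ 2 <= (4 * tau * q2) * (2 * q1) * #|branches x S u r|.
Proof.
move=> hS; rewrite inE => hu hr.
pose E := [set i in typed x S | cell N q2 (b i) == u].
have hB : #|branches x S u r| = \sum_(m in E) #|[set i | (b i == b m) && (cell N q1 (a i) == r)]|.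
  have -> : branches x S u r = [set p | (p.1 \in E) && ((b p.2 == b p.1) && (cell N q1 (a p.2) == r))].
    by apply/setP => p; rewrite !inE !andbA.
  rewrite (card_fibers (@fst I I)); apply: eq_bigr => m mE.
  rewrite -[RHS](card_imset _ (_ : injective (fun i : I => (m, i)))); last by move=> i j [].
  apply: eq_card => -[m' i]; rewrite !inE /=; apply/idP/imsetP.
    by case/and3P=> /eqP -> h1 h2; exists i; rewrite // inE h1.
  by case=> i' ; rewrite inE => h [-> ->]; rewrite eqxx.
have h1 : #|E| * d <= 2 * q1 * #|branches x S u r|.
  rewrite hB big_distrr /= -sum_nat_const leq_sum // => m; rewrite inE => /andP[mt _].
  by have := hS m mt => hm; move: hr; rewrite -hm inE.
have h2 : d <= (4 * tau * q2) * #|E| by apply: leq_trans hu _; apply: eq_leq; rewrite -/E; clear; lia.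
rewrite expnS expn1; apply: leq_trans (_ : (4 * tau * q2) * #|E| * d <= _); first by rewrite leq_mul2r h2 orbT.
by rewrite -[_ * #|E| * d]mulnA -[X in _ <= X]mulnA leq_mul2l h1 orbT.
Qed.

(** Joining a branch through J with one through K gives at least d^4 / c3 walks with middle piece
    [x], too many to be all lonely when [x] is outside [badI3]. A walk that is not lonely, with its
    companion, feeds [walks_conf]. As [r] and [r'] differ from the cell of [x], the pieces X and Y
    differ from M, and [u != u'] keeps J and K apart. *)
Lemma rich_conf i0 x S u u' r r' : x \notin badI3 ->
  (forall i, i \in typed x S -> cells_at (b i) = S) ->
  u \in popular x S -> u' \in popular x S -> u != u' -> r \in S -> r' \in S ->
  (r : nat) != cell N q1 x -> (r' : nat) != cell N q1 x ->
  exists c z, conf f g a b (cell N q1) (cell N q2) (cell N q3) i0 c (cell N q3 x) u u' r r' z.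
Proof.
move=> hx hS hu hu' uu hr hr' rx rx'.
have B1 := branches_many hS hu hr; have B2 := branches_many hS hu' hr'.
pose h (p : (I * I) * (I * I)) : walk := (p.1.2, p.1.1, p.2.1, p.2.2).
have hinj : injective h by move=> [[p1 p2] [p3 p4]] [[p1' p2'] [p3' p4']] [-> -> -> ->].
pose Q := [set h p | p in setX (branches x S u r) (branches x S u' r')].
have QE w : w \in Q -> is_walk w /\ [/\ a w.1.1.2 = x, cell N q2 (b w.1.1.2) = u, cell N q2 (b w.1.2) = u',
    cell N q1 (a w.1.1.1) = r & cell N q1 (a w.2) = r'].
  case/imsetP => -[[p1 p2] [p3 p4]]; rewrite !inE /= => /andP[/and4P[/and3P[/eqP h1 _ _] /eqP h2 /eqP h3 /eqP h4]].
  by case/and4P => /and3P[/eqP h1' _ _] /eqP h2' /eqP h3' /eqP h4' ->; rewrite /h /= h1 h1' h3 h3' !eqxx.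
have : ~~ (Q \subset [set w in lonely | a w.1.1.2 == x]).
  apply: contra hx => sub; rewrite inE.
  apply: leq_trans (_ : c3 * #|Q| <= _); last by rewrite leq_mul2l subset_leq_card ?orbT.
  rewrite card_imset // cardsX -[4]/(2 + 2) expnD.
  apply: leq_trans (leq_mul B1 B2) _; apply: eq_leq; rewrite /c3 [_ ^ 2]expnS expn1.
  by rewrite mulnACA.
case/subsetPn => w wQ; have [ww [wx wu wu' wr wr']] := QE w wQ.
rewrite !inE wx eqxx andbT ww /= negb_forall => /existsP[w']; rewrite negb_imply => /andP[/andP[ww' /eqP wE] ne].
move: w w' ww ww' wE ne wx wu wu' wr wr' {wQ} => [[[x1 b1] d1] y1] [[[x2 b2] d2] y2] /=.
case/and3P => /eqP e1 /eqP e2 /eqP e3 /and3P[/eqP e1' /eqP e2' /eqP e3'].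
case=> ax ay bj am bk oJ oM oK ne wx wu wu' wr wr'.
have c2b : cell N q2 (b b2) = cell N q2 (b b1) by [].
have c2d : cell N q2 (b d2) = cell N q2 (b d1) by [].
have c3b : cell N q3 (a b2) = cell N q3 (a b1) by [].
(* q3 is a multiple of q1, so a fine cell determines the coarse one; hence the second middle piece
   is also different from X and Y. *)
have fine y : cell N q3 y = cell N q3 (a b1) -> cell N q1 y = cell N q1 (a b1).
  have E z : cell N q1 z = cell N q3 z %/ q'.
    have q'0 : 0 < q' by move: q3_gt0; rewrite /q3 muln_gt0 => /andP[].
    by rewrite /cell /q3 -divnMA mulnA divnMr.
  by move=> hy; rewrite !E hy.
have xb1 : a x1 != a b1 by apply: contraNneq rx => hh; rewrite -wr hh wx.
have yb1 : a y1 != a b1 by apply: contraNneq rx' => hh; rewrite -wr' hh wx.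
have xb2 : a x2 != a b2 by apply: contraNneq rx => hh; rewrite -wr -ax hh -wx; apply/eqP/fine.
have yb2 : a y2 != a b2 by apply: contraNneq rx' => hh; rewrite -wr' -ay hh -wx; apply/eqP/fine.
have bd1 : b b1 != b d1 by apply: contraNneq uu => hh; apply/eqP/val_inj; rewrite /= -wu hh.
have bd2 : b b2 != b d2 by apply: contraNneq uu => hh; apply/eqP/val_inj; rewrite /= -wu -wu' -c2b hh c2d.
have ne' : (x1, b1, d1, y1) != (x2, b2, d2, y2) by rewrite eq_sym.
have [c [z cz]] := @walks_conf I N f g a b finj ginj fmono gmono abinj (cell N q1) (cell N q2) (cell N q3)
  i0 x1 b1 d1 y1 x2 b2 d2 y2 (esym ax) (esym ay) e1 e1' e2 e2' e3 e3' c2b c2d c3b xb1 xb2 yb1 yb2 bd1 bd2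
  (esym oJ) (esym oM) (esym oK) ne'.
by exists c, z; move: cz; rewrite wu wu' wr wr' wx.
Qed.

(** Everything about a middle piece that the selection looks at. The number of possible values
    depends only on q1 and q2, so [q'] can be chosen after it. *)
Let data := ({set 'I_q1} * {set 'I_q2} * {ffun ('I_q2 * 'I_q2) * ('I_q1 * 'I_q1) -> color})%type.

Definition fits i0 (x : 'I_N) (dt : data) : Prop :=
  [/\ n1 <= #|dt.1.1|, n2 <= #|dt.1.2| & forall u u' r r', u \in dt.1.2 -> u' \in dt.1.2 -> u != u' ->
     r \in dt.1.1 -> r' \in dt.1.1 -> (r : nat) != cell N q1 x -> (r' : nat) != cell N q1 x ->
     exists z, conf f g a b (cell N q1) (cell N q2) (cell N q3) i0 (dt.2 ((u, u'), (r, r')))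
        (cell N q3 x) u u' r r' z].

Definition good : {set 'I_N} := [set a i | i in I] :\: (badI1 :|: badI2 :|: badI3).

(** There are at least v/4 pieces, and each of the three bad sets takes at most v/32. *)
Lemma good_many : 5 * v <= 32 * #|good|.
Proof.
have h : #|[set a i | i in I]| <= #|good| + (#|badI1| + #|badI2| + #|badI3|).
  rewrite -[X in X <= _](cardsID (badI1 :|: badI2 :|: badI3)) addnC leq_add2l.
  apply: leq_trans (subset_leq_card (subsetIr _ _)) _.
  apply: leq_trans (leq_card_setU _ _) _; rewrite leq_add2r.
  exact: leq_card_setU.
move: h badI1_few badI2_few badI3_few pieces; clear; lia.
Qed.

Lemma good_fits i0 x : x \in good -> exists dt, fits i0 x dt.
Proof.
rewrite in_setD !in_setU !negb_or => /andP[/andP[/andP[h1 h2] h3] /imsetP[i _ ix]].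
have [S [nS nU hS]] := popular_type (ex_intro _ i (esym ix)) h1 h2.
have h (t : ('I_q2 * 'I_q2) * ('I_q1 * 'I_q1)) : exists c : color,
   t.1.1 \in popular x S -> t.1.2 \in popular x S -> t.1.1 != t.1.2 -> t.2.1 \in S -> t.2.2 \in S ->
   (t.2.1 : nat) != cell N q1 x -> (t.2.2 : nat) != cell N q1 x ->
   exists z, conf f g a b (cell N q1) (cell N q2) (cell N q3) i0 c (cell N q3 x) t.1.1 t.1.2 t.2.1 t.2.2 z.
  case: (boolP [&& t.1.1 \in popular x S, t.1.2 \in popular x S, t.1.1 != t.1.2, t.2.1 \in S, t.2.2 \in S,
    (t.2.1 : nat) != cell N q1 x & (t.2.2 : nat) != cell N q1 x]).
    case/and5P => u1 u2 u3 u4 /and3P[u5 u6 u7].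
    have [c hc] := rich_conf i0 h3 hS u1 u2 u3 u4 u5 u6 u7.
    by exists c.
  move=> neg; exists (ord0, (true, true, true, true), (true, true, true, true)) => u1 u2 u3 u4 u5 u6 u7.
  by move: neg; rewrite u1 u2 u3 u4 u5 u6 u7.
have [c hc] := fin_all_exists h.
exists (S, popular x S, finfun c); split => // u u' r r' /= uU uU' uu rS rS' rx rx'.
by rewrite ffunE; exact: (hc ((u, u'), (r, r'))).
Qed.

Hypothesis hq' : 20 * #|{: data}| < q'.

(** Otherwise the good pieces with equal data all lie in one fine cell, which has at most 3v/q3
    labels; with 5v/32 good pieces this gives q3 <= 96/5 times the number of data, whence the
    constant 20. *)
Lemma two_good i0 : exists x x' dt, [/\ fits i0 x dt, fits i0 x' dt & cell N q3 x < cell N q3 x'].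
Proof.
have h (x : 'I_N) : exists dt, x \in good -> fits i0 x dt.
  case: (boolP (x \in good)) => [/(good_fits i0)[dt hd]|_]; first by exists dt.
  by exists (set0, set0, [ffun=> (ord0, (true, true, true, true), (true, true, true, true))]).
have [dt hdt] := fin_all_exists h.
case: (pickP (fun p : 'I_N * 'I_N => [&& p.1 \in good, p.2 \in good, dt p.1 == dt p.2 & cell N q3 p.1 < cell N q3 p.2])).
  move=> [x x'] /= /and4P[gx gx' /eqP E lt]; exists x, x', (dt x); split => //; first exact: hdt.
  by rewrite E; exact: hdt.
move=> none.
have small (t : data) : #|[set x in good | dt x == t]| * q3 <= 3 * v.
  have [->|[x0]] := set_0Vmem [set x in good | dt x == t]; first by rewrite cards0.
  rewrite in_set => /andP[gx0 /eqP ex0].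
  apply: leq_trans (_ : #|[set x : 'I_N | cell N q3 x == cell N q3 x0]| * q3 <= _).
    rewrite leq_mul2r; apply/orP; right; apply: subset_leq_card; apply/subsetP => x.
    rewrite in_set => /andP[gx /eqP ex]; rewrite in_set.
    have := none (x, x0); have := none (x0, x); rewrite /= gx gx0 ex ex0 eqxx /=.
    by case: ltngtP.
  apply: leq_trans (cell_card N _ q3_gt0) _; move: hN q3v; clear; lia.
have h1 : #|good| * q3 <= #|{: data}| * (3 * v).
  rewrite -[#|good|]cardsE (card_fibersT dt) big_distrl /= -sum_nat_const leq_sum //.
have h2 : q' <= q3 by rewrite /q3 leq_pmull.
have h3 := good_many.
exfalso.
have h4 : 5 * v * q3 <= 32 * (#|{: data}| * (3 * v)).
  apply: leq_trans (_ : 32 * #|good| * q3 <= _); first by rewrite leq_mul2r h3 orbT.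
  by rewrite -mulnA leq_mul2l h1 orbT.
have h5 : 5 * (20 * #|{: data}|).+1 * v <= 96 * #|{: data}| * v.
  apply: leq_trans (_ : 5 * v * q3 <= _); last by apply: leq_trans h4 _; apply: eq_leq; clear; lia.
  by rewrite mulnAC leq_mul2l (leq_trans hq' h2) orbT.
by move: h5; rewrite leq_pmul2r //; clear; lia.
Qed.

Variables (s1 s2 : nat) (cr pa : color -> bool).
Hypothesis sel : forall col : nat -> nat -> nat -> nat -> color,
  exists i k i' k' r1 r2 r3 r4,
  [/\ [/\ i < s2, k < s2, i' < s2 & k' < s2], r4 < s1,
      col i k r1 r2 = col i' k' r3 r4,
      comparable (pa (col i k r1 r2)) i k i' k' & crossing (cr (col i k r1 r2)) r1 r2 r3 r4].
Hypothesis n1E : 3 * s1 + 2 <= n1.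
Hypothesis n2E : 2 * s2 <= n2.
Hypothesis crpa : forall c, combos_ok (cr c) (pa c) (words_of c).

Lemma enum_sorted (S : {set 'I_q1}) (P : pred 'I_q1) : sorted ltn (map val (filter P (enum S))).
Proof.
apply: (subseq_sorted ltn_trans _ (sorted_enum_ord S)).
by apply: map_subseq; exact: filter_subseq.
Qed.

(** At most two members of S are lost to [m] and [m'] themselves; the rest fall into three regions,
    so 3 s1 + 2 members leave s1 of them in one region. *)
Lemma region_list (S : {set 'I_q1}) m m' : m <= m' -> n1 <= #|S| -> exists reg (s : seq 'I_q1),
  [/\ sorted ltn (map val s), s1 <= size s, {subset s <= S} &
   forall r : 'I_q1, r \in s -> match reg with 0 => (r < m) && (r < m')
     | 1 => (m < r) && (r < m') | _ => (m < r) && (m' < r) end].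
Proof.
move=> mm hS.
pose P0 (r : 'I_q1) := (r < m) && (r < m'); pose P1 (r : 'I_q1) := (m < r) && (r < m').
pose P2 (r : 'I_q1) := (m < r) && (m' < r).
pose Q (r : 'I_q1) := ((r : nat) == m) || ((r : nat) == m').
have small : count Q (enum S) <= 2.
  rewrite -size_filter -(size_map val); apply: (@uniq_leq_size _ _ [:: m; m']).
    by rewrite (map_inj_uniq val_inj) filter_uniq ?enum_uniq.
  by move=> y /mapP[r]; rewrite mem_filter => /andP[h _] ->; rewrite !inE.
have tot_seq l : size l <= count P0 l + count P1 l + count P2 l + count Q l.
  elim: l => //= r s IH.
  have : 1 <= P0 r + P1 r + P2 r + Q r.
    rewrite /P0 /P1 /P2 /Q; move: mm; clear; move: (nat_of_ord r) => k.
    by case: ltngtP; case: (ltngtP k m') => //; lia.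
  by move: IH; clear; lia.
have := tot_seq (enum S); rewrite -cardE => tot.
have sub (P : pred 'I_q1) : {subset filter P (enum S) <= S}.
  by move=> r; rewrite mem_filter mem_enum => /andP[].
have [h|h0] := leqP s1 (count P0 (enum S)).
  exists 0, (filter P0 (enum S)); rewrite size_filter; split => //; first exact: enum_sorted.
  by move=> r; rewrite mem_filter => /andP[].
have [h|h1] := leqP s1 (count P1 (enum S)).
  exists 1, (filter P1 (enum S)); rewrite size_filter; split => //; first exact: enum_sorted.
  by move=> r; rewrite mem_filter => /andP[].
exists 2, (filter P2 (enum S)); rewrite size_filter; split => //; first exact: enum_sorted.
  move: small (leq_trans hS tot) h0 h1 n1E; move: (count Q _) (count P0 _) (count P1 _) (count P2 _) => a1 a2 a3 a4; clear; lia.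
by move=> r; rewrite mem_filter => /andP[].
Qed.

Lemma regular_exchangeable (i0 : I) : exists z w v, exchangeable f g a b i0 z w v.
Proof.
have [x [x' [dt [[hS hU hx] [_ _ hx'] lt]]]] := two_good i0.
have E z : cell N q1 z = cell N q3 z %/ q'.
  have q'0 : 0 < q' by move: q3_gt0; rewrite /q3 muln_gt0 => /andP[].
  by rewrite /cell /q3 -divnMA mulnA divnMr.
have mm : cell N q1 x <= cell N q1 x' by rewrite !E leq_div2r // ltnW.
have [reg [s [ss sz sS sreg]]] := region_list mm hS.
pose us := enum dt.1.2.
have su : sorted ltn (map val us) by exact: sorted_enum_ord.
have szu : 2 * s2 <= size us by rewrite -cardE (leq_trans n2E).
pose o1 := Ordinal q1_gt0; pose o2 := Ordinal q2_gt0.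
(* J cells come from the first s2 popular cells and K cells from the next s2, so every J cell
   precedes every K cell. *)
pose u i := nth o2 us i; pose u' k := nth o2 us (s2 + k); pose r j := nth o1 s j.
have szl i : i < s2 -> i < size us /\ s2 + i < size us.
  by move: szu; move: (size us) => l; clear; lia.
have uin i : i < s2 -> u i \in dt.1.2.
  by move=> /szl[h _]; rewrite -mem_enum; apply: mem_nth.
have u'in i : i < s2 -> u' i \in dt.1.2.
  by move=> /szl[_ h]; rewrite -mem_enum; apply: mem_nth.
have rin j : j < s1 -> r j \in s by move=> h; apply: mem_nth; apply: leq_trans sz.
have uu' i k : i < s2 -> k < s2 -> u i < u' k.
  move=> h /szl[_ h']; apply: sorted_nth_lt => //; exact: leq_trans h (leq_addr _ _).
have um i k : i < k -> k < s2 -> u i < u k.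
  by move=> h /szl[h' _]; apply: sorted_nth_lt.
have um' i k : i < k -> k < s2 -> u' i < u' k.
  by move=> h /szl[_ h']; apply: sorted_nth_lt => //; rewrite ltn_add2l.
have rm i k : i < k -> k < s1 -> r i < r k.
  by move=> h h'; apply: sorted_nth_lt => //; apply: leq_trans sz.
have rne j : j < s1 -> (r j : nat) != cell N q1 x /\ (r j : nat) != cell N q1 x'.
  by move=> /rin/sreg; case: (reg) => [|[|_]] /andP[]; rewrite !neq_ltn => -> ->; rewrite ?orbT.
pose col i k j j' := dt.2 ((u i, u' k), (r j, r j')).
have cf i k j j' : i < s2 -> k < s2 -> j < s1 -> j' < s1 ->
  (exists z, conf f g a b (cell N q1) (cell N q2) (cell N q3) i0 (col i k j j') (cell N q3 x) (u i) (u' k) (r j) (r j') z) /\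
  (exists z, conf f g a b (cell N q1) (cell N q2) (cell N q3) i0 (col i k j j') (cell N q3 x') (u i) (u' k) (r j) (r j') z).
  move=> hi hk hj hj'; have [t1 t2] := rne j hj; have [t3 t4] := rne j' hj'.
  have un : u i != u' k by rewrite -val_eqE neq_ltn /= uu'.
  have h1 := uin i hi; have h2 := u'in k hk; have h3 := sS _ (rin j hj); have h4 := sS _ (rin j' hj').
  by split; [exact: hx|exact: hx'].
have [i [k [i' [k' [j1 [j2 [j3 [j4 [[hi hk hi' hk'] hj4 cE cmp crs]]]]]]]]] := sel col.
have [l1 l2 l3] : [/\ j1 < s1, j2 < s1 & j3 < s1].
  by move: crs hj4; rewrite /crossing; case: (cr _) => /and3P[]; clear => *; split; lia.
have [A1 A2] := cf i k j1 j2 hi hk l1 l2.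
have [B1 B2] := cf i' k' j3 j4 hi' hk' l3 hj4.
rewrite -cE in B1 B2.
apply: (@assemble I N f g a b fmono gmono (cell N q1) (cell N q2) (cell N q3) (fun m => m %/ q')
  (@cell_mono N q1) (@cell_mono N q2) (@cell_mono N q3) E i0 _ _ _ _ _ _ _ _ _ _ _ lt A1 A2 B1 B2
  (cr (col i k j1 j2)) (pa (col i k j1 j2)) _ _ _ reg) => //.
- move: cmp; rewrite /comparable; case: (pa _) => /orP[] /andP[h h'].
  + by rewrite (um _ _ h hi') (um' _ _ h' hk').
  + by rewrite (um _ _ h hi) (um' _ _ h' hk) orbT.
  + by rewrite (um _ _ h hi') (um' _ _ h' hk).
  + by rewrite (um _ _ h hi) (um' _ _ h' hk') orbT.
- by rewrite !uu'.
- by move: crs; rewrite /crossing; case: (cr _) => /and3P[h1 h2 h3]; apply/and3P; split; apply: rm.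
apply/allP => q hq.
have [j lj ->] : exists2 j, j < s1 & q = r j.
  by move: hq; rewrite !inE => /or4P[] /eqP ->; [exists j1|exists j2|exists j3|exists j4].
by rewrite -!E; apply: sreg; exact: rin.
Qed.

End Regular.

(* Names a numeral such as [32 ^ 4], which conversion must not compute in unary. *)
Lemma ex_eq (x : nat) : exists y, y = x. Proof. by exists x. Qed.

(** The constants are chosen one after the other: the selection fixes n1 and n2, then come w1 and
    q1, the number [tau] of types, w2 and q2, and last [q'] from the number of data. *)
Theorem regular_case : exists K : nat, forall (I : finType) (N v d D : nat) (f g : I -> nat)
    (a b : I -> 'I_N) (i0 : I),
  0 < d -> N <= 2 * v -> D <= 32 * d -> injective f -> injective g ->
  (forall i j, f i <= f j -> a i <= a j) -> (forall i j, g i <= g j -> b i <= b j) ->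
  (forall i j, a i = a j -> b i = b j -> i = j) ->
  (forall x, #|[set i | a i == x]| <= D) -> (forall y, #|[set i | b i == y]| <= D) ->
  (forall i, d <= #|[set j | a j == a i]|) -> (forall i, d <= #|[set j | b j == b i]|) ->
  (forall P Q : {set 'I_N},
    #|[set i | (a i \in P) && (b i \in Q)]| ^ 4 * v <= D ^ 4 * (#|P| + #|Q|) ^ 5) ->
  v <= 4 * #|[set a i | i in I]| -> K * v <= D ^ 4 ->
  exists z w u, exchangeable f g a b i0 z w u.
Proof.
have [cr [pa crpa]] : exists cr pa : color -> bool, forall c, combos_ok (cr c) (pa c) (words_of c).
  have h (c : color) : exists u : bool * bool, combos_ok u.1 u.2 (words_of c).
    have /and5P[_ _ _ _ /hasP[x _ /hasP[y _ xy]]] := color_wf c.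
    by exists (x, y).
  have [u hu] := fin_all_exists h.
  by exists (fun c => (u c).1), (fun c => (u c).2).
have [s1 [s2 sel]] := @selection color cr pa.
pose n1 := 3 * s1 + 2; pose n2 := 2 * s2.
have [w1 w1E] : exists w1, w1 = 64 * 32 * (3 * (32 * (2 * n1) + 1)) ^ 3 by exact: ex_eq.
pose q1 := w1 ^ 4; pose tau := #|{set 'I_q1}|.
have [w2 w2E] : exists w2, w2 = 32 * (3 * (32 * (2 * n2 * (2 * tau)) + 1)) ^ 3 by exact: ex_eq.
pose q2 := w2 ^ 4.
pose q' := (20 * #|{: {set 'I_q1} * {set 'I_q2} * {ffun ('I_q2 * 'I_q2) * ('I_q1 * 'I_q1) -> color}}|).+1.
pose q3 := q1 * q'.
have w10 : 0 < w1 by rewrite w1E muln_gt0 expn_gt0 addn1 muln_gt0.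
have w20 : 0 < w2 by rewrite w2E muln_gt0 expn_gt0 addn1 muln_gt0.
have q10 : 0 < q1 by rewrite expn_gt0 w10.
have q20 : 0 < q2 by rewrite expn_gt0 w20.
have q30 : 0 < q3 by rewrite /q3 muln_gt0 q10.
pose c3 := ((4 * tau * q2) * (2 * q1)) ^ 2.
have [T TE] : exists T, T = 32 ^ 4 by exact: ex_eq.
have [U UE] : exists U, U = 64 ^ 4 by exact: ex_eq.
have [M ME] : exists M, M = q1 + q2 + q3 by exact: ex_eq.
have [Z ZE] : exists Z, Z = T * (32 * 32) * (c3 * (q2 ^ 2 * q3)) by exact: ex_eq.
(* [Z] serves the count of lonely walks; [U * M ^ 3] forces v >= M, because D <= 64 v when there are
   no parallel edges. *)
exists (Z + U * M ^ 3) => I N v d D f g a b i0 d0 hN hD finj ginj fmono gmono abinj a_le b_le a_ge b_ge hsub pieces hK.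
have Dv : D <= 64 * v.
  apply: leq_trans hD _; apply: leq_trans (_ : 32 * N <= _); last by move: hN; clear; lia.
  rewrite leq_mul2l /=; apply: leq_trans (a_ge i0) _.
  rewrite -[X in _ <= X]card_ord -(@card_in_imset _ _ b); first exact: max_card.
  by move=> i j; rewrite !inE => /eqP ei /eqP ej; apply: abinj; rewrite ei ej.
have v0 : 0 < v by have := ltn_ord (a i0); move: hN; clear; lia.
have Mv : M <= v.
  rewrite leqNgt; apply/negP => vM.
  have h1 : U * M ^ 3 * v <= U * v ^ 3 * v.
    apply: leq_trans (_ : D ^ 4 <= _).
      by apply: leq_trans hK; rewrite leq_mul2r leq_addl orbT.
    by rewrite -mulnA -expnSr UE -expnMn leq_exp2r.
  move: h1; rewrite leq_pmul2r // leq_pmul2l; last by rewrite UE expn_gt0.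
  by rewrite leq_exp2r // leqNgt vM.
have q1v : q1 <= v by move: ME Mv; clear; lia.
have q2v : q2 <= v by move: ME Mv; clear; lia.
have q3v : q3 <= v by move: ME Mv; clear; lia.
have hK' : T * (32 * 32) * (c3 * (q2 ^ 2 * q3)) * v <= D ^ 4.
  by rewrite -ZE; apply: leq_trans hK; rewrite leq_mul2r leq_addr orbT.
exact: (@regular_exchangeable I N v d D f g a b d0 hN hD finj ginj fmono gmono abinj a_le b_le a_ge b_ge
  hsub pieces n1 n2 w1 w2 q' q10 q20 q30 (eq_leq (esym w1E)) (eq_leq (esym w2E)) q1v q2v q3v T TE hK' (ltnSn _)
  s1 s2 cr pa sel (leqnn _) (leqnn _) crpa i0).
Qed.

(** * Dense port graphs *)

Lemma nth_map_id (I J : Type) (h : J -> I) j0 z p : nth (h j0) (map h z) p = h (nth j0 z p).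
Proof.
have [lt|ge] := ltnP p (size z); first exact: nth_map.
by rewrite !nth_default ?size_map.
Qed.

Lemma exchangeable_lift (I J U V U' V' : eqType) (h : J -> I) (f g : I -> nat) (A : I -> U) (B : I -> V)
    (a : J -> U') (b : J -> V') j0 z w v : injective h ->
  (forall i j, a i = a j -> A (h i) = A (h j)) -> (forall i j, b i = b j -> B (h i) = B (h j)) ->
  exchangeable (f \o h) (g \o h) a b j0 z w v -> exchangeable f g A B (h j0) (map h z) w v.
Proof.
move=> hinj ha hb [[h1 h2 h3] [h4 h5] [h6 h7] [h8 h9] [h10 h11]].
have E (F : I -> nat) u : map (F \o nth (h j0) (map h z)) u = map (F \o h \o nth j0 z) u.
  by apply: eq_map => p /=; rewrite nth_map_id.
split; rewrite ?size_map ?map_inj_uniq //; split; rewrite ?E //.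
  by apply: sub_all h8 => p /eqP/ha; rewrite !nth_map_id => ->.
by apply: sub_all h9 => p /eqP/hb; rewrite !nth_map_id => ->.
Qed.

(** With a single pair of ports on each cycle there is only one tour, in every order, so two paths
    between the same two segments already suffice. *)
Lemma twin_exchangeable (I U V : eqType) (f g : I -> nat) (A : I -> U) (B : I -> V) i j :
  injective f -> injective g -> i != j -> A i = A j -> B i = B j ->
  exists z w v, exchangeable f g A B i z w v.
Proof.
move=> finj ginj ij Aij Bij; exists [:: i; j].
have f_ne : f i != f j by rewrite (inj_eq finj).
have g_ne : g i != g j by rewrite (inj_eq ginj).
exists (if f i < f j then [:: 0; 1] else [:: 1; 0]), (if g i < g j then [:: 0; 1] else [:: 1; 0]).
split.
- by rewrite /= inE ij.
- by split; case: ifP.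
- by split; [move: f_ne; case: (ltngtP (f i) (f j))|move: g_ne; case: (ltngtP (g i) (g j))] => //= ->.
- by split; case: ifP => _ /=; rewrite ?Aij ?Bij eqxx.
- by case: ifP; case: ifP.
Qed.

(** Ratios are compared as integers after multiplication by the product of all positive
    denominators. *)
Lemma max_ratio (T : finType) (n d : T -> nat) x0 : 0 < d x0 -> (forall y, d y = 0 -> n y = 0) ->
  exists2 x, 0 < d x & forall y, n y * d x <= n x * d y.
Proof.
move=> d0 nd; pose M := \prod_(z | 0 < d z) d z.
have M0 : 0 < M by apply: prodn_cond_gt0.
have dM z : 0 < d z -> M = M %/ d z * d z.
  by move=> dz; rewrite divnK // /M (bigD1 z) //= dvdn_mulr.
case: (arg_maxnP (P := fun x => 0 < d x) (fun x => n x * (M %/ d x)) d0) => x dx mx.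
exists x => // y; case: (posnP (d y)) => [/nd -> //|dy].
rewrite -(leq_pmul2r M0) {1}(dM y dy) {2}(dM x dx).
have := leq_mul (mx y dy : n y * (M %/ d y) <= n x * (M %/ d x)) (leqnn (d x * d y)); clear.
by move: (M %/ d y) (M %/ d x) (d y) (d x) (n y) (n x) => *; lia.
Qed.

Lemma card_fiber_pieces (I : finType) (E : {set I}) (r : I -> nat) D q : 0 < D -> {in E &, injective r} ->
  #|[set i in E | r i %/ D == q]| <= D.
Proof.
move=> D0 rinj; pose h i : 'I_D := Ordinal (ltn_pmod (r i) D0).
rewrite -[X in _ <= X]card_ord -(@card_in_imset _ _ h); first exact: max_card.
move=> i j; rewrite !inE => /andP[iE /eqP di] /andP[jE /eqP dj] /(congr1 val) /= mm.
by apply: rinj => //; rewrite (divn_eq (r i) D) di mm -dj -divn_eq.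
Qed.

Section Pieces.
Variables (I : finType) (m v D : nat) (f : I -> nat) (A : I -> 'I_m) (P : {set 'I_m}) (E : {set I}).
Hypothesis finj : injective f.
Hypothesis fmono : forall i j, f i <= f j -> A i <= A j.
Hypothesis EP : forall i, i \in E -> A i \in P.
Hypothesis D0 : 0 < D.
Hypothesis eD : #|E| < D * v.

Let rank i := #|[set j in E | f j < f i]|.

(** The sum of two nondecreasing counters, one stepping between used segments and one after every
    [D] edges. On [E] the sum determines both, so a piece lies inside one segment and holds at most
    [D] edges, and there are at most |P| + v pieces. *)
Definition piece i := #|[set p in P | p < A i]| + rank i %/ D.

Let rank_lt i j : i \in E -> f i < f j -> rank i < rank j.
Proof.
move=> iE ij; apply: proper_card; apply/properP; split.
  by apply/subsetP => k; rewrite !inE => /andP[-> h] /=; apply: ltn_trans ij.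
by exists i; rewrite !inE iE ?ij // ltnn.
Qed.

Lemma piece_mono i j : f i <= f j -> piece i <= piece j.
Proof.
move=> ij; apply: leq_add; last apply: leq_div2r; apply: subset_leq_card; apply/subsetP => k.
  by rewrite !inE => /andP[-> h] /=; apply: leq_trans h (fmono ij).
by rewrite !inE => /andP[-> h] /=; apply: leq_trans h ij.
Qed.

Lemma piece_lt i : i \in E -> piece i < #|P| + v.
Proof.
move=> iE; rewrite -addSn leq_add //.
  apply: proper_card; apply/properP; split; first by apply/subsetP => p; rewrite inE => /andP[].
  by exists (A i); rewrite ?EP // inE ltnn andbF.
apply: ltnW; rewrite ltn_divLR // mulnC; apply: leq_ltn_trans eD.
by apply: subset_leq_card; apply/subsetP => j; rewrite inE => /andP[].
Qed.

Lemma piece_lab i j : i \in E -> j \in E -> piece i = piece j -> A i = A j /\ rank i %/ D = rank j %/ D.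
Proof.
have lt k l : k \in E -> A k < A l -> piece k < piece l.
  move=> kE kl; have fkl : f k < f l.
    by rewrite ltnNge; apply/negP => /fmono; rewrite leqNgt kl.
  rewrite -addSn leq_add //.
    apply: proper_card; apply/properP; split.
      by apply/subsetP => p; rewrite !inE => /andP[-> h]; apply: ltn_trans kl.
    by exists (A k); rewrite !inE ?EP ?kl //= ltnn.
  by apply: leq_div2r; apply/ltnW/rank_lt.
move=> iE jE E1; have Aij : A i = A j.
  by apply: val_inj => /=; case: (ltngtP (A i) (A j)) => // /lt h; have := h ltac:(by []); rewrite E1 ltnn.
by split => //; move: E1; rewrite /piece Aij => /addnI.
Qed.

Lemma piece_fiber x : #|[set i in E | piece i == x]| <= D.
Proof.
have [->|[j]] := set_0Vmem [set i in E | piece i == x]; first by rewrite cards0.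
rewrite inE => /andP[jE /eqP jx].
apply: leq_trans (@card_fiber_pieces I E rank D (rank j %/ D) D0 _).
  apply: subset_leq_card; apply/subsetP => i; rewrite !inE => /andP[iE /eqP ix]; rewrite iE /=.
  by have [_ ->] := piece_lab iE jE (etrans ix (esym jx)).
move=> i k iE kE E1; apply: finj; apply/eqP; case: ltngtP => // h.
  by have := rank_lt iE h; rewrite E1 ltnn.
by have := rank_lt kE h; rewrite E1 ltnn.
Qed.

End Pieces.

(** Sets of deleted labels that maximise the remaining edges plus [d] per deleted label replace
    step-by-step deletion: a surviving label of degree below [d] could be deleted with profit.
    Comparison with nothing deleted bounds the lost edges. *)
Lemma prune (I J K : finType) (a : I -> J) (b : I -> K) (E : {set I}) d : exists2 E' : {set I},
  E' \subset E /\ #|E| <= #|E'| + d * (#|J| + #|K|) &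
  forall i, i \in E' -> d <= #|[set j in E' | a j == a i]| /\ d <= #|[set j in E' | b j == b i]|.
Proof.
pose sub (x : {set J} * {set K}) := [set i in E | (a i \notin x.1) && (b i \notin x.2)].
pose score x := #|sub x| + d * (#|x.1| + #|x.2|).
have [[X Y] _ mx] := @arg_maxnP _ (set0, set0) xpredT score isT.
have le x : score x <= score (X, Y) := mx x isT.
exists (sub (X, Y)).
  split; first by apply/subsetP => i; rewrite inE => /andP[].
  have -> : #|E| = score (set0, set0).
    rewrite /score /= !cards0 muln0 addn0; apply: eq_card => i.
    by rewrite in_set !in_set0 !andbT.
  by apply: leq_trans (le _) _; rewrite leq_add2l leq_mul2l leq_add ?orbT ?max_card.
have gen (E1 E2 : {set I}) (Q : pred I) s : {subset [set j in E1 | ~~ Q j] <= E2} ->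
    #|E2| + d * s.+1 <= #|E1| + d * s -> d <= #|[set j in E1 | Q j]|.
  move=> s1 s2; have {}s1 := subset_leq_card (introT subsetP s1).
  have h : #|E1| = #|[set j in E1 | Q j]| + #|[set j in E1 | ~~ Q j]|.
    rewrite -(cardsID [set j | Q j] E1); congr (_ + _); apply: eq_card => j; rewrite !inE //.
    by rewrite andbC.
  by move: s2; rewrite h mulnSr; move: s1; clear; lia.
move=> i iE; have [iX iY] : a i \notin X /\ b i \notin Y.
  by move: iE; rewrite in_set => /and3P[].
split.
  apply: (gen _ (sub (a i |: X, Y)) _ (#|X| + #|Y|)).
    by move=> j; rewrite !inE /= negb_or => /andP[/and3P[-> -> ->] ->].
  by have := le (a i |: X, Y); rewrite /score /= cardsU1 iX add1n addSn.
apply: (gen _ (sub (X, b i |: Y)) _ (#|X| + #|Y|)).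
  by move=> j; rewrite !inE /= negb_or => /andP[/and3P[-> -> ->] ->].
by have := le (X, b i |: Y); rewrite /score /= cardsU1 iY add1n addnS.
Qed.

Lemma card_sigma (I : finType) (E : {set I}) (Q : pred I) :
  #|[set j : {i | i \in E} | Q (val j)]| = #|[set i in E | Q i]|.
Proof.
rewrite -(card_imset _ val_inj); apply: eq_card => i; rewrite inE; apply/imsetP/andP.
  by case=> j; rewrite inE => Qj ->; split; first exact: (valP j).
by case=> iE Qi; exists (Sub i iE); rewrite ?inE ?SubK.
Qed.

Lemma card_imset_factor (I X Y : finType) (S : {set I}) (h : I -> X) (k : I -> Y) (P : {set Y}) :
  {in S, forall i, k i \in P} -> {in S &, forall i j, k i = k j -> h i = h j} -> #|h @: S| <= #|P|.
Proof.
move=> kP hk; pose lab y := if [pick i in S | k i == y] is Some i then Some (h i) else None.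
have Sinj : injective (@Some X) by move=> x y [].
rewrite -(card_imset _ Sinj); apply: leq_trans (leq_imset_card lab P).
apply: subset_leq_card; apply/subsetP => _ /imsetP[_ /imsetP[i iS ->] ->].
apply/imsetP; exists (k i); first exact: kP.
rewrite /lab; case: pickP => [j /andP[jS /eqP E]|/(_ i)]; last by rewrite iS eqxx.
by congr Some; apply: hk.
Qed.

Lemma card_le_image (I X : finType) (h : I -> X) D :
  (forall x, #|[set i | h i == x]| <= D) -> #|I| <= #|[set h i | i in I]| * D.
Proof.
move=> hD; rewrite -sum_nat_const -cardsT -[X in X <= _]sum1_card.
rewrite (partition_big h (mem [set h i | i in I])) /=; last by move=> i _; apply: imset_f.
apply: leq_sum => x _; rewrite sum1dep_card; apply: leq_trans (hD x).
by apply: subset_leq_card; apply/subsetP => i; rewrite !inE.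
Qed.

(** The upper degree lies just above e/v and the lower one is e/(8v) rounded down; e >= 16 v keeps
    the rounding harmless, whence C = 16^4. *)
Lemma ratio_sizes e v C : 0 < v -> C = 16 ^ 4 -> C * v ^ 5 < e ^ 4 ->
  [/\ 16 * v <= e, e < (e %/ v).+1 * v, (e %/ v).+1 <= 32 * (e %/ (8 * v)),
      (e %/ v).+1 * v <= 2 * e & e %/ (8 * v) * (8 * v) <= e].
Proof.
move=> v0 CE h; have e16 : 16 * v <= e.
  rewrite leqNgt; apply/negP => lt; move: h; apply/negP; rewrite -leqNgt.
  apply: leq_trans (_ : (16 * v) ^ 4 <= _); first by rewrite leq_exp2r // ltnW.
  by rewrite expnMn -CE leq_mul2l leq_pexp2l // orbT.
have v8 : 0 < 8 * v by rewrite muln_gt0.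
have h1 := ltn_ceil e v8; have h2 := ltn_ceil e v0.
have h3 := leq_divM e (8 * v); have h4 := leq_divM e v.
have d2 : 2 <= e %/ (8 * v) by rewrite leq_divRL // mulnA.
split => //; last by rewrite mulSn; move: h4 e16 v0; clear; lia.
have : e %/ v < 8 * (e %/ (8 * v)).+1 by rewrite ltn_divLR // -mulnA mulnCA.
by move: d2; clear; lia.
Qed.

Theorem dense_exchangeable : exists K : nat, forall (I : finType) (m : nat) (f g : I -> nat) (A B : I -> 'I_m),
  injective f -> injective g ->
  (forall i j, f i <= f j -> A i <= A j) -> (forall i j, g i <= g j -> B i <= B j) ->
  K * m ^ 5 < #|I| ^ 4 -> exists i0 z w u, exchangeable f g A B i0 z w u.
Proof.
have [K1 reg] := regular_case; have [C CE] : exists C, C = 16 ^ 4 by exact: ex_eq.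
exists (32 * (K1 + C)) => I m f g A B finj ginj fmono gmono hI.
(* Parallel edges are exchangeable by themselves, so from here on an edge is determined by its two
   segments. *)
case: (pickP (fun p : I * I => [&& p.1 != p.2, A p.1 == A p.2 & B p.1 == B p.2])).
  move=> [i j] /= /and3P[ij /eqP Aij /eqP Bij]; exists i; exact: twin_exchangeable ij Aij Bij.
move=> none; have ABinj i j : A i = A j -> B i = B j -> i = j.
  move=> Aij Bij; apply/eqP; have := none (i, j); rewrite /= Aij Bij !eqxx !andbT.
  by move/negbFE.
have m0 : 0 < m.
  have : 0 < #|I| ^ 4 := leq_ltn_trans (leq0n _) hI.
  by rewrite expn_gt0 orbF => /card_gt0P[i _]; apply: leq_ltn_trans (ltn_ord (A i)).
pose ed (x : {set 'I_m} * {set 'I_m}) := #|[set i | (A i \in x.1) && (B i \in x.2)]|.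
pose sz (x : {set 'I_m} * {set 'I_m}) := #|x.1| + #|x.2|.
have sz0 : 0 < sz (setT, setT) ^ 5 by rewrite expn_gt0 /sz /= !cardsT card_ord addn_gt0 m0.
have [|[P Q] vPQ0 mx] := @max_ratio _ (fun x => ed x ^ 4) (fun x => sz x ^ 5) _ sz0.
  move=> [P Q] /eqP; rewrite expn_eq0 andbT addn_eq0 !cards_eq0 /= => /andP[/eqP-> /eqP->].
  by rewrite /ed /= eq_card0 // => i; rewrite !inE.
pose v := #|P| + #|Q|; have v0 : 0 < v by move: vPQ0; rewrite expn_gt0 orbF.
pose E := [set i | (A i \in P) && (B i \in Q)]; pose e := #|E|.
have hd (P' Q' : {set 'I_m}) : #|[set i | (A i \in P') && (B i \in Q')]| ^ 4 * v ^ 5 <= e ^ 4 * (#|P'| + #|Q'|) ^ 5.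
  exact: (mx (P', Q')).
have he : (K1 + C) * v ^ 5 < e ^ 4.
  have := hd setT setT; rewrite !cardsT card_ord (_ : #|[set i | _]| = #|I|); last first.
    by apply: eq_card => i; rewrite !inE.
  (* There are m segments on each cycle, 2m in all: this is the factor 32 of the constant. *)
  have -> : (m + m) ^ 5 = 32 * m ^ 5 by rewrite addnn -mul2n expnMn.
  have m5 : 0 < 32 * m ^ 5 by rewrite muln_gt0 expn_gt0 m0.
  move=> h; rewrite -(ltn_pmul2r m5); apply: leq_trans h.
  have v5 : 0 < v ^ 5 by rewrite expn_gt0 v0.
  move: hI; rewrite -(ltn_pmul2r v5); apply: leq_trans.
  by rewrite ltnS; apply: eq_leq; move: (K1 + C) (v ^ 5) (m ^ 5) => *; lia.
have heC : C * v ^ 5 < e ^ 4 by apply: leq_ltn_trans he; rewrite leq_mul2r leq_addl orbT.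
have [e16 eD Dd De d8] := ratio_sizes v0 CE heC.
pose D := (e %/ v).+1; pose d := e %/ (8 * v); rewrite -/D -/d in eD Dd De d8.
have d0 : 0 < d by have : 0 < 32 * d := leq_trans (ltn0Sn _) Dd; rewrite muln_gt0.
have e0 : 0 < e by apply: leq_trans e16; rewrite muln_gt0.
have D0 : 0 < D by [].
have EP i : i \in E -> A i \in P by rewrite inE => /andP[].
have EQ i : i \in E -> B i \in Q by rewrite inE => /andP[].
pose N := 2 * v; have N0 : 0 < N by rewrite muln_gt0.
pose pa := piece D f A P E; pose pb := piece D g B Q E.
have paN i : i \in E -> pa i < N.
  move=> iE; apply: leq_trans (piece_lt f EP D0 eD iE) _.
  by rewrite /N mul2n -addnn leq_add2r leq_addr.
have pbN i : i \in E -> pb i < N.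
  move=> iE; apply: leq_trans (piece_lt g EQ D0 eD iE) _.
  by rewrite /N mul2n -addnn leq_add2r leq_addl.
pose ap i := insubd (Ordinal N0) (pa i); pose bp i := insubd (Ordinal N0) (pb i).
have apE i : i \in E -> ap i = pa i :> nat by move=> iE; rewrite val_insubd paN.
have bpE i : i \in E -> bp i = pb i :> nat by move=> iE; rewrite val_insubd pbN.
have [E' [E'E E'big] E'deg] := prune ap bp E d.
have {}E'E i : i \in E' -> i \in E by exact: (subsetP E'E).
(* There are 2N = 4v labels, so pruning at d <= e/(8v) costs at most e/2 edges. *)
have e_half : e <= 2 * #|E'|.
  by move: E'big d8; rewrite !card_ord -/e /N; move: (#|E'|) => k; clear; lia.
have E'0 : 0 < #|E'| by have := leq_trans e0 e_half; rewrite muln_gt0.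
pose J := {i | i \in E'}.
have [i0 i0E] := card_gt0P E'0.
pose j0 : J := Sub i0 i0E.
have apA i j : i \in E -> j \in E -> ap i = ap j -> A i = A j.
  move=> iE jE /(congr1 val); rewrite /= apE // apE // => E1.
  by have [] := piece_lab fmono EP iE jE E1.
have bpB i j : i \in E -> j \in E -> bp i = bp j -> B i = B j.
  move=> iE jE /(congr1 val); rewrite /= bpE // bpE // => E1.
  by have [] := piece_lab gmono EQ iE jE E1.
have E'J (j : J) : sval j \in E by apply: E'E; exact: (valP j).
have fibA x : #|[set j : J | (ap \o val) j == x]| <= D.
  rewrite (card_sigma E' (fun i => ap i == x)).
  apply: leq_trans (piece_fiber finj fmono EP D0 x); apply: subset_leq_card; apply/subsetP => i.
  by rewrite !inE => /andP[/E'E iE /eqP <-]; rewrite apE // eqxx; move: iE; rewrite inE => ->.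
have [] := reg J N v d D (f \o val) (g \o val) (ap \o val) (bp \o val) j0 d0 (leqnn _) Dd
  (inj_comp finj val_inj) (inj_comp ginj val_inj).
- by move=> i j /= h; rewrite !apE ?E'J //; exact: (piece_mono D P E fmono h).
- by move=> i j /= h; rewrite !bpE ?E'J //; exact: (piece_mono D Q E gmono h).
- by move=> i j /= h1 h2; apply: val_inj; apply: ABinj; [apply: (apA _ _ _ _ h1)|apply: (bpB _ _ _ _ h2)]; exact: E'J.
- exact: fibA.
- move=> x; rewrite (card_sigma E' (fun i => bp i == x)).
  apply: leq_trans (piece_fiber ginj gmono EQ D0 x); apply: subset_leq_card; apply/subsetP => i.
  by rewrite !inE => /andP[/E'E iE /eqP <-]; rewrite bpE // eqxx; move: iE; rewrite inE => ->.
- by move=> j; rewrite (card_sigma E' (fun i => ap i == ap (val j))); have [] := E'deg _ (valP j).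
- by move=> j; rewrite (card_sigma E' (fun i => bp i == bp (val j))); have [] := E'deg _ (valP j).
(* Sets of pieces are replaced by the sets of segments that their edges meet, which are no larger,
   and extremality of (P, Q) applies; e < D v turns e^4 into D^4 v^4. *)
- move=> P' Q'; rewrite (card_sigma E' (fun i => (ap i \in P') && (bp i \in Q'))).
  pose S := [set i in E' | (ap i \in P') && (bp i \in Q')].
  have SP : #|A @: S| <= #|P'|.
    apply: (card_imset_factor (k := ap)) => [i|i j]; first by rewrite inE => /and3P[].
    by rewrite !inE => /andP[/E'E iE _] /andP[/E'E jE _]; apply: apA.
  have SQ : #|B @: S| <= #|Q'|.
    apply: (card_imset_factor (k := bp)) => [i|i j]; first by rewrite inE => /and3P[].
    by rewrite !inE => /andP[/E'E iE _] /andP[/E'E jE _]; apply: bpB.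
  have v4 : 0 < v ^ 4 by rewrite expn_gt0 v0.
  rewrite -(leq_pmul2r v4) -mulnA -expnS.
  apply: leq_trans (_ : e ^ 4 * (#|P'| + #|Q'|) ^ 5 <= _).
    apply: leq_trans (leq_trans _ (hd (A @: S) (B @: S))) _; last first.
      by rewrite leq_mul2l leq_exp2r // leq_add ?orbT.
    rewrite leq_mul2r leq_exp2r //; apply/orP; right; apply: subset_leq_card; apply/subsetP => i iS.
    by rewrite inE !imset_f.
  rewrite mulnAC leq_mul2r -expnMn leq_exp2r // ltnW ?orbT //.
(* Half of the edges survive, at most D on each piece, and D v <= 2 e; so v/4 pieces are left. *)
- have := card_le_image fibA; rewrite card_sig; set s := #|[set _ | _ in _]| => h.
  have {}h : #|E'| <= s * D by apply: leq_trans h; apply: eq_leq; apply: eq_card.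
  have h2 : v * #|E'| <= s * (2 * e).
    by rewrite mulnC (leq_trans (leq_mul h (leqnn v))) // -mulnA leq_mul2l De orbT.
  have h3 : v * e <= v * (2 * #|E'|) by rewrite leq_mul2l e_half orbT.
  by rewrite -(leq_pmul2r e0); move: h2 h3; clear; move: s (#|E'|) => s k; lia.
- have v4 : 0 < v ^ 4 by rewrite expn_gt0 v0.
  rewrite -(leq_pmul2r v4) -expnMn -mulnA -expnS.
  apply: leq_trans (_ : e ^ 4 <= _); last by rewrite leq_exp2r // ltnW.
  by apply: leq_trans (ltnW he); rewrite leq_mul2r leq_addr orbT.
move=> z [w [u h]]; exists (val j0), (map val z), w, u.
apply: exchangeable_lift h; [exact: val_inj| |] => i j /= E1.
- by apply: (apA _ _ _ _ E1); exact: E'J.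
- by apply: (bpB _ _ _ _ E1); exact: E'J.
Qed.

(** * Longest cycles and separators *)

(** The part wanted runs from the last vertex in [C] to the first vertex in [D] after it; it has an
    edge because no vertex of the path lies in both. *)
Lemma trim_path (T : eqType) (e : rel T) (C D : pred T) x p : path e x p -> uniq (x :: p) ->
  has C (x :: p) -> D (last x p) -> (forall z, z \in x :: p -> ~~ (C z && D z)) ->
  exists x' h y, [/\ path e x' (rcons h y), C x' /\ D y, uniq h,
    {in h, forall z, ~~ C z /\ ~~ D z} & {subset x' :: rcons h y <= x :: p}].
Proof.
elim: p x => [|z p IH] x.
  by rewrite /= orbF => _ _ Cx Dx /(_ x); rewrite inE eqxx Cx Dx => /(_ isT).
move=> pa un hC Dl nb; case: (boolP (has C (z :: p))) => [hz|nC].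
  have /andP[_ pa'] := pa; have /andP[_ un'] := un.
  have [|x' [h [y [h1 h2 h3 h4 h5]]]] := IH z pa' un' hz Dl.
    by move=> u uz; apply: nb; rewrite inE uz orbT.
  by exists x', h, y; split => // u /h5 uz; rewrite inE uz orbT.
have Cx : C x by move: hC; rewrite /= in nC *; rewrite (negPf nC) orbF.
have hD : has D (z :: p) by apply/hasP; exists (last z p); first exact: mem_last.
move: nC un pa {IH hC Dl nb}; case/split_find: hD => y h r Dy nD nC un pa.
exists x, h, y; split => //.
- by move: pa; rewrite cat_path => /andP[].
- by move: un; rewrite cons_uniq cat_uniq rcons_uniq => /and3P[_ /andP[_ ->]].
- move=> u uh; split; last by apply: contra nD => Du; apply/hasP; exists u.
  by apply: contra nC => Cu; apply/hasP; exists u; rewrite // mem_cat mem_rcons inE uh orbT.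
by move=> u; rewrite !inE => /orP[->//|uh]; rewrite mem_cat uh orbT.
Qed.

Section Family.
Variables (T : finType) (e : rel T) (c d : seq T).

Definition meet : {set T} := [set z in c] :&: [set z in d].

Record family (I : finType) (x y : I -> T) (h : I -> seq T) : Prop := Family {
  fam_path : forall i, path e (x i) (rcons (h i) (y i));
  fam_x : forall i, x i \in c;
  fam_y : forall i, y i \in d;
  fam_avoid : forall i z, z \in h i -> (z \notin c) && (z \notin d);
  fam_uniq : forall i, uniq (h i);
  fam_disj : forall i j z, i != j -> z \in x i :: rcons (h i) (y i) -> z \notin x j :: rcons (h j) (y j);
  fam_xd : forall i, x i \notin d;
  fam_yc : forall i, y i \notin c }.
End Family.

(** Paths through a common vertex of the cycles are discarded, at most one for each such vertex by
    disjointness; the others are trimmed so that they touch the two cycles only at their ends. *)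
Lemma linkage_family (T : finType) (e : rel T) (c d : seq T) k x p :
  @linkage T e [set z in c] [set z in d] k x p ->
  exists (I : finType) (x y : I -> T) (h : I -> seq T),
    family e c d x y h /\ k <= #|I| + #|meet c d|.
Proof.
move=> [lk disj].
pose bad i := has (mem (meet c d)) (x i :: p i).
pose I := {i : 'I_k | ~~ bad i}.
have ex (i : I) : exists t : T * seq T * T, [/\ path e t.1.1 (rcons t.1.2 t.2), (t.1.1 \in c) /\ (t.2 \in d),
    uniq t.1.2, {in t.1.2, forall z, (z \notin c) /\ (z \notin d)} &
    {subset t.1.1 :: rcons t.1.2 t.2 <= x (val i) :: p (val i)}].
  have [xc pa ld un] := lk (val i).
  have [|||x' [h [y hxy]]] := @trim_path T e (mem c) (mem d) _ _ pa un.
  - by apply/hasP; exists (x (val i)); rewrite ?inE ?eqxx //; move: xc; rewrite inE.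
  - by move: ld; rewrite inE.
  - move=> z zp; apply: contra (valP i) => /andP[zc zd]; apply/hasP; exists z => //.
    by apply/setIP; rewrite !in_set.
  by exists (x', h, y).
have [t ht] := fin_all_exists ex.
have mx i : (t i).1.1 \in x (val i) :: p (val i).
  by have [_ _ _ _] := ht i; apply; rewrite inE eqxx.
have my i : (t i).2 \in x (val i) :: p (val i).
  by have [_ _ _ _] := ht i; apply; rewrite inE mem_rcons inE eqxx orbT.
have nb (i : I) z : z \in x (val i) :: p (val i) -> z \in c -> z \in d -> False.
  move=> zp zc zd; have : ~~ bad (val i) := valP i; apply/negP; rewrite negbK.
  by apply/hasP; exists z => //; apply/setIP; rewrite !in_set.
exists I, (fun i => (t i).1.1), (fun i => (t i).2), (fun i => (t i).1.2); split.
  split.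
  - by move=> i; have [] := ht i.
  - by move=> i; have [_ []] := ht i.
  - by move=> i; have [_ []] := ht i.
  - by move=> i z zh; have [_ _ _ /(_ z zh)[-> ->]] := ht i.
  - by move=> i; have [] := ht i.
  - move=> i j z ij zi; have [_ _ _ _ /(_ z zi) zi'] := ht i; have [_ _ _ _ sj] := ht j.
    apply/negP => /sj; apply/negP; apply: disj zi'.
    by rewrite (inj_eq val_inj).
  - by move=> i; apply/negP; apply: nb (mx i) _; have [_ []] := ht i.
  - by move=> i; apply/negP => yc; apply: nb (my i) yc _; have [_ []] := ht i.
have : #|[set i | bad i]| <= #|meet c d|.
  pose w i := odflt (x i) [pick z | (z \in x i :: p i) && (z \in meet c d)].
  have wP i : bad i -> (w i \in x i :: p i) /\ (w i \in meet c d).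
    move=> /hasP[z z1 z2]; rewrite /w; case: pickP => [u /andP[] //|/(_ z)].
    by rewrite z1 (z2 : z \in meet c d).
  rewrite -(@card_in_imset _ _ w).
    by apply: subset_leq_card; apply/subsetP => z /imsetP[i]; rewrite inE => /wP[_ h] ->.
  move=> i j; rewrite !inE => /wP[hi _] /wP[hj _] E; apply/eqP; apply: contraT => ij.
  by have := disj i j _ ij hi; rewrite E hj.
have : k <= #|[set i | ~~ bad i]| + #|[set i | bad i]|.
  rewrite -{1}[k]card_ord -cardsT -(cardsID [set i | bad i] setT) addnC.
  by apply: leq_add; apply: subset_leq_card; apply/subsetP => i; rewrite !inE // andbT.
have -> : #|{: I}| = #|[set i | ~~ bad i]| by rewrite card_sig; apply: eq_card => i; rewrite inE.
by move=> h1 h2; apply: leq_trans h1 _; rewrite leq_add2l.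
Qed.

Section Longest.
Variables (T : finType) (e : rel T) (c d : seq T).
Hypothesis esym : symmetric e.
Hypothesis cc : ucycle e c.
Hypothesis dd : ucycle e d.
Hypothesis cmax : forall s, ucycle e s -> size s <= size c.
Hypothesis dmax : forall s, ucycle e s -> size s <= size d.
Let m := #|meet c d|.

Section Fam.
Variables (I : finType) (x y : I -> T) (h : I -> seq T).
Hypothesis fam : family e c d x y h.
Let f i := index (x i) c.
Let g i := index (y i) d.

Lemma fam_injx : injective f.
Proof.
move=> i j E; have {}E : x i = x j by exact: (index_inj (x i) (fam_x fam i) (fam_x fam j) E).
apply/eqP; apply: contraT => ij; have := fam_disj fam ij (mem_head (x i) _).
by rewrite E inE eqxx.
Qed.

Lemma fam_injy : injective g.
Proof.
move=> i j E; have {}E : y i = y j by exact: (index_inj (y i) (fam_y fam i) (fam_y fam j) E).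
apply/eqP; apply: contraT => ij; have yi : y i \in x i :: rcons (h i) (y i) by rewrite inE mem_rcons mem_head orbT.
by have := fam_disj fam ij yi; rewrite E inE mem_rcons mem_head orbT.
Qed.

(** A segment is named by the number of common vertices before it. The cycle is read as a list, so
    the stretch across its end counts as two segments: m + 1 labels for m common vertices. *)
Definition seg (s : seq T) k : 'I_m.+1 := inord #|[set z in meet c d | index z s < k]|.

Lemma segE s k : seg s k = #|[set z in meet c d | index z s < k]| :> nat.
Proof.
by rewrite inordK // ltnS; apply: subset_leq_card; apply/subsetP => z; rewrite inE => /andP[].
Qed.

Lemma seg_mono s k l : k <= l -> seg s k <= seg s l.
Proof.
move=> kl; rewrite !segE; apply: subset_leq_card; apply/subsetP => z; rewrite in_set => /andP[h1 h2].
by rewrite in_set h1 (leq_trans h2).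
Qed.

Lemma seg_gap s k l z : seg s k = seg s l -> k <= index z s < l -> z \notin meet c d.
Proof.
move=> E /andP[kz zl]; apply/negP => zm; have := congr1 val E; rewrite /= !segE; apply/eqP.
rewrite neq_ltn; apply/orP; left; apply: proper_card; apply/properP; split.
  apply/subsetP => w; rewrite in_set => /andP[h1 h2].
  by rewrite in_set h1 (ltn_trans h2) // (leq_ltn_trans kz).
by exists z; rewrite in_set zm //= -leqNgt.
Qed.

Lemma fam_not_exchangeable i0 z w v :
  ~ exchangeable f g (fun i => seg c (f i)) (fun i => seg d (g i)) i0 z w v.
Proof.
have in_meet u : u \in c -> u \in d -> u \in meet c d.
  by move=> uc ud; apply/setIP; rewrite !in_set.
apply: (not_exchangeable esym cc dd cmax dmax (fam_path fam) (fam_x fam) (fam_y fam) (fam_avoid fam)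
  (fam_uniq fam)).
- move=> i j u ij ui; apply/negP => uj.
  have ui' : u \in x i :: rcons (h i) (y i) by rewrite inE mem_rcons inE ui !orbT.
  by have := fam_disj fam ij ui'; rewrite inE mem_rcons inE uj !orbT.
- move=> i j u E uc /andP[h1 h2]; apply/negP => ud.
  have := in_meet u uc ud; apply/negP; apply: (seg_gap E); rewrite h1 ltn_neqAle h2 andbT /=.
  apply: contraTneq ud => /(index_inj u uc (fam_x fam j)) ->.
  exact: fam_xd fam j.
- move=> i j u E ud /andP[h1 h2]; apply/negP => uc.
  have := in_meet u uc ud; apply/negP; apply: (seg_gap E); rewrite h1 ltn_neqAle h2 andbT /=.
  apply: contraTneq uc => /(index_inj u ud (fam_y fam j)) ->.
  exact: fam_yc fam j.
Qed.

End Fam.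

(** For disjoint cycles there is only one label, so any two linking paths are twins. *)
Lemma longest_meet : (forall S, separates e [set z in c] [set z in d] S -> 2 <= #|S|) -> 0 < m.
Proof.
move=> sep; rewrite lt0n; apply/eqP => m0.
have [x [p lk]] := menger sep; have [I [x' [y' [h [fam]]]]] := linkage_family lk.
rewrite -/m m0 addn0 => /card_gt1P[i [j [_ _ ij]]].
have ord1E (a b : 'I_m.+1) : a = b.
  by apply: val_inj; case: a b => [a ha] [b hb] /=; move: ha hb; rewrite m0; case: a b => [|a] [|b].
have [z [w [v]]] := @twin_exchangeable _ _ _ _ _ (fun i => seg c (index (x' i) c)) (fun i => seg d (index (y' i) d))
  _ _ (fam_injx fam) (fam_injy fam) ij (ord1E _ _) (ord1E _ _).
exact: (fam_not_exchangeable fam).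
Qed.

End Longest.

Theorem longest_separator : exists K : nat, forall (T : finType) (e : rel T) (c d : seq T) k,
  symmetric e -> ucycle e c -> ucycle e d -> (forall s, ucycle e s -> size s <= size c) ->
  (forall s, ucycle e s -> size s <= size d) ->
  (forall S, separates e [set z in c] [set z in d] S -> k <= #|S|) ->
  (k - #|meet c d|) ^ 4 <= K * #|meet c d|.+1 ^ 5.
Proof.
have [K HK] := dense_exchangeable; exists K => T e c d k esym cc dd cmax dmax sep.
have [x [p lk]] := menger sep; have [I [x' [y' [h [fam kI]]]]] := linkage_family lk.
rewrite leqNgt; apply/negP => lt.
have [] := HK I #|meet c d|.+1 (fun i => index (x' i) c) (fun i => index (y' i) d)
  (fun i => seg c d c (index (x' i) c)) (fun i => seg c d d (index (y' i) d)) (fam_injx fam) (fam_injy fam).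
- by move=> i j; apply: seg_mono.
- by move=> i j; apply: seg_mono.
- by apply: leq_trans lt _; rewrite leq_exp2r // leq_subLR addnC.
by move=> i0 [z [w [v]]]; apply: (fam_not_exchangeable esym cc dd cmax dmax fam).
Qed.

(** * Vertex-transitive graphs *)

Lemma shortest_paths (T : finType) (e : rel T) x0 : (forall y, connect e x0 y) ->
  exists d : T -> nat,
    (forall y, exists2 p, path e x0 p & last x0 p = y /\ size p = d y) /\
    (forall p, path e x0 p -> d (last x0 p) <= size p).
Proof.
move=> conn; pose reach y k := [exists p : k.-tuple T, path e x0 p && (last x0 p == y)].
have reachP p : path e x0 p -> reach (last x0 p) (size p).
  by move=> pa; apply/existsP; exists (in_tuple p); rewrite /= pa eqxx.
have ex y : exists k, reach y k.
  by have /connectP[p pa ->] := conn y; exists (size p); apply: reachP.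
exists (fun y => ex_minn (ex y)); split=> [y|p pa].
  by case: ex_minnP => k /existsP[p /andP[pa /eqP l]] _; exists p; rewrite // size_tuple.
by case: ex_minnP => k _; apply; apply: reachP.
Qed.

Definition noncut (T : finType) (e : rel T) x := forall a b, a != x -> b != x ->
  exists2 p, path e a p & last a p = b /\ x \notin a :: p.

(** A vertex at greatest distance from [x0] lies on no shortest path to another vertex, so all other
    vertices stay connected through [x0]. *)
Lemma farthest_noncut (T : finType) (e : rel T) x0 : symmetric e -> (forall y, connect e x0 y) ->
  1 < #|T| -> exists z, noncut e z.
Proof.
move=> esym conn T2; have [d [dp dmin]] := shortest_paths conn.
have [z _ zmax] := @arg_maxnP _ x0 xpredT d isT.
have zx0 : z != x0.
  have [y yx0] : exists y, y != x0.
    by move: T2; rewrite -cardsT (cardsD1 x0) inE /= => /card_gt0P[y]; rewrite !inE andbT; exists y.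
  apply: contraNneq yx0 => zE; have [p pa [lp sp]] := dp y.
  have : size p <= 0 by rewrite sp (leq_trans (zmax y isT)) // zE; exact: (dmin [::]).
  by rewrite leqn0 => /nilP pE; rewrite -lp pE.
exists z; pose r u v := [&& e u v, u != z & v != z].
have rsym : symmetric r by move=> u v; rewrite /r esym [(u != z) && _]andbC.
have reach a : a != z -> connect r x0 a.
  move=> az; have [p pa [lp sp]] := dp a.
  have zp : z \notin x0 :: p.
    rewrite inE (negPf zx0) /=; apply/negP => zp; case/path.splitP: zp pa lp sp => p1 p2 pa lp sp.
    have := dmin (rcons p1 z); rewrite last_rcons size_rcons; move: pa; rewrite cat_path => /andP[pa _] /(_ pa).
    have := zmax a isT; rewrite -sp size_cat size_rcons.
    case: p2 lp {sp} => [|u p2] /=; first by rewrite cats0 last_rcons => E; rewrite E eqxx in az.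
    by move=> _; clear; rewrite /geq /=; lia.
  apply/connectP; exists p => //; elim: p (x0) pa zp {lp sp} => //= u p IH w /andP[wu pa].
  rewrite !inE !negb_or => /and3P[zw zu zp].
  by rewrite /r wu eq_sym zw eq_sym zu IH //= inE negb_or zu.
move=> a b az bz; have : connect r a b.
  by apply: connect_trans (reach b bz); rewrite (sym_connect_sym rsym) reach.
case/connectP => p; elim: p a az => [|u p IH] a az /=; first by move=> _ <-; exists [::]; rewrite // inE eq_sym.
case/andP => /and3P[au _ uz] pa /(IH _ uz pa)[q qa [lq zq]]; exists (u :: q); first by rewrite /= au.
by rewrite inE negb_or eq_sym az.
Qed.

Section Transitive.
Variables (T : finType) (e : rel T).
Hypothesis simple : simple_graph e.
Hypothesis conn : connected_graph e.
Hypothesis trans : vertex_transitive e.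
Hypothesis T3 : 3 <= #|T|.

Let esym : symmetric e. Proof. by case: simple. Qed.
Let G := graph_aut e.

Lemma aut_edge g x y : g \in G -> e (g x) (g y) = e x y.
Proof. by move/graph_autP. Qed.

Lemma aut_path g x p : g \in G -> path e (g x) (map g p) = path e x p.
Proof. by move=> gG; rewrite path_map; apply: eq_path => u v; exact: aut_edge. Qed.

Lemma aut_cycle g s : g \in G -> path.cycle e (map g s) = path.cycle e s.
Proof. by case: s => //= x s gG; rewrite -map_rcons aut_path. Qed.

Lemma aut_ex x y : exists2 g, g \in G & g x = y.
Proof.
by have [g gG ->] := atransP2 trans (in_setT x) (in_setT y); exists g.
Qed.

Lemma all_noncut x : noncut e x.
Proof.
have [x0 _] : exists x0 : T, true by case/card_gt0P: (proj1 conn) => x0; exists x0.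
have [z nz] := farthest_noncut esym (proj2 conn x0) (ltnW T3).
have [g gG <-] := aut_ex z x => a b.
have ne u : u != g z -> (g^-1)%g u != z.
  by apply: contra => /eqP <-; rewrite permKV.
move=> /ne az /ne bz; have [p pa [lp zp]] := nz _ _ az bz.
exists (map g p).
  by have := aut_path ((g^-1)%g a) p gG; rewrite permKV => ->.
have aE : a = g ((g^-1)%g a) by rewrite permKV.
rewrite {1 2}aE last_map lp permKV; split => //.
by rewrite -map_cons mem_map //; exact: perm_inj.
Qed.

(** A separator inside one vertex s is contradicted by a path that avoids s and joins members of A
    and B other than s. *)
Lemma separator_two (A B S : {set T}) : 1 < #|A| -> 1 < #|B| -> separates e A B S -> 1 < #|S|.
Proof.
move=> A2 B2 sep; rewrite ltnNge; apply/negP => S1.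
have [s sE] : exists s, S \subset [set s].
  have [->|[s sS]] := set_0Vmem S.
    by case/card_gt0P: (ltnW A2) => s _; exists s; exact: sub0set.
  exists s; apply/subsetP => u uS; rewrite inE; apply/eqP.
  by move/card_le1_eqP: S1; apply.
have pick (X : {set T}) : 1 < #|X| -> exists2 a, a \in X & a != s.
  move=> X2; have : 0 < #|X :\ s| by move: X2; rewrite (cardsD1 s); case: (s \in X) => //; exact: ltnW.
  by case/card_gt0P => a; rewrite !inE => /andP[? ?]; exists a.
have [a aA as_] := pick A A2; have [b bB bs] := pick B B2.
have [p pa [lp sp]] := all_noncut as_ bs.
have := sep a p aA pa; rewrite lp => /(_ bB) /hasP[u up uS].
by move/(subsetP sE): uS; rewrite inE => /eqP us; move: sp; rewrite -us up.
Qed.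

Lemma neighbour x : exists2 y, e x y & y != x.
Proof.
have [z zx] : exists z, z != x.
  have : 0 < #|[set: T] :\ x| by move: T3; rewrite -cardsT (cardsD1 x) inE => /ltnW.
  by case/card_gt0P=> y; rewrite !inE andbT; exists y.
case/connectP: (proj2 conn x z) => -[|y p] /=; first by move=> _ E; rewrite E eqxx in zx.
move=> /andP[xy _] _; exists y => //; apply: contraTneq xy => ->; by rewrite (proj2 simple).
Qed.

(** Menger between an edge at [x] and an edge at [z] gives two disjoint paths, which the two edges
    close to a cycle. It may degenerate to two vertices; this does no harm, since maximality of the
    longest cycle is stated for [ucycle], which admits this case. *)
Lemma common_cycle x z : exists2 s, ucycle e s & x \in s /\ z \in s.
Proof.
have [x' xx' x'x] := neighbour x; have [z' zz' z'z] := neighbour z.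
have cx : 1 < #|[set x; x']| by rewrite cards2 eq_sym x'x.
have cz : 1 < #|[set z; z']| by rewrite cards2 eq_sym z'z.
have [y [p [lk dj]]] := menger (fun S => separator_two cx cz (S := S)).
have [a0 b0 c0 d0] := lk ord0; have [a1 b1 c1 d1] := lk ord_max.
have dis w : w \in y ord0 :: p ord0 -> w \notin y ord_max :: p ord_max by apply: dj.
move: (y ord0) (p ord0) (y ord_max) (p ord_max) a0 b0 c0 d0 a1 b1 c1 d1 dis => u p0 v p1.
move=> uA pu uB uu vA pv vB uv dis {lk dj y p}.
have two (a b c d : T) : c != d -> c \in [set a; b] -> d \in [set a; b] -> e a b ->
    e c d /\ (a = c \/ a = d).
  move=> cd; rewrite !inE => /orP[] /eqP cE /orP[] /eqP dE ab; move: cd; rewrite cE dE ?eqxx // => _.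
    by split; [|left].
  by split; [rewrite esym|right].
have nuv : u != v by apply: contraTneq (mem_head u p0) => {1}->; apply: contraL (mem_head v p1) => /dis.
have nl : last u p0 != last v p1.
  by apply: contraTneq (mem_last u p0) => {1}->; apply: contraL (mem_last v p1) => /dis.
have [euv xE] := two _ _ _ _ nuv uA vA xx'; have [el zE] := two _ _ _ _ nl uB vB zz'.
exists ((u :: p0) ++ rev (v :: p1)).
  apply/andP; split.
    rewrite /= rcons_cat cat_path pu /= lastI rev_rcons /= el rcons_path rev_path.
    rewrite (eq_path (e' := e)) ?pv; last by move=> w t; exact: esym.
    by case: (p1) => [|t q] /=; rewrite ?rev_cons ?last_rcons esym.
  rewrite cat_uniq uu rev_uniq uv andbT /=; apply/hasPn => w; rewrite mem_rev => wv.
  by apply: contraL wv => /dis.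
rewrite !mem_cat !mem_rev; split.
  by case: xE => ->; rewrite mem_head ?orbT.
by case: zE => ->; rewrite mem_last ?orbT.
Qed.

(** With [x] and [y] adjacent, a path from [x] avoiding [y] shows a second neighbour [u] of [x], and
    a path from [y] to [u] avoiding [x] closes up at [x]. *)
Lemma cycle_ex : exists2 s, ucycle e s & 3 <= size s.
Proof.
have [x _] : exists x : T, true by case/card_gt0P: (proj1 conn) => x; exists x.
have [y xy yx] := neighbour x.
have [w wy wx] : exists2 w, w != y & w != x.
  have : 0 < #|[set: T] :\ x :\ y|.
    by move: T3; rewrite -cardsT (cardsD1 x) (cardsD1 y (_ :\ _)) !inE yx.
  by case/card_gt0P=> w; rewrite !inE andbT => /andP[]; exists w.
rewrite eq_sym in yx; have [[|u q] /= pq [lq yq]] := all_noncut yx wy; first by rewrite lq eqxx in wx.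
case/andP: pq => xu _; move: yq; rewrite !inE !negb_or => /and3P[_ yu _].
have ux : u != x by apply: contraTneq xu => ->; rewrite (proj2 simple).
rewrite eq_sym in yx; have [p pa [lp xp]] := all_noncut yx ux.
case/shortenP: pa lp xp => p' pa' un sub lp xp.
exists [:: x, y & p'].
  rewrite /ucycle /= xy rcons_path pa' lp esym xu /= (un : (y \notin p') && uniq p') andbT.
  by apply: contra xp; rewrite !inE => /orP[->//|/sub ->]; rewrite orbT.
by case: p' lp {pa' un sub} => //= E; rewrite E eqxx in yu.
Qed.

Lemma longest_ex : exists c, [/\ ucycle e c, 3 <= size c & forall s, ucycle e s -> size s <= size c].
Proof.
pose P k := [exists s : k.-tuple T, ucycleb e s].
have PI s : ucycle e s -> P (size s) by move=> us; apply/existsP; exists (in_tuple s).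
have [s0 us0 s3] := cycle_ex.
have ub k : P k -> k <= #|T|.
  by case/existsP => s /andP[_ us]; rewrite -(size_tuple s) -(card_uniqP us) max_card.
case: (ex_maxnP (ex_intro P _ (PI _ us0)) ub) => k /existsP[c uc] kmax.
exists c; rewrite size_tuple; split => //; first exact: leq_trans (kmax _ (PI _ us0)).
by move=> s us; apply: kmax; exact: PI.
Qed.
End Transitive.

(** * Averaging over automorphisms *)

Lemma double_count (I J : finType) (X : {set I}) (R : I -> J -> bool) :
  \sum_(i in X) #|[set j | R i j]| = \sum_j #|[set i in X | R i j]|.
Proof.
under eq_bigr => i _ do rewrite -sum1dep_card big_mkcond /=.
rewrite exchange_big; apply: eq_bigr => j _; rewrite -sum1dep_card big_mkcondr.
by [].
Qed.

Definition barrier (T : finType) (e : rel T) (A Y : {set T}) :=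
  forall z w, z \in A -> e z w -> w \notin Y -> w \in A.

Lemma barrier_path (T : finType) (e : rel T) (A Y : {set T}) x p : barrier e A Y ->
  path e x p -> x \in A -> {in p, forall z, z \notin Y} -> {subset p <= A}.
Proof.
move=> bA; elim: p x => //= u p IH x /andP[xu pa] xA pY.
have uA : u \in A by apply: bA xu _ => //; rewrite pY ?mem_head.
move=> z; rewrite inE => /orP[/eqP->//|zp]; apply: IH pa uA _ z zp.
by move=> w wp; rewrite pY // inE wp orbT.
Qed.

Lemma barrier_cycle (T : finType) (e : rel T) (A Y : {set T}) s u : barrier e A Y ->
  path.cycle e s -> u \in s -> u \in A -> {in s, forall z, z \notin Y} -> {subset s <= A}.
Proof.
move=> bA cs us uA sY; have [i s' E] := rot_to us.
have : path e u (rcons s' u) by move: cs; rewrite -(rot_cycle i) E.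
move=> pa z zs; apply: (barrier_path bA pa uA) => [w|].
  by rewrite mem_rcons -E mem_rot; apply: sY.
by rewrite mem_rcons -E mem_rot.
Qed.

Section Count.
Variables (T : finType) (e : rel T).
Hypothesis simple : simple_graph e.
Hypothesis conn : connected_graph e.
Hypothesis trans : vertex_transitive e.
Hypothesis T3 : 3 <= #|T|.
Let esym : symmetric e. Proof. by case: simple. Qed.
Variable G : {group {perm T}}.
Hypothesis GE : G = graph_aut_group e.
Let n := #|T|.

Let G0 : 0 < #|G|. Proof. exact: cardG_gt0. Qed.
Let n0 : 0 < n. Proof. exact: leq_trans T3. Qed.

Let moveG u v : exists2 g, g \in G & g u = v.
Proof. by rewrite GE; exact: aut_ex. Qed.
Let cycleG g s : g \in G -> path.cycle e (map g s) = path.cycle e s.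
Proof. by rewrite GE; exact: aut_cycle. Qed.

(** Right translation by an automorphism that takes one image point to another shows that all n
    image points of [x] are equally frequent. *)
Lemma move_count x y : #|[set g in G | g x == y]| * n = #|G|.
Proof.
have eqy z : #|[set g in G | g x == z]| = #|[set g in G | g x == y]|.
  have le u v : #|[set g in G | g x == u]| <= #|[set g in G | g x == v]|.
    have [h hG hu] := moveG u v.
    rewrite -(card_imset _ (mulIg h)); apply: subset_leq_card; apply/subsetP => k /imsetP[g].
    by rewrite !inE => /andP[gG /eqP gx] ->; rewrite groupM //= permM gx hu.
  by apply/eqP; rewrite eqn_leq !le.
rewrite -[in RHS](setIid G) -[LHS]mulnC -sum_nat_const.
rewrite -[RHS]sum1_card (partition_big (fun g : {perm T} => g x) xpredT) //=.
by apply: eq_bigr => z _; rewrite -(eqy z) -sum1dep_card; apply: eq_bigl => g; rewrite inE andbb.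
Qed.

Lemma hit_count x (Y : {set T}) : #|[set g in G | g x \in Y]| * n = #|Y| * #|G|.
Proof.
have -> : #|[set g in G | g x \in Y]| = #|[set g : {perm T} | (g x \in Y) && (g \in G)]|.
  by apply: eq_card => g; rewrite !inE andbC.
rewrite (card_fibers (fun g : {perm T} => g x)) big_distrl /= -sum_nat_const.
apply: eq_bigr => y _; rewrite -(move_count x y); congr (_ * _).
by apply: eq_card => g; rewrite !inE andbC.
Qed.

Lemma hits_count (s : seq T) (Y : {set T}) :
  #|[set g in G | has (fun x => g x \in Y) s]| * n <= size s * #|Y| * #|G|.
Proof.
elim: s => [|x s IH] /=.
  by rewrite (_ : [set g in G | false] = set0) ?cards0 //; apply/setP => g; rewrite !inE andbF.
apply: leq_trans (_ : (#|[set g in G | g x \in Y]| + #|[set g in G | has (fun x => g x \in Y) s]|) * n <= _).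
  rewrite leq_mul2r; apply/orP; right; apply: leq_trans (leq_card_setU _ _).
  by apply: subset_leq_card; apply/subsetP => g; rewrite !inE -andb_orr.
by rewrite mulnDl hit_count mulSn mulnDl leq_add2l.
Qed.

Variable c : seq T.
Hypothesis cU : ucycle e c.
Hypothesis c3 : 3 <= size c.
Hypothesis cmax : forall s, ucycle e s -> size s <= size c.
Let L := size c.

(** Any two vertices lie on a cycle of length at most L. If [g] carries them into A and to the far
    side B, the image of that cycle must hit Y, which happens for at most a fraction L|Y|/n of all
    [g]. Summing over the n^2 pairs counts each [g] exactly |A| |B| times. *)
Lemma barrier_small (A Y : {set T}) : barrier e A Y -> #|A| * #|~: (A :|: Y)| <= n * (L * #|Y|).
Proof.
move=> bA; pose B := ~: (A :|: Y).
pose R (g : {perm T}) (p : T * T) := (g p.1 \in A) && (g p.2 \in B).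
have Rg g : #|[set p | R g p]| = #|A| * #|B|.
  rewrite -cardsX -[RHS](card_preimset _ (_ : injective (fun p : T * T => (g p.1, g p.2)))).
    by apply: eq_card => p; rewrite in_set inE in_setX.
  by move=> [a b] [a' b'] [/perm_inj -> /perm_inj ->].
have Rp p : #|[set g in G | R g p]| * n <= L * #|Y| * #|G|.
  have [s us [s1 s2]] := common_cycle simple conn trans T3 p.1 p.2.
  apply: leq_trans (_ : size s * #|Y| * #|G| <= _); last by rewrite -!mulnA leq_mul2r cmax ?orbT.
  apply: leq_trans (hits_count s Y); rewrite leq_mul2r; apply/orP; right.
  apply: subset_leq_card; apply/subsetP => g; rewrite !inE => /andP[gG /andP[gA gB]]; rewrite gG /=.
  apply: contraTT gB => /hasPn sY; rewrite in_setC negbK in_setU.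
  have : {subset map g s <= A}.
    apply: (barrier_cycle bA _ (map_f g s1) gA).
      by rewrite cycleG //; case/andP: us.
    by move=> k /mapP[w ws ->]; apply: sY.
  by move=> /(_ _ (map_f g s2)) ->.
have h : #|G| * (#|A| * #|B|) * n <= n * n * (L * #|Y| * #|G|).
  have -> : #|G| * (#|A| * #|B|) = \sum_p #|[set g in G | R g p]|.
    by rewrite -double_count -sum_nat_const; apply: eq_bigr => g _; rewrite Rg.
  rewrite big_distrl /= -[n * n]card_prod -sum_nat_const; apply: leq_sum => p _; exact: Rp.
rewrite -(leq_pmul2r n0) -(leq_pmul2l G0); move: h; rewrite -/B.
move: (#|A| * #|B|) (L * #|Y|) (#|G|) => a l k; clear; lia.
Qed.

Lemma image_ucycle g : g \in G -> ucycle e (map g c).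
Proof.
move=> gG; have /andP[cc uc] := cU.
by rewrite /ucycle cycleG // cc map_inj_uniq //; exact: perm_inj.
Qed.

Let image_max (g : {perm T}) s : ucycle e s -> size s <= size (map g c).
Proof. by rewrite size_map; exact: cmax. Qed.

Lemma images_meet g h : g \in G -> h \in G -> 0 < #|meet (map g c) (map h c)|.
Proof.
move=> gG hG.
apply: (longest_meet esym (image_ucycle gG) (image_ucycle hG) (@image_max g) (@image_max h)) => S.
have two (k : {perm T}) : k \in G -> 1 < #|[set z in map k c]|.
  move=> kG; rewrite cardsE; have /andP[_ /card_uniqP ->] := image_ucycle kG.
  by rewrite size_map; exact: ltnW.
exact: separator_two (two g gG) (two h hG).
Qed.

Lemma small_overlap : exists2 g, g \in G & #|meet c (map g c)| * n <= L ^ 2.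
Proof.
pose C := [set z in c].
have CL : #|C| = L by rewrite cardsE; apply/card_uniqP; case/andP: cU.
have E (g : {perm T}) : #|meet c (map g c)| = #|[set x in C | g x \in C]|.
  rewrite -[RHS](card_imset _ (@perm_inj _ g)); congr #|pred_of_set _|; apply/setP => z.
  rewrite /meet in_setI !in_set; apply/andP/imsetP.
    by case=> zc /mapP[x xc zE]; exists x; rewrite // !inE xc -zE.
  by case=> x; rewrite !inE => /andP[xc gc] ->; split => //; apply: map_f.
case: (pickP (fun g => (g \in G) && (#|meet c (map g c)| * n <= L ^ 2))) => [g /andP[gG h]|none].
  by exists g.
have : #|G| * (L ^ 2).+1 <= #|G| * L ^ 2.
  rewrite -sum_nat_const; apply: leq_trans (_ : \sum_(g in G) #|meet c (map g c)| * n <= _).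
    by apply: leq_sum => g gG; have := none g; rewrite /= gG /= ltnNge => ->.
  rewrite -big_distrl /=.
  under eq_bigr => g _ do rewrite E.
  rewrite (double_count G (fun g x => (x \in C) && (g x \in C))) big_distrl /=.
  rewrite (bigID (mem C)) /= [X in _ + X]big1 ?addn0; last first.
    move=> x xC; rewrite (_ : [set _ in G | _] = set0) ?cards0 //.
    by apply/setP => g; rewrite in_set in_set0 (negPf xC) andbF.
  apply: leq_trans (_ : \sum_(x in C) L * #|G| <= _).
    apply: leq_sum => x xC; rewrite -CL -(hit_count x C) leq_mul2r; apply/orP; right.
    by apply: subset_leq_card; apply/subsetP => g; rewrite !inE => /and3P[-> _ ->].
  by rewrite sum_nat_const CL; rewrite -mulnn mulnA mulnC.
by rewrite leq_pmul2l // ltnn.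
Qed.

(** It suffices to move one fixed vertex of the cycle out of A: an image cycle that avoids Y lies
    inside A or entirely outside it. By counting, |A| + L|Y| < n is enough for a suitable
    automorphism. *)
Lemma barrier_large (A Y : {set T}) h : h \in G -> barrier e A Y ->
  {subset map h c <= A :|: Y} -> 2 * #|A| <= n -> n <= 8 * (L * #|Y|).
Proof.
move=> hG bA sub A2; rewrite leqNgt; apply/negP => lt.
have L0 : 0 < L by exact: leq_trans c3.
have small := barrier_small bA.
have cov : n <= #|~: (A :|: Y)| + (#|A| + #|Y|).
  rewrite /n -(cardsC (A :|: Y)) addnC leq_add2l; exact: leq_card_setU.
have kL : #|Y| <= L * #|Y| by rewrite leq_pmull.
have A3 : 3 * #|A| <= 8 * (L * #|Y|).
  rewrite -(leq_pmul2r n0); apply: leq_trans (_ : 8 * (#|A| * #|~: (A :|: Y)|) <= _).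
    (* The far side has at least n - n/2 - n/8 = 3n/8 vertices. *)
    have : 3 * n <= 8 * #|~: (A :|: Y)| by move: cov A2 lt kL; clear; lia.
    move=> h3; have := leq_mul (leqnn #|A|) h3; clear; move: #|A| n #|~: _| => x y z; lia.
  by move: small; clear; lia.
have sum_lt : L * #|Y| + #|A| < n by move: A3 lt; clear; lia.
have [x0 x0c] : exists x0, x0 \in c by case: (c) c3 => [|x0 s] // _; exists x0; exact: mem_head.
pose b1 := [set g in G | has (fun x => g x \in Y) (map h c)].
pose b2 := [set g in G | g (h x0) \in A].
have : ~~ (G \subset b1 :|: b2).
  apply/negP => /subset_leq_card; rewrite leqNgt => /negP; apply.
  rewrite -(ltn_pmul2r n0); apply: leq_ltn_trans (_ : (L * #|Y| + #|A|) * #|G| < _); last first.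
    by rewrite mulnC ltn_pmul2l.
  apply: leq_trans (_ : (#|b1| + #|b2|) * n <= _); first by rewrite leq_mul2r leq_card_setU orbT.
  rewrite !mulnDl hit_count leq_add2r; apply: leq_trans (hits_count _ _) _.
  by rewrite size_map.
case/subsetPn => g gG; rewrite in_setU !in_set gG /= negb_or => /andP[/hasPn avY gx].
have avY' : {in map g (map h c), forall z, z \notin Y}.
  by move=> z /mapP[w wc ->]; apply: avY.
have cyc : path.cycle e (map g (map h c)).
  by rewrite cycleG //; case/andP: (image_ucycle hG).
have avA u : u \in map g (map h c) -> u \notin A.
  move=> us; apply/negP => uA; case/negP: gx.
  by apply: (barrier_cycle bA cyc us uA avY'); rewrite !map_f.
have := images_meet (groupM hG gG) hG; rewrite (_ : map (h * g)%g c = map g (map h c)); last first.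
  by rewrite -map_comp; apply: eq_map => x; rewrite /= permM.
case/card_gt0P => z /setIP[]; rewrite !in_set => z1 z2.
by have := sub z z2; rewrite in_setU (negPf (avA z z1)) (negPf (avY' z z1)).
Qed.

Definition side (X Y : {set T}) : {set T} :=
  [set z | [exists x in X, (x \notin Y) && connect (fun u v => [&& e u v, u \notin Y & v \notin Y]) x z]].

Lemma side_notin X Y z : z \in side X Y -> z \notin Y.
Proof.
rewrite inE => /exists_inP[x _ /andP[xY /connectP[p pa ->]]].
elim: p x xY pa => //= u p IH x xY /andP[/and3P[_ _ uY]]; exact: IH.
Qed.

Lemma side_barrier X Y : barrier e (side X Y) Y.
Proof.
move=> z w zS zw wY; have zY := side_notin zS; move: zS.
rewrite !inE => /exists_inP[x xX /andP[xY xz]]; apply/exists_inP; exists x; rewrite // xY /=.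
by apply: connect_trans xz _; apply: connect1; rewrite zw zY.
Qed.

Lemma side_sub (X Y : {set T}) : X \subset side X Y :|: Y.
Proof.
apply/subsetP => x xX; rewrite in_setU; case: (boolP (x \in Y)) => xY; first by rewrite orbT.
by rewrite orbF inE; apply/exists_inP; exists x; rewrite // xY connect0.
Qed.

Lemma side_disjoint (X Z Y : {set T}) : separates e X Z Y -> #|side X Y| + #|side Z Y| <= n.
Proof.
move=> sep; rewrite -cardsUI (_ : _ :&: _ = set0) ?cards0 ?addn0 ?max_card //.
apply/setP => z; rewrite in_set0; apply/negP => /setIP[]; rewrite !inE.
pose r : rel T := fun u v => [&& e u v, u \notin Y & v \notin Y].
move=> /exists_inP[x xX /andP[xY xz]] /exists_inP[y yZ /andP[_ yz]].
have rsym : symmetric r by move=> u v; rewrite /r esym [(u \notin Y) && _]andbC.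
have : connect r x y by apply: connect_trans xz _; rewrite (sym_connect_sym rsym); exact: yz.
case/connectP => p pa yE.
have pe : path e x p by apply: sub_path pa => u v /and3P[].
have := sep x p xX pe; rewrite -yE => /(_ yZ); apply/negP; rewrite /= negb_or xY /=.
elim: p x xY pa {xX xz yE pe} => //= u p IH x xY /andP[/and3P[_ _ uY] pa].
by rewrite negb_or uY; apply: IH pa.
Qed.

End Count.

Lemma min_separator (T : finType) (e : rel T) (A B : {set T}) :
  exists2 Y, separates e A B Y & forall S, separates e A B S -> #|Y| <= #|S|.
Proof.
have sA : `[< separates e A B A >] by apply/asboolP => x p xA _ _; apply/orP; left.
have [Y /asboolP sY minY] := @arg_minnP _ A (fun S => `[< separates e A B S >]) (fun S : {set T} => #|S|) sA.
by exists Y => // S sS; apply: minY; apply/asboolP.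
Qed.

(** Either k >= 2m and then k <= 2(k - m), or k < 2m and m^4 <= m^5; so k^4 = O(m^5) also when the
    truncated difference [k - m] vanishes. *)
Lemma power_bound n L k m K : 0 < m -> n <= 8 * (L * k) -> m * n <= L ^ 2 ->
  (k - m) ^ 4 <= K * m.+1 ^ 5 -> n ^ 9 <= 8 ^ 4 * (2 ^ 4 * (1 + K * 2 ^ 5)) * L ^ 14.
Proof.
move=> m0 nk mn km.
have k4 : k ^ 4 <= 2 ^ 4 * (1 + K * 2 ^ 5) * m ^ 5.
  have h1 : (k - m) ^ 4 <= K * 2 ^ 5 * m ^ 5.
    apply: leq_trans km _; rewrite -mulnA -expnMn leq_mul2l leq_exp2r //.
    by rewrite mul2n -addnn -addn1 leq_add2l m0 orbT.
  have h2 : m ^ 4 <= m ^ 5 by rewrite leq_pexp2l.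
  rewrite -mulnA mulnDl mul1n; have [le|lt] := leqP (2 * m) k.
    apply: leq_trans (_ : 2 ^ 4 * (k - m) ^ 4 <= _).
      by rewrite -expnMn leq_exp2r //; move: le; clear; lia.
    by rewrite leq_mul2l (leq_trans h1) ?orbT // leq_addl.
  apply: leq_trans (_ : 2 ^ 4 * m ^ 4 <= _); first by rewrite -expnMn leq_exp2r // ltnW.
  by rewrite leq_mul2l (leq_trans h2) ?orbT // leq_addr.
have [C CE] : exists C, C = 2 ^ 4 * (1 + K * 2 ^ 5) by exact: ex_eq.
have [E EE] : exists E, E = 8 ^ 4 by exact: ex_eq.
rewrite -CE in k4; rewrite -CE -EE -[9]/(4 + 5) expnD.
apply: leq_trans (_ : E * (L ^ 4 * k ^ 4) * n ^ 5 <= _).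
  by rewrite leq_mul2r EE -!expnMn leq_exp2r // nk orbT.
apply: leq_trans (_ : E * (L ^ 4 * (C * m ^ 5)) * n ^ 5 <= _).
  by rewrite leq_mul2r !leq_mul2l k4 !orbT.
have -> : L ^ 14 = L ^ 4 * (L ^ 2) ^ 5 by rewrite -expnM -expnD.
apply: leq_trans (_ : E * C * (L ^ 4 * (m * n) ^ 5) <= _).
  by apply: eq_leq; rewrite expnMn; move: (L ^ 4) (m ^ 5) (n ^ 5) => *; clear; lia.
by rewrite !leq_mul2l leq_exp2r // mn !orbT.
Qed.

Theorem long_cycle : exists K : nat, forall (T : finType) (e : rel T),
  simple_graph e -> connected_graph e -> vertex_transitive e -> 3 <= #|T| ->
  exists c, [/\ ucycle e c, 3 <= size c & #|T| ^ 9 <= K * size c ^ 14].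
Proof.
have [K HK] := longest_separator.
exists (8 ^ 4 * (2 ^ 4 * (1 + K * 2 ^ 5))) => T e simple conn trans T3.
have [c [cU c3 cmax]] := longest_ex simple conn trans T3.
exists c; split => //.
have esym : symmetric e by case: simple.
have GE : graph_aut_group e = graph_aut_group e by [].
have [g gG mn] := small_overlap trans GE cU.
have one : 1%g \in graph_aut_group e := group1 _.
have cE : map (1 : {perm T})%g c = c by rewrite -[RHS]map_id; apply: eq_map => x; rewrite perm1.
have m0 := images_meet simple conn trans T3 GE cU c3 cmax one gG; rewrite cE in m0.
have dU := image_ucycle GE cU gG.
have dmax s : ucycle e s -> size s <= size (map g c) by rewrite size_map; exact: cmax.
have [Y sY minY] := min_separator e [set z in c] [set z in map g c].
have km := HK T e c (map g c) #|Y| esym cU dU cmax dmax minY.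
have large (h : {perm T}) (X : {set T}) : h \in graph_aut_group e -> {subset map h c <= X} ->
    2 * #|side e X Y| <= #|T| -> #|T| <= 8 * (size c * #|Y|).
  move=> hG hX; apply: (barrier_large simple conn trans T3 GE cU c3 cmax hG).
    exact: side_barrier.
  by move=> z /hX zX; apply: (subsetP (side_sub e X Y)).
suff nk : #|T| <= 8 * (size c * #|Y|) by exact: power_bound m0 nk mn km.
have := side_disjoint simple sY.
(* The smaller side has at most n/2 vertices and, together with Y, contains the cycle itself or its
   image under [g]. *)
have [le|lt] := leqP #|side e [set z in c] Y| #|side e [set z in map g c] Y| => tot.
  apply: (large 1%g [set z in c] one); last by move: le tot; clear; lia.
  by move=> z; rewrite cE in_set.
apply: (large g [set z in map g c] gG); last by move: lt tot; clear; lia.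
by move=> z; rewrite in_set.
Qed.

(** * The real exponent 9/14 *)

Import Order.TTheory GRing.Theory Num.Theory.
Local Open Scope ring_scope.

Lemma powR_ratio_le (R : realType) (a n L : R) : 0 < a -> 0 <= n -> 0 <= L ->
  n ^+ 9 <= a * L ^+ 14 -> (a `^ 14%:R^-1)^-1 * n `^ (9%:R / 14%:R) <= L.
Proof.
move=> a0 n0 L0 h.
have t0 : 0 <= 14%:R^-1 :> R by rewrite invr_ge0.
have e0 : 0 < a `^ 14%:R^-1 by rewrite powR_gt0.
rewrite mulrC ler_pdivrMr // powRrM powR_mulrn //.
apply: le_trans (ge0_ler_powR t0 _ _ h) _; rewrite ?nnegrE ?exprn_ge0 //.
  by rewrite mulr_ge0 ?exprn_ge0 // ltW.
rewrite powRM ?exprn_ge0 ?(ltW a0) //.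
by rewrite -(powR_mulrn 14 L0) -powRrM divff ?pnatr_eq0 // powRr1 // mulrC.
Qed.

Theorem corollary2 (R : realType) :
  exists2 c : R, 0 < c &
    forall (T : finType) (e : rel T),
      simple_graph e -> connected_graph e -> vertex_transitive e ->
      (3 <= #|T|)%N ->
      (exists2 s : seq T, graph_cycle e s &
         c * (#|T|%:R `^ (9%:R / 14%:R)) <= (size s)%:R) /\
      (exists x : T, exists2 p : seq T, graph_path e x p &
         c * (#|T|%:R `^ (9%:R / 14%:R)) <= (size p)%:R).
Proof.
have [K HK] := long_cycle.
(* The successor makes the constant positive even if [K] is 0. *)
pose a : R := (K.+1)%:R; have a0 : 0 < a by rewrite ltr0Sn.
(* The factor 1/2 is for the path: dropping the closing edge of a cycle of length L leaves L - 1 >=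
   L/2 edges. *)
exists (2%:R^-1 * (a `^ 14%:R^-1)^-1); first by rewrite mulr_gt0 ?invr_gt0 ?powR_gt0.
move=> T e simple conn trans T3.
have [c [cU c3 hc]] := HK T e simple conn trans T3.
have half : 2%:R^-1 * (a `^ 14%:R^-1)^-1 * #|T|%:R `^ (9%:R / 14%:R) <= 2%:R^-1 * (size c)%:R :> R.
  rewrite -mulrA ler_pM2l ?invr_gt0 //; apply: powR_ratio_le => //.
  rewrite /a -!natrX -natrM ler_nat; apply: leq_trans hc _.
  by rewrite leq_mul2r leqnSn orbT.
have c0 : 0 <= (size c)%:R :> R by [].
split; first by exists c => //; apply: le_trans half _; lra.
case: c cU c3 {hc} half c0 => [|x p] // cU c3 half _.
exists x, p; last first.
  have : 1 <= (size p)%:R :> R by rewrite ler1n ltnW.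
  by move: half; rewrite /= -[(size p).+1%:R]natr1; lra.
have /andP[] := cU; rewrite /= rcons_path => /andP[pa _] un.
by split.
Qed.
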